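(* Let $v$ be a 1-singular Gelfand--Tsetlin tableau of height $n$, with singular pair $(k,i),(k,j)$, satisfying the conventions of the context. If $W_{rs}=W_{rs}^{(1)}$ for all $(r,s)\notin\{(k,i),(k,j)\}$ with $1\le s\le r\le n-1$, then the $\mathrm U_q$-module $\overline V(T(v))=\mathrm U_q(T(v))\big/\sum_{r,s}W_{rs}$ is simple.
   Context: Let $n\ge3$, $m\ge3$ odd, $\theta=2\pi/m$, $q=e^{\mathbf i\theta}$, $\mathbf i=\sqrt{-1}$. For $x\in\mathbb C$: $q^x=e^{\mathbf i\theta x}$, $[x]_q=\frac{q^x-q^{-x}}{q-q^{-1}}$; $\mathbb Z_m=\mathbb Z/m\mathbb Z$. $\mathrm U_q=\mathrm U_q(\mathfrak{gl}_n)$ is the unital associative $\mathbb C$-algebra generated by $E_i,F_i$ ($1\le i\le n-1$), $K_j^{\pm1}$ ($1\le j\le n$) with relations: the $K_j$ commute and are invertible; $K_iE_jK_i^{-1}=q^{\delta_{ij}-\delta_{i,j+1}}E_j$; $K_iF_jK_i^{-1}=q^{\delta_{i,j+1}-\delta_{ij}}F_j$; $[E_i,F_j]=\delta_{ij}\frac{K_iK_{i+1}^{-1}-K_{i+1}K_i^{-1}}{q-q^{-1}}$; $[E_i,E_j]=[F_i,F_j]=0$ for $|i-j|\ge2$; $E_i^2E_{i\pm1}-(q+q^{-1})E_iE_{i\pm1}E_i+E_{i\pm1}E_i^2=0$ and the same with $F$. A Gelfand--Tsetlin tableau is an array $v=(v_{ab})_{1\le b\le a\le n}$ of complex numbers;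 $\delta^{ab}$ is the array with $1$ at $(a,b)$ and $0$ elsewhere. $v$ is 1-singular if there are $1\le i<j\le k\le n-1$ with $v_{ki}-v_{kj}\in\frac{\mathbb Z}2$ while $v_{rs}-v_{rt}\notin\frac{\mathbb Z}2$ for every other pair of entries in the same row $r\le n-1$. Conventions: for all positions, $v_{ab}-v_{cd}\in\mathbb Z$ or $v_{ab}-v_{cd}\notin\frac{\mathbb Z}2$; and the base tableau is normalized so that $v_{ki}=v_{kj}$. Index set: arrays $z=(z_{rs})_{1\le s\le r\le n}$ with $z_{ns}=0$, $z_{ki},z_{kj}\in\mathbb Z_m$ and $z_{rs}\in\mathbb Z$ for the other positions $r\le n-1$. $\tau(z)$ is $z$ with $z_{ki}$ and $z_{kj}$ interchanged. $V(T(v))$ is the $\mathbb C$-vector space spanned by symbols $T(v+z)$, $\mathcal DT(v+z)$, subject only to $T(v+z)=T(v+\tau(z))$ and $\mathcal DT(v+z)+\mathcal DT(v+\tau(z))=0$. Module structure on $V(T(v))$: let $x,y$ be variables, $v(x,y)=v+x\delta^{ki}+y\delta^{kj}$, $\mathbb K$ the field of rational functions in $q^x,q^y$, and $V(T(v(x,y)))$ the $\mathbb K$-vector space with basis $T(v(x,y)+z)$, a $\mathrm U_q$-module via: for $w=v(x,y)+z$, $K_rT(w)=q^{a_r}T(w)$, $a_r=\sum_{s=1}^rw_{r,s}-\sum_{s=1}^{r-1}w_{r-1,s}+r$; $E_rT(w)=-\sum_{s=1}^r\frac{\prod_{t=1}^{r+1}[w_{r,s}-w_{r+1,t}]_q}{\prod_{t\ne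 s}[w_{r,s}-w_{r,t}]_q}T(w+\delta^{rs})$; $F_rT(w)=\sum_{s=1}^r\frac{\prod_{t=1}^{r-1}[w_{r,s}-w_{r-1,t}]_q}{\prod_{t\ne s}[w_{r,s}-w_{r,t}]_q}T(w-\delta^{rs})$. For $f\in\mathbb K$ holomorphic near $x=y=0$ put $\mathcal D^v(f)=\frac{q-q^{-1}}{4\mathbf i\theta}\left(\frac{\partial f}{\partial x}-\frac{\partial f}{\partial y}\right)\big|_{x=y=0}$, let $f(v)$ be its value at $x=y=0$, and extend $\mathbb C$-linearly $\mathcal D^v(fT(v(x,y)+z))=\mathcal D^v(f)T(v+z)+f(v)\mathcal DT(v+z)$. The generators $u\in\{E_r,F_r,K_r^{\pm1}\}$ act on $V(T(v))$ by $u(T(v+z))=\mathcal D^v([x-y]_q\,u(T(v(x,y)+z)))$ and, for $z'\ne\tau(z')$, $u(\mathcal DT(v+z'))=\mathcal D^v(u(T(v(x,y)+z')))$. (This is a $\mathrm U_q$-module.) Quotient: $\mathrm U_q(T(v))$ is the submodule of $V(T(v))$ generated by $T(v)$. For $(r,s)\notin\{(k,i),(k,j)\}$, $1\le s\le r\le n-1$, let $t$ ($s\le t\le r$) be determined by $v_{rs}=v_{r-1,s}=\dots=v_{ts}\ne v_{t-1,s}$ (with $t=s$ if all of $v_{rs},\dots,v_{ss}$ are equal). $W_{rs}^{(1)}$ is the submodule of $\mathrm U_q(T(v))$ generated by $T(v-m\delta^{rs}-m\delta^{r-1,s}-\dots-m\delta^{ts})-T(v)$ (shifts by $m$ at $(k,i),(k,j)$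 are trivial); it is assumed, as part of the construction, that these vectors lie in $\mathrm U_q(T(v))$. In the general construction $W_{rs}=W_{rs}^{(1)}$ if $v_{r+1,s}\ne v_{rs}$, and if $v_{r+1,s}=v_{rs}$ then $W_{rs}$ is either $W_{rs}^{(1)}$ or the submodule $W_{rs}^{(2)}$ generated by $T(v-m\delta^{rs}-\dots-m\delta^{ts})$. The sum $\sum_{r,s}W_{rs}$ is over all $(r,s)\notin\{(k,i),(k,j)\}$, $1\le s\le r\le n-1$. *)

(* Defs.v *)
(* The field of complex numbers is R[i] for R : realType. *)
From HB Require Import structures.
From mathcomp Require Import all_boot all_order all_algebra.
From mathcomp Require Import all_classical all_reals all_analysis.
From mathcomp Require Import complex polyXY freeg ring_quotient.

Set Implicit Arguments.
Unset Strict Implicit.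
Unset Printing Implicit Defensive.

Import Order.TTheory GRing.Theory Num.Theory.
Import numFieldNormedType.Exports.
Local Open Scope classical_set_scope.
Local Open Scope ring_scope.
Local Open Scope quotient_scope.
Local Open Scope complex_scope.

Section Subspace.
Variables (C : fieldType) (V : lmodType C).

Definition is_subspace (S : set V) : Prop :=
  S 0 /\ forall (a : C) x y, S x -> S y -> S (a *: x + y).

Record subspace := Subspace {
  sub_set :> V -> Prop;
  sub_setP : is_subspace sub_set }.

Definition sub_mem (S : subspace) : {pred V} := fun x => `[< S x >].

Fact sub_mem_closed S : GRing.submod_closed (sub_mem S).
Proof.
case: (sub_setP S) => S0 SD; split=> [|a x y /asboolP hx /asboolP hy].
  exact/asboolP.
by apply/asboolP/SD.
Qed.

HB.instance Definition _ S :=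
  GRing.isSubmodClosed.Build C V (sub_mem S) (sub_mem_closed S).

Definition linspan_set (A : set V) : set V :=
  [set x | forall S : subspace, A `<=` sub_set S -> S x].

Fact linspan_setP A : is_subspace (linspan_set A).
Proof.
split=> [S _|a x y hx hy S AS]; case: (sub_setP S) => // _; apply.
  exact: hx.
exact: hy.
Qed.

Definition linspan (A : set V) : subspace := Subspace (linspan_setP A).

End Subspace.

Section LinearQuotient.
Variables (C : fieldType) (V : lmodType C) (S : subspace V).

Definition lquot : Type := Quotient.quot (sub_mem S).
HB.instance Definition _ := GRing.Zmodule.on lquot.

Definition lquot_pi (x : V) : lquot := \pi_(Quotient.quot (sub_mem S)) x.
Definition lquot_repr (x : lquot) : V := repr (x : Quotient.quot (sub_mem S)).

Lemma lquot_reprK x : lquot_pi (lquot_repr x) = x.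
Proof. exact: reprK. Qed.

Lemma lquot_eqP x y : reflect (lquot_pi x = lquot_pi y) (x - y \in sub_mem S).
Proof. by rewrite Quotient.idealrBE; apply: eqP. Qed.

Lemma lquot_piD x y : lquot_pi (x + y) = lquot_pi x + lquot_pi y.
Proof. exact: raddfD. Qed.

Definition lquot_scale (a : C) (x : lquot) : lquot :=
  lquot_pi (a *: lquot_repr x).

Lemma lquot_scaleE a x : lquot_scale a (lquot_pi x) = lquot_pi (a *: x).
Proof.
by apply/lquot_eqP; rewrite -scalerBr rpredZ //; apply/lquot_eqP/lquot_reprK.
Qed.

Fact lquot_scaleA a b x :
  lquot_scale a (lquot_scale b x) = lquot_scale (a * b) x.
Proof. by rewrite -[x]lquot_reprK !lquot_scaleE scalerA. Qed.

Fact lquot_scale1 : left_id 1 lquot_scale.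
Proof. by move=> x; rewrite -[x]lquot_reprK lquot_scaleE scale1r. Qed.

Fact lquot_scaleDr : right_distributive lquot_scale +%R.
Proof.
move=> a x y; rewrite -[x]lquot_reprK -[y]lquot_reprK -lquot_piD !lquot_scaleE.
by rewrite scalerDr lquot_piD.
Qed.

Fact lquot_scaleDl x : {morph lquot_scale^~ x : a b / a + b}.
Proof.
by move=> a b; rewrite -[x]lquot_reprK !lquot_scaleE scalerDl lquot_piD.
Qed.

HB.instance Definition _ := GRing.Zmodule_isLmodule.Build C lquot
  lquot_scaleA lquot_scale1 lquot_scaleDr lquot_scaleDl.

Lemma lquot_pi_linear : linear lquot_pi.
Proof. by move=> a x y; rewrite lquot_piD -lquot_scaleE. Qed.

HB.instance Definition _ :=
  GRing.isLinear.Build C V lquot *:%R lquot_pi lquot_pi_linear.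

End LinearQuotient.

(* The index is 1-based; see valid_gen for its range. UKi r is K_r^{-1}. *)
Inductive Ugen := UE of nat | UF of nat | UK of nat | UKi of nat.

Definition valid_gen (n : nat) (g : Ugen) : bool :=
  match g with
  | UE r | UF r => (1 <= r < n)%N
  | UK r | UKi r => (1 <= r <= n)%N
  end.

Section Uq.
Variables (C : fieldType) (n : nat) (q : C).

(* A list of pairs (coefficient, word) stands for an element of the free
   algebra on the generators; Uq_rel lists the elements that vanish in U_q. *)
Definition free_elt := seq (C * seq Ugen).

Inductive Uq_rel : free_elt -> Prop :=
| rel_KV j of (1 <= j <= n)%N :
    Uq_rel [:: (1, [:: UK j; UKi j]); (-1, [::])]
| rel_VK j of (1 <= j <= n)%N :
    Uq_rel [:: (1, [:: UKi j; UK j]); (-1, [::])]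
| rel_KK i j of (1 <= i <= n)%N & (1 <= j <= n)%N :
    Uq_rel [:: (1, [:: UK i; UK j]); (-1, [:: UK j; UK i])]
| rel_KE i j of (1 <= i <= n)%N & (1 <= j < n)%N :
    Uq_rel [:: (1, [:: UK i; UE j; UKi i]);
               (- q ^ ((i == j)%:Z - (i == j.+1)%:Z), [:: UE j])]
| rel_KF i j of (1 <= i <= n)%N & (1 <= j < n)%N :
    Uq_rel [:: (1, [:: UK i; UF j; UKi i]);
               (- q ^ ((i == j.+1)%:Z - (i == j)%:Z), [:: UF j])]
| rel_EF i j of (1 <= i < n)%N & (1 <= j < n)%N :
    Uq_rel [:: (1, [:: UE i; UF j]); (-1, [:: UF j; UE i]);
               (- ((i == j)%:R / (q - q^-1)), [:: UK i; UKi i.+1]);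
               ((i == j)%:R / (q - q^-1), [:: UK i.+1; UKi i])]
| rel_EE i j of (1 <= i < n)%N & (1 <= j < n)%N & (i.+2 <= j)%N || (j.+2 <= i)%N :
    Uq_rel [:: (1, [:: UE i; UE j]); (-1, [:: UE j; UE i])]
| rel_FF i j of (1 <= i < n)%N & (1 <= j < n)%N & (i.+2 <= j)%N || (j.+2 <= i)%N :
    Uq_rel [:: (1, [:: UF i; UF j]); (-1, [:: UF j; UF i])]
| rel_SerreE i j of (1 <= i < n)%N & (1 <= j < n)%N & (j == i.+1) || (i == j.+1) :
    Uq_rel [:: (1, [:: UE i; UE i; UE j]);
               (- (q + q^-1), [:: UE i; UE j; UE i]);
               (1, [:: UE j; UE i; UE i])]
| rel_SerreF i j of (1 <= i < n)%N & (1 <= j < n)%N & (j == i.+1) || (i == j.+1) :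
    Uq_rel [:: (1, [:: UF i; UF i; UF j]);
               (- (q + q^-1), [:: UF i; UF j; UF i]);
               (1, [:: UF j; UF i; UF i])].

Definition word_act (V : lmodType C) (act : Ugen -> V -> V) (w : seq Ugen)
  (x : V) : V := foldr act x w.

Definition free_act (V : lmodType C) (act : Ugen -> V -> V) (e : free_elt)
  (x : V) : V := \sum_(cw <- e) cw.1 *: word_act act cw.2 x.

(* By the presentation of U_q, a U_q-module structure on V is a family of
   linear operators, one for each generator, satisfying the relations.
   Values of act at generators outside the valid range are irrelevant. *)
Record is_Uq_action (V : lmodType C) (act : Ugen -> V -> V) : Prop := {
  Uq_linear : forall g, valid_gen n g -> linear (act g);
  Uq_relations : forall e, Uq_rel e -> forall x, free_act act e x = 0 }.

Record Uq_module := UqModule {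
  Uq_car :> lmodType C;
  Uq_act : Ugen -> Uq_car -> Uq_car;
  Uq_actP : is_Uq_action Uq_act }.

Lemma Uq_rel_valid e : Uq_rel e ->
  all (fun cw => all (valid_gen n) cw.2) e.
Proof.
by case=> /=; do ?[move=> j ->]; do ?[move=> i j /andP[i1 ilt] /andP[j1 jlt]];
  rewrite ?i1 ?ilt ?j1 ?jlt ?(ltnW ilt) ?(ltnW jlt).
Qed.

Lemma free_act_morph (V W : lmodType C) (f : {linear V -> W})
    (actV : Ugen -> V -> V) (actW : Ugen -> W -> W) :
    (forall g, valid_gen n g -> forall x, f (actV g x) = actW g (f x)) ->
  forall e x, Uq_rel e -> f (free_act actV e x) = free_act actW e (f x).
Proof.
move=> fact e x /Uq_rel_valid; rewrite /free_act.
elim: e => [|[c w] e IH] /=; first by rewrite !big_nil raddf0.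
case/andP=> vw ve; rewrite !big_cons linearD linearZ /= IH //.
congr (_ *: _ + _); elim: w vw => //= g w IHw /andP[vg vw].
by rewrite fact // IHw.
Qed.

Record Uq_submodule (M : Uq_module) := UqSubmodule {
  usub_space :> subspace M;
  usub_stable : forall g, valid_gen n g ->
    forall x, usub_space x -> usub_space (Uq_act g x) }.

Section Constructions.
Variable M : Uq_module.

Section SubQuo.
Variable S : Uq_submodule M.

Record usub_type := USub { usub_val :> M; _ : sub_mem S usub_val }.
HB.instance Definition _ := [isSub for usub_val].
HB.instance Definition _ := [Choice of usub_type by <:].
HB.instance Definition _ := [SubChoice_isSubLmodule of usub_type by <:].

(* For valid g the default value x of insubd is never used. *)
Definition usub_act (g : Ugen) (x : usub_type) : usub_type :=
  insubd x (Uq_act g (val x)).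

Lemma val_usub_act g : valid_gen n g -> forall x,
  val (usub_act g x) = Uq_act g (val x).
Proof.
move=> vg x; rewrite /usub_act insubdK //; apply/asboolP/usub_stable => //.
exact/asboolP/(valP x).
Qed.

Lemma usub_val_linear : linear (val : usub_type -> M).
Proof. by move=> a x y; rewrite linearP. Qed.

Fact usub_actP : is_Uq_action usub_act.
Proof.
split=> [g vg a x y|e re x]; apply: val_inj.
  rewrite val_usub_act // !usub_val_linear !val_usub_act //.
  exact: (Uq_linear (Uq_actP M) vg).
rewrite (free_act_morph (f := val) val_usub_act) //.
by rewrite (Uq_relations (Uq_actP M)) // raddf0.
Qed.

Definition usub_module : Uq_module := UqModule usub_actP.

Definition uquot_act (g : Ugen) (x : lquot S) : lquot S :=
  lquot_pi S (Uq_act g (lquot_repr x)).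

Lemma uquot_actE g : valid_gen n g -> forall x,
  lquot_pi S (Uq_act g x) = uquot_act g (lquot_pi S x).
Proof.
move=> vg x; apply/esym; apply/lquot_eqP.
have -> (y z : M) : Uq_act g y - Uq_act g z = Uq_act g (y - z).
  by rewrite addrC -scaleN1r -(Uq_linear (Uq_actP M) vg) scaleN1r addrC.
apply/asboolP/usub_stable => //; apply/asboolP.
exact/lquot_eqP/lquot_reprK.
Qed.

Fact uquot_actP : is_Uq_action uquot_act.
Proof.
split=> [g vg a x y|e re x].
  rewrite -[x]lquot_reprK -[y]lquot_reprK -linearP -!uquot_actE //.
  by rewrite (Uq_linear (Uq_actP M) vg) linearP.
rewrite -[x]lquot_reprK -(free_act_morph (f := lquot_pi S) uquot_actE) //.
by rewrite (Uq_relations (Uq_actP M)) // raddf0.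
Qed.

Definition uquot_module : Uq_module := UqModule uquot_actP.

End SubQuo.

Definition ugen_set (A : set M) : set M :=
  [set x | forall N : Uq_submodule M, A `<=` sub_set N -> N x].

Fact ugen_subspace A : is_subspace (ugen_set A).
Proof.
split=> [N _|a x y hx hy N AN]; case: (sub_setP N) => // _; apply.
  exact: hx.
exact: hy.
Qed.

Fact ugen_stable A g : valid_gen n g ->
  forall x, ugen_set A x -> ugen_set A (Uq_act g x).
Proof. by move=> vg x hx N AN; apply: usub_stable => //; apply: hx. Qed.

Definition ugen (A : set M) : Uq_submodule M :=
  @UqSubmodule M (Subspace (ugen_subspace A)) (@ugen_stable A).

Section Sum.
Variables (I : finType) (W : I -> Uq_submodule M).

Definition usum_set : set M :=
  [set x | exists y : I -> M, (forall p, W p (y p)) /\ x = \sum_p y p].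

Fact usum_subspace : is_subspace usum_set.
Proof.
split=> [|a _ _ [x [hx ->]] [y [hy ->]]].
  exists (fun=> 0); split=> [p|]; first by case: (sub_setP (W p)).
  by rewrite big1.
exists (fun p => a *: x p + y p); split=> [p|].
  by case: (sub_setP (W p)) => _; apply.
by rewrite scaler_sumr big_split.
Qed.

Lemma Uq_act_sum g (y : I -> M) : valid_gen n g ->
  Uq_act g (\sum_p y p) = \sum_p Uq_act g (y p).
Proof.
move=> vg; have lg := Uq_linear (Uq_actP M) vg.
have actD : {morph Uq_act (u := M) g : u w / u + w}.
  by move=> u w; rewrite -[u in LHS]scale1r lg scale1r.
apply: (big_morph _ actD); apply: (addrI (Uq_act g 0)).
by rewrite -actD !addr0.
Qed.

Fact usum_stable g : valid_gen n g ->
  forall x, usum_set x -> usum_set (Uq_act g x).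
Proof.
move=> vg _ [x [hx ->]]; exists (fun p => Uq_act g (x p)).
by split=> [p|]; [apply: usub_stable | apply: Uq_act_sum].
Qed.

Definition usum : Uq_submodule M := @UqSubmodule M (Subspace usum_subspace) usum_stable.

End Sum.
End Constructions.

Definition Uq_simple (M : Uq_module) : Prop :=
  (exists x : M, x <> 0) /\
  forall N : Uq_submodule M, sub_set N = [set 0] \/ sub_set N = setT.

End Uq.

Section QNumbers.
Variables (R : realType) (m : nat).
Local Notation C := R[i].

Definition cexp (z : C) : C :=
  (expR (complex.Re z))%:C * (cos (complex.Im z) +i* sin (complex.Im z)).

Definition theta : C := (2 * pi / m%:R)%:C.
Definition qpow (x : C) : C := cexp ('i * theta * x).
Definition qroot : C := qpow 1.

(* 'X stands for q^x and 'Y for q^y. *)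
Definition ratK := {fraction {poly {poly C}}}.
Definition Kconst (c : C) : ratK := tofrac (c%:P%:P).
Definition Kx : ratK := tofrac 'X.
Definition Ky : ratK := tofrac 'Y.

(* (c, (a, b)) stands for c + a x + b y. *)
Definition affine := (C * (int * int))%type.

Definition qpowK (w : affine) : ratK := Kconst (qpow w.1) * Kx ^ w.2.1 * Ky ^ w.2.2.

Definition qnumK (w : affine) : ratK :=
  (qpowK w - qpowK (- w)) / Kconst (qroot - qroot^-1).

(* f is holomorphic near x = y = 0 iff it has a fraction P / Q whose
   denominator does not vanish at q^x = q^y = 1. *)
Definition regular_fraction (f : ratK) (PQ : {poly {poly C}} * {poly {poly C}}) :=
  PQ.2.[1, 1] != 0 /\ f = tofrac PQ.1 / tofrac PQ.2.

(* The function of x, y defined by f; junk if f is not holomorphic near 0. *)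
Definition Kfun (f : ratK) (x y : C) : C :=
  let PQ := xget (0, 1) [set PQ | regular_fraction f PQ] in
  PQ.1.[qpow x, qpow y] / PQ.2.[qpow x, qpow y].

Definition Kval (f : ratK) : C := Kfun f 0 0.

(* derive1 is the complex derivative: the base field is C. *)
Definition Dv (f : ratK) : C :=
  (qroot - qroot^-1) / (4 * 'i * theta) *
  (derive1 ((fun x => Kfun f x 0) : C -> C^o) 0 -
   derive1 ((fun y => Kfun f 0 y) : C -> C^o) 0).

End QNumbers.

Section Tableaux.
Variables (R : realType) (n m k i j : nat).
Local Notation C := R[i].
Local Notation K := (ratK R).

(* Only the entries v a b with 1 <= b <= a <= n are used. *)
Variable v : nat -> nat -> C.

Definition is_integer (x : C) : Prop := exists p : int, x = p%:~R.
Definition half_integer (x : C) : Prop := exists p : int, x = p%:~R / 2.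

Definition one_singular : Prop :=
  [/\ (1 <= i)%N, (i < j)%N, (j <= k)%N, (k < n)%N &
   half_integer (v k i - v k j) /\
   forall r s t, (1 <= s <= r)%N -> (1 <= t <= r)%N -> (r < n)%N -> s != t ->
     (r, s, t) \notin [:: (k, i, j); (k, j, i)] ->
     ~ half_integer (v r s - v r t)].

Definition GT_convention : Prop :=
  forall a b c d, (1 <= b <= a)%N -> (a <= n)%N -> (1 <= d <= c)%N -> (c <= n)%N ->
    is_integer (v a b - v c d) \/ ~ half_integer (v a b - v c d).

(* Positions (r, s), 1 <= s <= r <= n-1, other than (k, i) and (k, j). *)
Definition regular_pos : pred ('I_n * 'I_n) :=
  [pred p : 'I_n * 'I_n | (1 <= p.2 <= p.1)%N &&
            ((p.1 : nat, p.2 : nat) \notin [:: (k, i); (k, j)])].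
Definition rpos := {p : 'I_n * 'I_n | regular_pos p}.
Definition pos_row (p : rpos) : nat := (val p).1.
Definition pos_col (p : rpos) : nat := (val p).2.

(* z is given by its integer entries at the positions in rpos and by the pair
   (z_ki, z_kj); the entries in row n are 0. 'Z_m is Z/mZ since 1 < m. *)
Definition GTindex := ({ffun rpos -> int} * ('Z_m * 'Z_m))%type.

Definition tau (z : GTindex) : GTindex := (z.1, (z.2.2, z.2.1)).

Definition delta (r s : nat) : GTindex :=
  ([ffun p => ((pos_row p, pos_col p) == (r, s))%:R],
   (((r, s) == (k, i))%:R, ((r, s) == (k, j))%:R)).

(* The representatives in {0, ..., m-1} are used for z_ki and z_kj; only powers
   of q are formed from them, so any other choice gives the same formulas. *)
Definition entry (z : GTindex) (r s : nat) : int :=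
  if (r, s) == (k, i) then (z.2.1 : nat)%:Z
  else if (r, s) == (k, j) then (z.2.2 : nat)%:Z
  else if [pick p : rpos | (pos_row p, pos_col p) == (r, s)] is Some p then z.1 p
  else 0.

Definition freeVT := {freeg (GTindex + GTindex)%type / C}.
Definition freeT (z : GTindex) : freeVT := << inl z >>.
Definition freeDT (z : GTindex) : freeVT := << inr z >>.

Definition VT_relations : set freeVT :=
  [set x | (exists z, x = freeT z - freeT (tau z)) \/
           (exists z, x = freeDT z + freeDT (tau z))].

Definition VT := lquot (linspan VT_relations).
HB.instance Definition _ := GRing.Lmodule.on VT.

(* tabT z is T(v+z), tabDT z is DT(v+z). *)
Definition tabT (z : GTindex) : VT := lquot_pi (linspan VT_relations) (freeT z).
Definition tabDT (z : GTindex) : VT := lquot_pi (linspan VT_relations) (freeDT z).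

(* The entries of v(x,y) + z. *)
Definition generic_entry (z : GTindex) (r s : nat) : affine R :=
  (v r s + (entry z r s)%:~R,
   (((r, s) == (k, i))%:R, ((r, s) == (k, j))%:R)).

(* The basis element << z >> stands for T(v(x,y)+z). *)
Definition genericVT := {freeg GTindex / K}.

Definition generic_weight (z : GTindex) (r : nat) : affine R :=
  let w := generic_entry z in
  \sum_(1 <= s < r.+1) w r s - \sum_(1 <= s < r) w r.-1 s + (r%:R, 0).

Definition generic_act (g : Ugen) (z : GTindex) : genericVT :=
  let w := generic_entry z in
  match g with
  | UE r => - \sum_(1 <= s < r.+1)
      << (\prod_(1 <= t < r.+2) qnumK m (w r s - w r.+1 t)) /
         (\prod_(1 <= t < r.+1 | t != s) qnumK m (w r s - w r t))
         *g z + delta r s >>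
  | UF r => \sum_(1 <= s < r.+1)
      << (\prod_(1 <= t < r) qnumK m (w r s - w r.-1 t)) /
         (\prod_(1 <= t < r.+1 | t != s) qnumK m (w r s - w r t))
         *g z - delta r s >>
  | UK r => << qpowK m (generic_weight z r) *g z >>
  | UKi r => << qpowK m (- generic_weight z r) *g z >>
  end.

Definition DvT (u : genericVT) : VT :=
  \sum_(z <- dom u)
    (Dv m (coeff z u) *: tabT z + Kval m (coeff z u) *: tabDT z).

(* [x - y]_q *)
Definition qnum_xy : K := qnumK m (0, (1, -1)).

Definition is_GT_action (act : Ugen -> VT -> VT) : Prop :=
  forall g, valid_gen n g ->
    (forall z, act g (tabT z) = DvT (qnum_xy *: generic_act g z)) /\
    (forall z, z <> tau z -> act g (tabDT z) = DvT (generic_act g z)).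

(* The t with v_rs = v_{r-1,s} = ... = v_ts != v_{t-1,s}, and t = s if all of
   v_rs, ..., v_ss are equal. *)
Fixpoint chain_start (r s : nat) : nat :=
  if r is r'.+1 then
    if (s <= r')%N && (v r s == v r' s) then chain_start r' s else r
  else 0%N.

(* T(v - m delta^{rs} - m delta^{r-1,s} - ... - m delta^{ts}) *)
Definition tab_chain (p : rpos) : VT :=
  tabT (- \sum_(chain_start (pos_row p) (pos_col p) <= a < (pos_row p).+1)
            delta a (pos_col p) *+ m).

Section Quotient.
Variables (act : Ugen -> VT -> VT) (actP : is_Uq_action n (qroot R m) act).

Definition VT_module : Uq_module n (qroot R m) := UqModule actP.

Definition UqT_submodule : Uq_submodule VT_module :=
  ugen [set (tabT 0 : VT_module)].

(* U_q(T(v)) *)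
Definition UqT : Uq_module n (qroot R m) := usub_module UqT_submodule.

Definition UqT_val (y : UqT) : VT := usub_val (y : usub_type UqT_submodule).

Definition chains_in_UqT : Prop :=
  forall p : rpos, UqT_submodule (tab_chain p - tabT 0).

(* Under chains_in_UqT the generating set is the single vector
   tab_chain p - T(v), viewed in U_q(T(v)); likewise for W2. *)
Definition W1 (p : rpos) : Uq_submodule UqT :=
  ugen [set y : UqT | UqT_val y = tab_chain p - tabT 0].

Definition W2 (p : rpos) : Uq_submodule UqT :=
  ugen [set y : UqT | UqT_val y = tab_chain p].

Definition W_choice (W : rpos -> Uq_submodule UqT) : Prop :=
  forall p, W p = W1 p \/
    (v (pos_row p).+1 (pos_col p) = v (pos_row p) (pos_col p) /\ W p = W2 p).

Definition Vbar (W : rpos -> Uq_submodule UqT) : Uq_module n (qroot R m) :=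
  uquot_module (usum W).

End Quotient.
End Tableaux.

(* Main.v *)
From HB Require Import structures.
From mathcomp Require Import all_boot all_order all_algebra.
From mathcomp Require Import all_classical all_reals all_analysis.
From mathcomp Require Import complex polyXY freeg.
From mathcomp Require Import ring lra.
Require Import Defs.
Set Implicit Arguments.
Unset Strict Implicit.
Unset Printing Implicit Defensive.
Import Order.TTheory GRing.Theory Num.Theory.
Import numFieldNormedType.Exports.
Local Open Scope ring_scope.
Local Open Scope complex_scope.

(** Call a subspace of V(T(v)) good if it is stable under U_q and under all shifts
    by multiples of m at the positions other than (k, i) and (k, j). A good
    subspace contains, with a vector, its components on the classes of tableaux
    that agree modulo m on the rows <= r. This is proved by induction on r: in
    such a class the entries of the rows <= r can be lowered with F until an
    entry (r, s) can be lowered and raised again without meeting a zero or a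
    pole, and this round trip acts on T(w), up to a common factor, as the value
    at q^(2 v_rs) of the polynomial with the roots q^(2 w_(r+1,t)). The r values
    and K_(r+1), which gives the constant term, determine this polynomial, hence
    the row r + 1 modulo m. On the vectors DT the round trip has a nilpotent part
    with values in the T, which yields T from DT, while F_k yields DT from T at
    the pole w_ki = w_kj. So a good subspace containing some T(w) is everything.

    Let J be the sum of the W_rs inside U = U_q(T(v)). Shifts need not preserve
    U, but the shifts along chains are trivial on U modulo J and generate all
    shifts. Inverting them turns the submodules between J and U into good
    subspaces, and J itself into a good subspace modulo which every shift is
    trivial; a vector outside of J then produces some T(w). Finally J does not
    contain T(v), because the linear form T |-> 1, DT |-> 0 is invariant under
    shifts. *)

(** * The exponential *)

(** Since [x]_q vanishes exactly when 2x lies in mZ, 1-singularity leaves w_ki = w_kj as the only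
    pole of the action, and as m is odd it occurs only when z_ki = z_kj in Z_m. Because q^m = 1, the
    coefficients see residues modulo m only. Hence F alone reaches every residue by going round Z_m,
    and a path that is closed for the residues differs from the identity by a shift, which a good
    subspace absorbs. The E_r serve only in the round trips. The obstacle is DT. In round trips at
    rows r < k - 1 it behaves like T; at row k - 1 the derivative of the coefficient of E_(k-1) adds
    a multiple of [w_kj - w_ki]_q T, so that eigenspaces become generalized eigenspaces. From row k
    on, F_k mixes T and DT, and a mixed family cannot be carried along as a whole. It is first split
    into its T part and its DT part. Off the pole the nilpotent part gives T from DT; conversely DT
    comes from T by bringing the entry (k, j) to the pole, through it, and on round Z_m to its old
    place. *)

Section ComplexExponential.
Variable R : realType.
Local Notation C := R[i].

Lemma cexpD (z w : C) : cexp (z + w) = cexp z * cexp w.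
Proof.
case: z w => [a b] [c d]; rewrite /cexp /= expRD cosD sinD.
by apply/eqP; rewrite eq_complex /=; apply/andP; split; apply/eqP; ring.
Qed.

Lemma cexp0 : cexp (0 : C) = 1.
Proof. by rewrite /cexp /= expR0 cos0 sin0 mul1r. Qed.

Lemma cos_eq1 (t : R) : cos t = 1 -> exists p : int, t = p%:~R * (pi *+ 2).
Proof.
move=> ct; have pi2 : 0 < (pi : R) *+ 2 by rewrite mulrn_wgt0 ?pi_gt0.
pose p := Num.floor (t / (pi *+ 2)); exists p.
(* Reduction to 0 <= u < 2 pi. There cos u = 1 - 2 sin(u/2)^2 = 1 forces sin(u/2) = 0, while sin is
   positive between 0 and pi, so u = 0. *)
pose u := t - p%:~R * (pi *+ 2).
have cosP (x : R) (k : nat) : cos (x + (pi *+ 2) *+ k) = cos x.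
  by elim: k => [|k IH]; rewrite ?mulr0n ?addr0 // mulrSr addrA cosD2pi.
have cu : cos u = 1.
  rewrite -ct /u; case: {u}p => k.
    by rewrite -[in RHS](subrK ((pi *+ 2) *+ k) t) cosP -pmulrn mulr_natl.
  by rewrite NegzE mulrNz mulNr opprK -pmulrn mulr_natl cosP.
have /andP[fl fu] : p%:~R <= t / (pi *+ 2) < (p + 1)%:~R by rewrite floor_itv.
have u0 : 0 <= u by rewrite subr_ge0 -ler_pdivlMr.
have u2 : u < pi *+ 2.
  by rewrite ltrBlDl; move: fu; rewrite ltr_pdivrMr // intrD mulrDl mul1r.
apply/eqP; rewrite -subr_eq0 -/u; apply/negPn/negP => un0.
have up : 0 < u / 2 < pi.
  apply/andP; split; first by rewrite divr_gt0 // lt_def un0.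
  by rewrite ltr_pdivrMr // mulr_natr.
have := sin_gt0_pi up; rewrite lt_def => /andP[/negP s0 _]; apply: s0.
have : cos (u / 2 *+ 2) = 1 by rewrite -mulr_natr divfK // pnatr_eq0.
rewrite mulr2n cosD -!expr2 cos2sin2 => /eqP.
rewrite -addrA -opprD -mulr2n -subr_eq0 addrAC subrr add0r oppr_eq0.
by rewrite mulrn_eq0 /= expf_eq0.
Qed.

Lemma cexp_eq1 (z : C) : cexp z = 1 -> exists p : int, z = (p%:~R * (pi *+ 2))*i.
Proof.
case: z => a b; rewrite /cexp /= => /eqP.
rewrite eq_complex /= !mul0r subr0 addr0 => /andP[/eqP ec /eqP es].
have sb : sin b = 0 by apply/eqP; move/eqP: es; rewrite mulf_eq0 expR_eq0.
have : `|cos b| = 1 by apply: sin0cos1.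
have cp : 0 < cos b by rewrite -(pmulr_rgt0 _ (expR_gt0 a)) ec.
rewrite gtr0_norm // => c1; have [p ->] := cos_eq1 c1; exists p.
by move: ec; rewrite c1 mulr1 => /eqP; rewrite -[X in _ == X]expR0 => /eqP/expR_inj ->.
Qed.

End ComplexExponential.

(** * The complex derivative of the exponential at 0 *)

Section ExponentialDerivative.
Variable R : realType.
Local Notation C := R[i].

Lemma normr_sin_le (b : R) : `|sin b| <= `|b|.
Proof.
wlog b0 : b / 0 <= b.
  by move=> H; have [/H//|/ltW b0] := leP 0 b; rewrite -normrN -sinN -(normrN b) H ?oppr_ge0.
have [c _ ] := MVT_segment b0 (fun x _ => is_derive_sin x)
  (continuous_subspaceT (@continuous_sin R)).
rewrite sin0 !subr0 => ->; rewrite normrM ler_piMl ?normr_ge0 //.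
exact: cos_max.
Qed.

Lemma cos_near0 (b : R) : `|cos b - 1| <= b ^+ 2 / 2.
Proof.
have -> : cos b - 1 = - 2 * sin (b / 2) ^+ 2.
  by rewrite [in LHS](splitr b) cosD -!expr2 cos2sin2; ring.
rewrite normrM normrN normr_nat normrX.
have := normr_sin_le (b / 2).
rewrite -(ler_pXn2r (ltn0Sn 1)) ?nnegrE // -(normrX _ (b / 2)).
rewrite (@ger0_norm _ ((b / 2) ^+ 2)) ?sqr_ge0 // => h.
rewrite (_ : b ^+ 2 / 2 = 2 * ((b / 2) ^+ 2)); last by field.
by rewrite ler_pM2l.
Qed.

Lemma sin_near0 (b : R) : `|b| <= 1 -> `|sin b - b| <= b ^+ 2 / 2.
Proof.
wlog b0 : b / 0 <= b.
  move=> H; have [/H//|/ltW b0] := leP 0 b => b1.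
  have := H (- b); rewrite oppr_ge0 normrN sqrrN sinN -opprD normrN.
  exact.
move=> b1.
have dv (x : R) : is_derive x 1 (sin - id) (cos x - 1) by exact: is_deriveB.
have cts : continuous (sin - id : R -> R).
  by move=> x; apply/differentiable_continuous/derivable1_diffP; case: (dv x).
have [c] := MVT_segment b0 (fun x _ => dv x) (continuous_subspaceT cts).
rewrite in_itv /= => /andP[c0 cb].
rewrite !fctE sin0 !subr0 => ->; rewrite normrM.
apply: (@le_trans _ _ (b ^+ 2 / 2 * 1)); last by rewrite mulr1.
apply: ler_pM => //; apply: le_trans (cos_near0 c) _.
by rewrite ler_pM2r ?invr_gt0 // ler_pXn2r.
Qed.

(** The inequality 1 + x <= exp x at x = a and x = - a gives (1 - a) (exp a - 1 - a) <= a^2, and 1 -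
    a >= 1/2. *)
Lemma expR_near0 (a : R) : `|a| <= 1 / 2 -> `|expR a - 1 - a| <= 2 * a ^+ 2.
Proof.
rewrite ler_norml => /andP[a1 a2].
have h0 := expR_ge1Dx a; have h1 := expR_ge1Dx (- a).
rewrite ger0_norm ?subr_ge0; last by lra.
have e0 := expR_gt0 a.
have h2 : (1 - a) * expR a <= 1.
  have {2}<- : expR (- a) * expR a = 1 by rewrite -expRD addNr expR0.
  by rewrite ler_pM2r.
have : (1 - a) * (expR a - 1 - a) <= a ^+ 2 by rewrite expr2; lra.
have t0 : 0 <= expR a - 1 - a by lra.
have a3 : 0 <= 1 / 2 - a by lra.
have := mulr_ge0 t0 a3; rewrite expr2; lra.
Qed.

Lemma normc_le (a b : R) : `|a +i* b| <= (`|a| + `|b|)%:C.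
Proof.
rewrite (_ : a +i* b = a%:C + b%:C * 'i); last first.
  by apply/eqP; rewrite eq_complex /=; apply/andP; split; apply/eqP; ring.
apply: le_trans (ler_normD _ _) _; rewrite normrM.
have nr (x : R) : `|x%:C| = `|x|%:C by rewrite normc_def /= expr0n addr0 sqrtr_sqr.
by rewrite !nr (normc_def 'i) /= expr0n expr1n add0r sqrtr1 mulr1 rmorphD.
Qed.

(** [cexp] is assembled from real functions, so its complex derivative has to come from an estimate.
    A quadratic remainder at 0 is enough, as [Dv] differentiates at x = y = 0 only. *)
Lemma cexp_near0 (z : C) : `|z| <= 1 / 2 -> `|cexp z - 1 - z| <= 4 * `|z| ^+ 2.
Proof.
case: z => a b zle.
have zE : `|a +i* b| ^+ 2 = (a ^+ 2 + b ^+ 2)%:C by rewrite -add_Re2_Im2.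
have [ale ble] : `|a| <= 1 / 2 /\ `|b| <= 1 / 2.
  have h : a ^+ 2 + b ^+ 2 <= (1 / 2) ^+ 2.
    rewrite -lecR -zE (_ : ((1 / 2) ^+ 2)%:C = (1 / 2) ^+ 2).
      by rewrite ler_pXn2r ?nnegrE // divr_ge0.
    by rewrite rmorphXn /= rmorphM /= rmorphV ?unitfE ?pnatr_eq0 // rmorph_nat.
  split; rewrite -(ler_pXn2r (ltn0Sn 1)) ?nnegrE ?divr_ge0 // -normrX ger0_norm ?sqr_ge0 //.
    by have := sqr_ge0 b; lra.
  by have := sqr_ge0 a; lra.
rewrite zE (_ : cexp _ - 1 - _ = (expR a * cos b - 1 - a) +i* (expR a * sin b - b)); last first.
  by apply/eqP; rewrite eq_complex /cexp /=; apply/andP; split; apply/eqP; ring.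
apply: le_trans (normc_le _ _) _.
rewrite -(rmorph_nat (real_complex R) 4) -rmorphM lecR.
have h1 := expR_near0 ale; have h2 := cos_near0 b.
have h3 : `|sin b - b| <= b ^+ 2 / 2 by apply: sin_near0; lra.
have h4 := normr_sin_le b; have h5 := cos_max b.
have a2 : `|a| ^+ 2 = a ^+ 2 by rewrite -normrX ger0_norm ?sqr_ge0.
have b2 : `|b| ^+ 2 = b ^+ 2 by rewrite -normrX ger0_norm ?sqr_ge0.
have na := normr_ge0 a; have nb := normr_ge0 b.
have h6 : `|expR a - 1| <= 2 * `|a|.
  rewrite -(subrK a (_ - 1)); apply: le_trans (ler_normD _ _) _; nra.
have -> : expR a * cos b - 1 - a = (expR a - 1 - a) * cos b + (1 + a) * (cos b - 1) by ring.
have -> : expR a * sin b - b = (expR a - 1) * sin b + (sin b - b) by ring.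
apply: (@le_trans _ _ ((2 * a ^+ 2 * 1 + 3 / 2 * (b ^+ 2 / 2)) + (2 * `|a| * `|b| + b ^+ 2 / 2))); last by nra.
apply: lerD; apply: le_trans (ler_normD _ _) _; rewrite !normrM; apply: lerD => //.
- exact: ler_pM.
- apply: ler_pM => //; apply: le_trans (ler_normD _ _) _; rewrite normr1; lra.
- exact: ler_pM.
Qed.

Lemma is_derive_cexp0 (c : C) :
  is_derive (0 : C^o) (1 : C^o) (fun x => cexp (c * x) : C^o) c.
Proof.
suff H : ((fun h : C^o => h^-1 *: ((cexp (c * (h *: 1 + 0)) : C^o) - cexp (c * 0))) @ (0 : C^o)^' --> (c : C^o))%classic.
  apply: DeriveDef; first by apply/cvg_ex; exists c.
  exact: cvg_lim H.
apply/cvgrPdist_le => e e0; near=> h.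
have h0 : h != 0 by near: h; exact: nbhs_dnbhs_neq.
rewrite mulr0 cexp0 addr0 /GRing.scale /= mulr1.
have -> : c - h^-1 * (cexp (c * h) - 1) = - (h^-1 * (cexp (c * h) - 1 - c * h)).
  by field.
rewrite normrN normrM normfV ler_pdivrMl ?normr_gt0 //.
have K0 : 0 < 4 * `|c| ^+ 2 + 1 by rewrite ltr_wpDl // mulr_ge0 // exprn_ge0.
have K1 : 0 < 2 * (`|c| + 1) by rewrite mulr_gt0 // ltr_wpDl.
have c1 : 0 < `|c| + 1 by rewrite ltr_wpDl.
apply: le_trans (cexp_near0 _) _; rewrite normrM.
  apply: (@le_trans _ _ ((`|c| + 1) * `|h|)); first by rewrite ler_wpM2r // lerDl.
  rewrite mulrC -ler_pdivlMr //; near: h.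
  apply: dnbhs0_le; by rewrite divr_gt0 // divr_gt0.
rewrite exprMn mulrA [4 * _ * _]mulrC expr2 -mulrA ler_wpM2l //.
apply: (@le_trans _ _ ((4 * `|c| ^+ 2 + 1) * `|h|)).
  by rewrite mulrC ler_wpM2r // lerDl.
rewrite mulrC -ler_pdivlMr //; near: h; apply: dnbhs0_le; exact: divr_gt0.
Unshelve. all: by end_near. Qed.

End ExponentialDerivative.

(** * Powers of q and the zeros of [x]_q *)

Section QPowers.
Variables (R : realType) (m : nat).
Hypothesis m_ge3 : (3 <= m)%N.
Local Notation C := R[i].
Local Notation q := (qroot R m).
Implicit Types x y : C.

Lemma qpowD x y : qpow m (x + y) = qpow m x * qpow m y.
Proof. by rewrite /qpow mulrDr cexpD. Qed.

Lemma qpow0 : qpow m (0 : C) = 1.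
Proof. by rewrite /qpow mulr0 cexp0. Qed.

Lemma qpow_neq0 x : qpow m x != 0.
Proof.
apply/eqP => x0; have := qpowD x (- x).
by rewrite subrr qpow0 x0 mul0r => /eqP; rewrite oner_eq0.
Qed.

Lemma qpowN x : qpow m (- x) = (qpow m x)^-1.
Proof.
apply: (mulfI (qpow_neq0 x)).
by rewrite -qpowD subrr qpow0 mulfV // qpow_neq0.
Qed.

Lemma qpowMn x k : qpow m (x *+ k) = qpow m x ^+ k.
Proof. by elim: k => [|k IH]; rewrite ?qpow0 // mulrS qpowD IH exprS. Qed.

Lemma theta_neq0 : theta R m != 0.
Proof.
have pi0 := pi_gt0 R.
rewrite /theta eq_complex /= negb_and mulf_neq0 //; last first.
  by rewrite invr_eq0 pnatr_eq0 -lt0n (leq_trans _ m_ge3).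
by rewrite mulf_neq0 ?pnatr_eq0 // gt_eqF.
Qed.

Lemma qpow_m : qpow m (m%:R : C) = 1.
Proof.
rewrite /qpow /theta -mulrA -(rmorph_nat (real_complex R)) -rmorphM /=.
rewrite divfK ?pnatr_eq0 -?lt0n ?(leq_trans _ m_ge3) //.
by rewrite /cexp /= !mul0r !mul1r subr0 add0r expR0 mul1r mulr_natl cos2pi sin2pi.
Qed.

Lemma qpow_int_eq1 (d : int) : (m %| d)%Z -> qpow m (d%:~R : C) = 1.
Proof.
case/dvdzP => k ->; rewrite intrM mulrC.
have h (p : nat) : qpow m (m%:~R * p%:R : C) = 1.
  by rewrite mulr_natr qpowMn -pmulrn qpow_m expr1n.
case: k => p; first by rewrite -pmulrn h.
by rewrite NegzE mulrNz mulrN qpowN -pmulrn h invr1.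
Qed.

Lemma qpow_eq1 x : qpow m x = 1 -> exists p : int, x = (p * m%:Z)%:~R.
Proof.
move=> /cexp_eq1[p e]; exists p.
have tn := theta_neq0.
have m0 : (m%:R : C) != 0 by rewrite pnatr_eq0 -lt0n (leq_trans _ m_ge3).
have e2 : theta R m * m%:R = (pi *+ 2)%:C.
  rewrite /theta -(rmorph_nat (real_complex R)) -rmorphM /=.
  by rewrite divfK ?mulr_natl // pnatr_eq0 -lt0n (leq_trans _ m_ge3).
apply: (mulfI tn); apply: (@mulfI _ ('i : C)).
  by rewrite eq_complex /= oner_eq0 andbF.
rewrite mulrA e rmorphM /= -pmulrn mulrC.
rewrite -(rmorph_int (real_complex R)) [RHS]mulrC.
rewrite [p%:~R%:C * _]mulrC [theta R m * _]mulrA e2 -rmorphM /=.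
by apply/eqP; rewrite eq_complex /=; apply/andP; split; apply/eqP; ring.
Qed.

Lemma qpow2_neq1 : qpow m (2 : C) != 1.
Proof.
apply/eqP => /qpow_eq1[p] /eqP; rewrite -[2]/(2%:Z%:~R) eqr_int => /eqP e.
move: m_ge3; have : (m%:Z %| 2)%Z by apply/dvdzP; exists p.
by rewrite /dvdz /= => /dvdn_leq -/(_ isT) h1 h2; have := leq_trans h2 h1.
Qed.

Lemma qdiff_neq0 : q - q^-1 != 0.
Proof.
have q0 : q != 0 by apply: qpow_neq0.
apply: contra qpow2_neq1 => /eqP h.
rewrite -[2]/(1 + 1) qpowD -/q -[X in _ == X](mulfV q0).
by apply/eqP; congr (_ * _); apply/eqP; rewrite -subr_eq0 h.
Qed.

Definition qnum x : C := (qpow m x - qpow m (- x)) / (q - q^-1).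

Lemma qnum_eq0 x : (qnum x == 0) = (qpow m (2 * x) == 1).
Proof.
rewrite /qnum mulf_eq0 invr_eq0 (negPf qdiff_neq0) orbF subr_eq0 qpowN.
rewrite mulr_natl mulr2n qpowD.
apply/eqP/eqP => [{1}->|e]; first by rewrite mulVf // qpow_neq0.
by apply: (mulIf (qpow_neq0 x)); rewrite e mulVf // qpow_neq0.
Qed.

(** This is the link with 1-singularity: a vanishing factor forces its argument to be a
    half-integer. *)
Lemma qnum_eq0_half x : qnum x = 0 -> exists p : int, x = p%:~R / 2 /\ (m %| p)%Z.
Proof.
move=> /eqP; rewrite qnum_eq0 => /eqP/qpow_eq1[p e]; exists (p * m%:Z).
split; last by apply/dvdzP; exists p.
by rewrite -e mulrAC mulfV ?mul1r // pnatr_eq0.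
Qed.

(** As q^2 != 1, consecutive arguments are never both zeros. Moving an entry by 1 therefore removes
    an obstruction. *)
Lemma qnum_pred_neq0 x : qnum x = 0 -> qnum (x - 1) != 0.
Proof.
move=> /eqP; rewrite !qnum_eq0 mulrBr mulr1 qpowD => /eqP ->.
rewrite mul1r qpowN; apply: contra qpow2_neq1 => /eqP e.
by rewrite -[qpow m 2]invrK e invr1.
Qed.

Lemma qpow_mod x y : qpow m (x - y) = 1 -> qpow m x = qpow m y.
Proof. by move=> h; rewrite -(subrK y x) qpowD h mul1r. Qed.

(** A zero only gives m | 2d; the oddness of m removes the factor 2. *)
Lemma qnum_int_eq0 (d : int) : odd m -> qnum d%:~R = 0 -> (m %| d)%Z.
Proof.
move=> om /qnum_eq0_half[p [e /dvdzP[l pe]]].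
have /eqP : (d * 2)%:~R = p%:~R :> C.
  by rewrite intrM e divfK // pnatr_eq0.
rewrite eqr_int => /eqP dp; have : (m%:Z %| d * 2)%Z by rewrite dp pe dvdz_mull.
by rewrite Gauss_dvdzl // coprimezE /= coprimen2.
Qed.

End QPowers.

(** * First order expansions at x = y = 0 *)

Section Jets.
Variables (R : realType) (m : nat).
Hypothesis m_ge3 : (3 <= m)%N.
Local Notation C := R[i].
Local Notation q := (qroot R m).
Local Notation kappa := ((q - q^-1) / 4).
Implicit Types (P Q : {poly {poly C}}) (f g : ratK R).

(** The outer variable stands for q^x and the inner one for q^y. [restX] and [restY] restrict to the
    lines q^y = 1 and q^x = 1 along which [Dv] differentiates. *)
Local Notation restX := (map_poly (horner_eval (1 : C))).
Definition restY P : {poly C} := P.[1].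

Lemma restYM : {morph restY : P Q / P * Q}.
Proof. by move=> P Q; rewrite /restY hornerM. Qed.

Lemma restXE P x : P.[x, 1] = (restX P).[x].
Proof.
by have := horner_map (horner_eval (1 : C)) P x%:P; rewrite /= /horner_eval hornerC.
Qed.

Lemma restYE P y : P.[1, y] = (restY P).[y].
Proof. by []. Qed.

(** The chain rule for q^x and q^y contributes i theta, which cancels against the constant (q -
    q^-1) / (4 i theta) of [Dv] and leaves [kappa]. *)
Definition dxy P : C := kappa * ((restX P)^`().[1] - (restY P)^`().[1]).

Lemma dxyM P Q : dxy (P * Q) = dxy P * Q.[1, 1] + P.[1, 1] * dxy Q.
Proof.
rewrite /dxy rmorphM restYM !derivM !hornerD !hornerM -!restXE -!restYE /=; ring.
Qed.

(* [jet f a b] says that f is holomorphic near x = y = 0, with f(v) = a and D^v(f) = b. *)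
Definition jet f (a b : C) := exists P Q,
  [/\ Q.[1, 1] != 0, f = tofrac P / tofrac Q, P.[1, 1] = a * Q.[1, 1] &
      dxy P = b * Q.[1, 1] + a * dxy Q].

Lemma is_derive_horner_qpow (p : {poly C}) :
  is_derive (0 : C^o) (1 : C^o) (fun x => p.[qpow m x] : C^o)
    (p^`().[1] * ('i * theta R m)).
Proof.
elim/poly_ind: p => [|p c IH].
  rewrite deriv0 horner0 mul0r (_ : (fun _ => _) = cst 0).
    exact: is_derive_cst.
  by apply/funext => x; rewrite horner0.
have -> : (fun x => (p * 'X + c%:P).[qpow m x] : C^o) =
    (fun x => p.[qpow m x] : C^o) * (fun x => cexp ('i * theta R m * x) : C^o)
    + cst (c : C^o).
  by apply/funext => x; rewrite !fctE !hornerE.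
have h1 := is_deriveM IH (is_derive_cexp0 ('i * theta R m)).
have h2 := is_deriveD h1 (is_derive_cst (c : C^o) (0 : C^o) (1 : C^o)).
apply: (is_derive_eq h2).
rewrite addr0 derivD derivC addr0 derivM derivX.
rewrite hornerD !hornerM hornerX hornerC -[cexp _]/(qpow m 0) qpow0.
by rewrite /GRing.scale /=; ring.
Qed.

Lemma derive1_fraction (p r : {poly C}) (a b : C) : r.[1] != 0 ->
  p.[1] = a * r.[1] -> p^`().[1] = b * r.[1] + a * r^`().[1] ->
  derive1 (fun x => p.[qpow m x] / r.[qpow m x] : C^o) (0 : C) =
  b * ('i * theta R m).
Proof.
move=> r0 pa pb; rewrite derive1E.
have [dp ep] := is_derive_horner_qpow p.
have [dr er] := is_derive_horner_qpow r.
have r0' : r.[qpow m 0] != 0 by rewrite qpow0.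
have -> : (fun x => p.[qpow m x] / r.[qpow m x] : C^o) =
   (fun x => p.[qpow m x] : C^o) * (fun x => (r.[qpow m x] : C^o)^-1).
  by [].
have dV := derivableV r0' dr.
have -> := deriveM dp dV; have -> := deriveV r0' dr; rewrite ep er !qpow0 /GRing.scale /= pb pa.
have fe (F : fieldType) (x y z s t : F) : x != 0 ->
    y * x * (- x ^- 2 * (z * t)) + x^-1 * ((s * x + y * z) * t) = s * t.
  by move=> x0; field.
exact: fe.
Qed.

Lemma Kfun_fraction f : (exists PQ, regular_fraction f PQ) ->
  exists2 PQ, regular_fraction f PQ &
  forall x y, Kfun m f x y = PQ.1.[qpow m x, qpow m y] / PQ.2.[qpow m x, qpow m y].
Proof.
move=> ex; exists (xget (0, 1) [set PQ | regular_fraction f PQ]%classic) => //.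
by case: ex => PQ; apply: xgetI.
Qed.

Lemma tofrac_cross P Q P' Q' : Q != 0 -> Q' != 0 ->
  tofrac P / tofrac Q = tofrac P' / tofrac Q' -> P * Q' = P' * Q.
Proof.
move=> q0 q0' e; apply: (can_inj (@tofracK _)) || apply/eqP.
rewrite -tofrac_eq !tofracM -[tofrac P](@divfK _ (tofrac Q)) ?tofrac_eq0 //.
by rewrite e mulrAC divfK ?tofrac_eq0.
Qed.

(** [Kfun] evaluates a fraction obtained by choice, so independence of the fraction is needed: two
    fractions satisfy P Q' = P' Q, and the Leibniz rule [dxyM] carries value and derivative from one
    to the other. *)
Lemma jetP f a b : jet f a b -> Kval m f = a /\ Dv m f = b.
Proof.
case=> P [Q [q0 fE ea eb]]; have [|[P' Q'] rf' Kf] := @Kfun_fraction f; first by exists (P, Q).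
have [q0' fE'] : Q'.[1, 1] != 0 /\ f = tofrac P' / tofrac Q' := rf'.
have nz S : S.[1, 1] != 0 -> S != 0 :> {poly {poly C}}.
  by apply: contraNneq => ->; rewrite !horner0.
have cr : P * Q' = P' * Q by apply: tofrac_cross; rewrite ?nz // -fE.
have ea' : P'.[1, 1] = a * Q'.[1, 1].
  apply: (mulIf q0); have := congr1 (fun S => S.[1, 1]) cr.
  by rewrite !hornerM ea => <-; ring.
have eb' : dxy P' = b * Q'.[1, 1] + a * dxy Q'.
  apply: (mulIf q0); have := congr1 dxy cr.
  rewrite !dxyM ea eb ea' => h; rewrite -[LHS](addrK (a * Q'.[1, 1] * dxy Q)) -h; ring.
split; first by rewrite /Kval Kf /= qpow0 ea' mulfK.
have th := theta_neq0 R m_ge3.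
have i0 : ('i : C) != 0 by rewrite eq_complex /= oner_eq0 andbF.
rewrite /Dv.
have -> : (fun x => Kfun m f x 0) = (fun x => (restX P').[qpow m x] / (restX Q').[qpow m x]).
  by apply/funext => x; rewrite Kf /= qpow0 !restXE.
have -> : (fun x => Kfun m f 0 x) = (fun x => (restY P').[qpow m x] / (restY Q').[qpow m x]).
  by apply/funext => x; rewrite Kf /= qpow0 !restYE.
have hX : (restX Q').[1] != 0 by rewrite -restXE.
have hY : (restY Q').[1] != 0 by rewrite -restYE.
have eX : (restX P').[1] = a * (restX Q').[1] by rewrite -!restXE.
have eX' : (restX P')^`().[1] =
    ((restX P')^`().[1] - a * (restX Q')^`().[1]) / Q'.[1, 1] * (restX Q').[1] + a * (restX Q')^`().[1].
  by rewrite -restXE divfK // subrK.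
have eY' : (restY P')^`().[1] =
    ((restY P')^`().[1] - a * (restY Q')^`().[1]) / Q'.[1, 1] * (restY Q').[1] + a * (restY Q')^`().[1].
  by rewrite -restYE divfK // subrK.
have -> := derive1_fraction hX eX eX'; have -> := derive1_fraction hY ea' eY'.
apply: (mulIf q0').
transitivity (dxy P' - a * dxy Q'); last by rewrite eb' addrK.
have fe (F : fieldType) (e x y z u w d c t l : F) : t != 0 -> c != 0 -> d != 0 -> l != 0 ->
   e / (l * c * t) * ((x - w * y) / d * (c * t) - (z - w * u) / d * (c * t)) * d =
   e / l * (x - z) - w * (e / l * (y - u)).
  by move=> t0 c0 d0 l0; field; rewrite t0 c0 d0 l0.
by apply: fe => //; rewrite pnatr_eq0.
Qed.

Lemma eval11C (c : C) : (c%:P%:P).[1, 1] = c.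
Proof. by rewrite !hornerC. Qed.

Lemma eval11_1 : (1 : {poly {poly C}}).[1, 1] = 1.
Proof. exact: (eval11C 1). Qed.

Lemma dxyC (c : C) : dxy c%:P%:P = 0.
Proof.
by rewrite /dxy map_polyC /= /horner_eval hornerC /restY hornerC subrr mulr0.
Qed.

Lemma dxy1 : dxy 1 = 0.
Proof. exact: (dxyC 1). Qed.

Lemma jet_poly P : jet (tofrac P) P.[1, 1] (dxy P).
Proof.
exists P, 1; rewrite eval11_1 dxy1 mulr0 addr0 !mulr1 tofrac1 divr1.
by split=> //; apply: oner_neq0.
Qed.

Lemma jet_const c : jet (Kconst c) c 0.
Proof. by have := jet_poly c%:P%:P; rewrite eval11C dxyC. Qed.

Lemma jetM f g a b c d : jet f a b -> jet g c d ->
  jet (f * g) (a * c) (a * d + b * c).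
Proof.
move=> [P [Q [q0 -> pa pb]]] [P' [Q' [q0' -> pa' pb']]].
exists (P * P'), (Q * Q'); rewrite !hornerM mulf_neq0 // !tofracM invfM mulrACA.
by split=> //; rewrite ?dxyM pa pa' ?pb ?pb'; ring.
Qed.

Lemma jetV f a b : a != 0 -> jet f a b -> jet f^-1 a^-1 (- b / a ^+ 2).
Proof.
move=> a0 [P [Q [q0 -> pa pb]]].
exists Q, P; rewrite invf_div pa pb mulf_neq0 //.
split=> //; first by rewrite mulKf.
have fe (F : fieldType) (x y z t : F) : x != 0 ->
   t = - y / x ^+ 2 * (x * z) + x^-1 * (y * z + x * t).
  by move=> x0; field.
exact: fe.
Qed.

Lemma jetN f a b : jet f a b -> jet (- f) (- a) (- b).
Proof.
move=> [P [Q [q0 -> pa pb]]]; exists (- P), Q.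
rewrite tofracN mulNr !hornerN pa mulNr; split=> //.
have := dxyM (- 1) P; rewrite mulN1r => ->.
rewrite -[-1](rmorphN1 polyC) -(rmorphN1 polyC) dxyC eval11C pb; ring.
Qed.

Lemma jetD f g a b c d : jet f a b -> jet g c d -> jet (f + g) (a + c) (b + d).
Proof.
move=> [P [Q [q0 -> pa pb]]] [P' [Q' [q0' -> pa' pb']]].
have nz S : S.[1, 1] != 0 -> S != 0 :> {poly {poly C}}.
  by apply: contraNneq => ->; rewrite !horner0.
exists (P * Q' + P' * Q), (Q * Q').
rewrite !hornerD !hornerM mulf_neq0 // tofracD !tofracM addf_div ?tofrac_eq0 ?nz //.
have -> : dxy (P * Q' + P' * Q) = dxy (P * Q') + dxy (P' * Q).
  by rewrite /dxy rmorphD /restY hornerD !derivD !hornerD; ring.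
by rewrite !dxyM pa pb pa' pb'; split=> //; ring.
Qed.

Lemma jet_Kx : jet (Kx R) 1 kappa.
Proof.
have := jet_poly 'X; rewrite hornerX hornerC.
by rewrite /dxy map_polyX derivX /restY hornerX derivC hornerC horner0 subr0 mulr1.
Qed.

Lemma jet_Ky : jet (Ky R) 1 (- kappa).
Proof.
have := jet_poly 'Y; rewrite hornerC hornerX.
rewrite /dxy map_polyC /= /horner_eval /restY hornerC hornerX derivC derivX.
by rewrite horner0 (hornerC (1 : C)) sub0r mulrN mulr1.
Qed.

Lemma jet_exprz f b (z : int) : jet f 1 b -> jet (f ^ z) 1 (b *~ z).
Proof.
move=> jf; have hn (p : nat) : jet (f ^+ p) 1 (b *+ p).
  elim: p => [|p IH]; first by rewrite expr0 -(rmorph1 (@tofrac _)); exact: jet_const.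
  by rewrite exprS -[1](mulr1 1) mulrS addrC -[b in _ + b]mulr1 -[b *+ p]mul1r; apply: jetM.
case: z => p; first exact: hn.
have := jetV (oner_neq0 _) (hn p.+1).
by rewrite invr1 expr1n divr1 NegzE mulrNz -exprnN.
Qed.

Lemma jet_qpowK (w : affine R) :
  jet (qpowK m w) (qpow m w.1) (qpow m w.1 * (kappa *~ (w.2.1 - w.2.2))).
Proof.
have := jetM (jetM (jet_const (qpow m w.1)) (jet_exprz w.2.1 jet_Kx)) (jet_exprz w.2.2 jet_Ky).
by rewrite !mulr1 addr0 mulNrz -mulrDr addrC -mulrzBr.
Qed.

(** The factor q - q^-1 of [kappa] cancels the denominator of [.]_q. In particular D^v([x - y]_q) =
    1, which explains the constant in D^v. *)
Lemma jet_qnumK (w : affine R) :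
  jet (qnumK m w) (qnum m w.1)
    ((w.2.1 - w.2.2)%:~R / 4 * (qpow m w.1 + qpow m (- w.1))).
Proof.
have d0 := qdiff_neq0 R m_ge3.
have := jetM (jetD (jet_qpowK w) (jetN (jet_qpowK (- w)))) (jetV d0 (jet_const (q - q^-1))).
rewrite oppr0 mul0r mulr0 add0r /=.
rewrite (_ : - w.2.1 - - w.2.2 = - (w.2.1 - w.2.2)); last by rewrite opprB addrC opprK.
rewrite mulrNz -mulrzl.
have fe (F : fieldType) (x y z d l : F) : d != 0 ->
   (x * (z * (d / l)) - y * - (z * (d / l))) / d = z / l * (x + y).
  have [->|l0 dn0] := eqVneq l 0; first by move=> _; rewrite invr0; ring.
  by field; rewrite dn0 l0.
by rewrite fe.
Qed.

End Jets.

(** * Linear maps on free modules *)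

Section FreeModule.
Variables (F : nzRingType) (K : choiceType).
Local Notation A := {freeg K / F}.

Lemma freegZ (c x : F) (z : K) : c *: << x *g z >> = << c * x *g z >> :> A.
Proof.
by apply/eqP/freeg_eqP => y; rewrite coeffZ !coeffU mulrA.
Qed.

Section Lift.
Variables (W : lmodType F) (f : K -> W).

Lemma fglift_linear : linear (fglift f : A -> W).
Proof.
move=> c x y; have fD : {morph (fglift f : A -> W) : u v / u + v}.
  by move=> u v; have := lift_is_additive f (u + v) v; rewrite addrK => ->; rewrite subrK.
have f0 : fglift f (0 : A) = 0 by apply: (addIr (fglift f 0)); rewrite -fD !add0r.
rewrite fD; congr (_ + _).
have [r [k ->]] : exists r (k : K -> F), x = \sum_(z <- r) << k z *g z >>.
  by exists (dom x), (fun z => coeff z x); rewrite freeg_sumE.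
elim: r => [|z r IH]; first by rewrite !big_nil scaler0 f0 scaler0.
by rewrite !big_cons scalerDr !fD freegZ !liftU scalerDr scalerA IH.
Qed.

HB.instance Definition _ := GRing.isLinear.Build F A W *:%R (fglift f) fglift_linear.

Lemma fglift1 z : fglift f << z >> = f z.
Proof. by rewrite liftU scale1r. Qed.

End Lift.

Lemma freeg_ind (P : A -> Prop) : P 0 ->
  (forall c z x, P x -> P (c *: << z >> + x)) -> forall x, P x.
Proof.
move=> P0 PS x.
have [r [k ->]] : exists r (k : K -> F), x = \sum_(z <- r) << k z *g z >>.
  by exists (dom x), (fun z => coeff z x); rewrite freeg_sumE.
elim: r => [|z r IH]; first by rewrite big_nil.
by rewrite big_cons -[k z]mulr1 -freegZ; apply: PS.
Qed.

Lemma freeg_ext (W : lmodType F) (f g : {linear A -> W}) :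
  (forall z, f << z >> = g << z >>) -> f =1 g.
Proof.
move=> fg; apply: freeg_ind => [|c z x IH]; first by rewrite !linear0.
by rewrite !linearP IH fg.
Qed.

(** The equation [restr S a = a] is used throughout to say that [a] is supported in [S]. *)
Definition restr (S : pred K) : A -> A := fglift (fun z => if S z then << z >> else 0).
HB.instance Definition _ S := GRing.Linear.on (restr S).

Lemma restrE S z : restr S << z >> = if S z then << z >> else 0.
Proof. exact: fglift1. Qed.

Lemma restr_comp S T x : restr S (restr T x) = restr (predI S T) x.
Proof.
have := @freeg_ext _ (restr S \o restr T : {linear _ -> _}) (restr (predI S T)).
apply=> z /=; rewrite !restrE /=; case: (T z); rewrite ?andbT ?restrE //.
by rewrite andbF linear0.
Qed.

Lemma eq_restr S T : S =1 T -> restr S =1 restr T.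
Proof. by move=> ST; apply: (@freeg_ext _ (restr S) (restr T)) => z; rewrite /= !restrE ST. Qed.

Lemma restr_dom x : restr (fun z => z \in dom x) x = x.
Proof.
rewrite -[in RHS](freeg_sumE x) -[X in restr _ X](freeg_sumE x) linear_sum /=.
apply: eq_big_seq => z zx.
by rewrite -[coeff z x]mulr1 -freegZ linearZ /= restrE zx.
Qed.

Lemma restr_ext (W : lmodType F) (f g : {linear A -> W}) S x :
  restr S x = x -> (forall z, S z -> f << z >> = g << z >>) -> f x = g x.
Proof.
move=> Sx fg; rewrite -Sx.
have := @freeg_ext _ (f \o restr S : {linear _ -> _}) (g \o restr S : {linear _ -> _}).
apply=> z /=; rewrite restrE; case: ifP => [/fg//|_]; by rewrite !linear0.
Qed.

Lemma restr_sub (S T : pred K) x : (forall z, S z -> T z) ->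
  restr S x = x -> restr T x = x.
Proof.
move=> ST Sx; rewrite -{1}Sx restr_comp -{2}Sx; apply: eq_restr => z /=.
by case: (boolP (S z)) => [/ST->|]; rewrite ?andbT ?andbF.
Qed.

End FreeModule.

Section Translate.
Variables (F : nzRingType) (K : choiceType) (I : zmodType).
Local Notation A := {freeg I / F}.

Definition translate (d : I) : A -> A := fglift (fun z => << z + d >>).
HB.instance Definition _ d := GRing.Linear.on (translate d).

Lemma translateE d z : translate d << z >> = << z + d >>.
Proof. exact: fglift1. Qed.

Lemma translateD d e x : translate d (translate e x) = translate (e + d) x.
Proof.
have := @freeg_ext _ _ _ (translate d \o translate e : {linear _ -> _}) (translate (e + d)).
by apply=> z /=; rewrite !translateE addrA.
Qed.

Lemma translate0 x : translate 0 x = x.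
Proof.
have := @freeg_ext _ _ _ (translate 0) (idfun : {linear A -> A}).
by apply=> z; rewrite /= translateE addr0.
Qed.

Lemma restr_translate (S T : pred I) d x : (forall z, S (z + d) = T z) ->
  restr S (translate d x) = translate d (restr T x).
Proof.
move=> ST; have := @freeg_ext _ _ _ (restr S \o translate d : {linear _ -> _})
  (translate d \o restr T : {linear _ -> _}).
apply=> z; rewrite /= translateE !restrE ST; case: ifP; by rewrite ?linear0 ?translateE.
Qed.

End Translate.

Section LinearFunctions.
Variables (F : nzRingType) (U W : lmodType F) (f : U -> W).
Hypothesis f_linear : linear f.

(** The operators [act g] are linear for valid [g] only, so linearity is carried as a hypothesis and
    not as a structure. *)
Lemma linear_fun0 : f 0 = 0.
Proof. by have := f_linear (-1) 0 0; rewrite scaler0 addr0 scaleN1r addNr. Qed.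

Lemma linear_funZ c x : f (c *: x) = c *: f x.
Proof. by have := f_linear c x 0; rewrite !addr0 linear_fun0 addr0. Qed.

Lemma linear_funD x y : f (x + y) = f x + f y.
Proof. by have := f_linear 1 x y; rewrite !scale1r. Qed.

Lemma linear_fun_sum (J : Type) (r : seq J) (P : pred J) (G : J -> U) :
  f (\sum_(l <- r | P l) G l) = \sum_(l <- r | P l) f (G l).
Proof. exact: (big_morph f linear_funD linear_fun0). Qed.

Lemma linear_fun_comb c d x y : f (c *: x + d *: y) = c *: f x + d *: f y.
Proof. by rewrite linear_funD !linear_funZ. Qed.

End LinearFunctions.

Lemma linear_comp (F : nzRingType) (U W X : lmodType F) (f : W -> X) (g : U -> W) :
  linear f -> linear g -> linear (fun x => f (g x)).
Proof. by move=> lf lg c x y; rewrite lg lf. Qed.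

Lemma restr_ext_fun (F : nzRingType) (K : choiceType) (W : lmodType F)
    (f g : {freeg K / F} -> W) S x : linear f -> linear g ->
  restr S x = x -> (forall z, S z -> f << z >> = g << z >>) -> f x = g x.
Proof.
move=> lf lg; pose f' : {linear _ -> _} := HB.pack f (GRing.isLinear.Build _ _ _ _ f lf).
pose g' : {linear _ -> _} := HB.pack g (GRing.isLinear.Build _ _ _ _ g lg).
exact: (@restr_ext _ _ _ f' g').
Qed.

Lemma freeg_ext_fun (F : nzRingType) (K : choiceType) (W : lmodType F)
    (f g : {freeg K / F} -> W) : linear f -> linear g ->
  (forall z, f << z >> = g << z >>) -> f =1 g.
Proof.
move=> lf lg; pose f' : {linear _ -> _} := HB.pack f (GRing.isLinear.Build _ _ _ _ f lf).
pose g' : {linear _ -> _} := HB.pack g (GRing.isLinear.Build _ _ _ _ g lg).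
exact: (@freeg_ext _ _ _ f' g').
Qed.

Lemma linear_scaled (F : comNzRingType) (U W : lmodType F) (c : F) (f : U -> W) :
  linear f -> linear (fun x => c *: f x).
Proof. by move=> lf d x y; rewrite lf scalerDr !scalerA mulrC. Qed.

Lemma linear_addf (F : nzRingType) (U W : lmodType F) (f g : U -> W) :
  linear f -> linear g -> linear (fun x => f x + g x).
Proof. by move=> lf lg d x y; rewrite lf lg scalerDr addrACA. Qed.

Lemma eq_opp0 (F : numFieldType) (W : lmodType F) (w : W) : w = - w -> w = 0.
Proof.
move=> /eqP; rewrite -subr_eq0 opprK -mulr2n -scaler_nat scaler_eq0 pnatr_eq0.
by move/eqP.
Qed.

Section Subspaces.
Variables (F : fieldType) (V : lmodType F) (N : V -> Prop).
Hypothesis N_sub : is_subspace N.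

Lemma subspaceP a x y : N x -> N y -> N (a *: x + y).
Proof. by case: N_sub => _; apply. Qed.

Lemma subspaceZ a x : N x -> N (a *: x).
Proof. by case: N_sub => N0 Nl Nx; rewrite -[_ *: _]addr0; apply: Nl. Qed.

Lemma subspaceD x y : N x -> N y -> N (x + y).
Proof. by case: N_sub => N0 Nl Nx; rewrite -[x]scale1r; apply: Nl. Qed.

Lemma subspaceB x y : N x -> N y -> N (x - y).
Proof. by case: N_sub => N0 Nl Nx Ny; rewrite addrC -scaleN1r; apply: Nl. Qed.

End Subspaces.

Section Weights.
Variables (F : fieldType) (K : choiceType).
Local Notation A := {freeg K / F}.
Implicit Types (a b : A) (S : pred K) (f g : K -> F).

Definition weigh f : A -> A := fglift (fun z => f z *: << z >>).
HB.instance Definition _ f := GRing.Linear.on (weigh f).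

Lemma weighE f z : weigh f << z >> = f z *: << z >>.
Proof. exact: fglift1. Qed.

Lemma weigh_ext S f g a : restr S a = a -> (forall z, S z -> f z = g z) -> weigh f a = weigh g a.
Proof. by move=> Sa fg; apply: (restr_ext (S := S)) => // z Sz /=; rewrite !weighE fg. Qed.

Lemma weigh_const S f c a : restr S a = a -> (forall z, S z -> f z = c) -> weigh f a = c *: a.
Proof.
move=> Sa fc; rewrite (@weigh_ext S f (fun=> c)) //.
have := @freeg_ext _ _ _ (weigh (fun=> c)) ( *:%R c : {linear A -> A}).
by apply=> z; rewrite /= weighE.
Qed.

Lemma weighM f g a : weigh f (weigh g a) = weigh (fun z => f z * g z) a.
Proof.
have := @freeg_ext _ _ _ (weigh f \o weigh g : {linear A -> A}) (weigh (fun z => f z * g z)).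
by apply=> z /=; rewrite !weighE linearZ /= weighE scalerA mulrC.
Qed.

Lemma weighB f c a : weigh (fun z => f z - c) a = weigh f a - c *: a.
Proof.
have := @freeg_ext _ _ _ (weigh (fun z => f z - c)) (weigh f \- *:%R c : {linear A -> A}).
by apply=> z /=; rewrite !weighE scalerBl.
Qed.

Lemma restr_weigh S f a : restr S (weigh f a) = weigh f (restr S a).
Proof.
have := @freeg_ext _ _ _ (restr S \o weigh f : {linear A -> A}) (weigh f \o restr S : {linear A -> A}).
apply=> z /=; rewrite weighE linearZ /= restrE.
by case: ifP => _; rewrite ?weighE ?scaler0 ?linear0.
Qed.

Lemma restr_pred0 a : restr pred0 a = 0.
Proof.
have := @freeg_ext _ _ _ (restr pred0) (\0 : {linear A -> A}).
by apply=> z; rewrite /= restrE.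
Qed.

End Weights.

Lemma weigh_translate (F : fieldType) (I : zmodType) (f : I -> F) d (a : {freeg I / F}) :
  weigh f (translate d a) = translate d (weigh (fun z => f (z + d)) a).
Proof.
have := @freeg_ext _ _ _ (weigh f \o translate d : {linear {freeg I / F} -> _})
  (translate d \o weigh (fun z => f (z + d)) : {linear {freeg I / F} -> _}).
by apply=> z /=; rewrite translateE !weighE linearZ /= translateE.
Qed.

Section GeneralizedEigenspaces.
Variables (F : fieldType) (K : choiceType) (W : lmodType F).
Local Notation A := {freeg K / F}.
Variables (sT sD : {linear A -> W}) (N : W -> Prop).
Hypothesis N_sub : is_subspace N.
Local Notation NZ c := (subspaceZ N_sub c).
Local Notation NB := (subspaceB N_sub).
Variables (SA SB : pred K) (lam mu : K -> F).
Hypothesis SBA : forall z, SB z -> SA z.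
Implicit Types (a b : A).

(* (a, b) stands for sT a + sD b; the operator is lam on the sT part and
   lam + (nilpotent mu from the sD part to the sT part) on the sD part. *)
Hypothesis N_op : forall a b, restr SA a = a -> restr SB b = b ->
  N (sT a + sD b) -> N (sT (weigh lam a + weigh mu b) + sD (weigh lam b)).

Let N_opB c a b : restr SA a = a -> restr SB b = b -> N (sT a + sD b) ->
  N (sT (weigh (fun z => lam z - c) a + weigh mu b) + sD (weigh (fun z => lam z - c) b)).
Proof.
move=> Sa Sb Nab; have := NB (N_op Sa Sb Nab) (NZ c Nab).
rewrite !weighB scalerDr opprD addrACA -!linearZ -!linearB /=.
by rewrite addrAC.
Qed.

(** Induction on the other eigenvalues c. Applying the operator minus c twice kills the c-part in
    spite of the nilpotent part. On the l-part it leaves the factor (l - c)^2 and an extra multiple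
    of [weigh mu b] under [sT]. The operator minus l isolates this extra term, which is then
    subtracted. *)
Lemma generalized_eigen a b l : restr SA a = a -> restr SB b = b -> N (sT a + sD b) ->
  N (sT (restr (fun z => lam z == l) a) + sD (restr (fun z => lam z == l) b)).
Proof.
pose Lp (L : seq F) := (fun z => lam z \in L) : pred K.
have restrSB c : restr SB c = c -> restr SA c = c by apply: restr_sub.
suff H L a1 b1 : l \notin L -> restr SA a1 = a1 -> restr SB b1 = b1 ->
    restr (Lp (l :: L)) a1 = a1 -> restr (Lp (l :: L)) b1 = b1 -> N (sT a1 + sD b1) ->
    N (sT (restr (fun z => lam z == l) a1) + sD (restr (fun z => lam z == l) b1)).
  move=> Sa Sb; pose L := [seq lam z | z <- dom a ++ dom b].
  have La : restr (Lp (l :: [seq x <- L | x != l])) a = a.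
    apply: (restr_sub (S := fun z => z \in dom a)); last exact: restr_dom.
    move=> z za; rewrite /Lp inE mem_filter /= -/(lam z \in L) /=.
    by case: eqP => //= _; apply: map_f; rewrite mem_cat za.
  have Lb : restr (Lp (l :: [seq x <- L | x != l])) b = b.
    apply: (restr_sub (S := fun z => z \in dom b)); last exact: restr_dom.
    move=> z zb; rewrite /Lp inE mem_filter /=.
    by case: eqP => //= _; apply: map_f; rewrite mem_cat zb orbT.
  by apply: H La Lb => //; rewrite mem_filter /= eqxx.
elim: L a1 b1 => [|c L IH] {}a {}b.
  move=> _ _ _ La Lb; have e x : restr (fun z => lam z == l) x = restr (Lp [:: l]) x.
    by apply: eq_restr => z; rewrite /Lp inE.
  by rewrite !e La Lb.
rewrite inE negb_or => /andP[lc lL] Sa Sb La Lb Nab.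
pose f z := lam z - c.
have N1 := N_opB c Sa Sb Nab.
have Sa1 : restr SA (weigh f a + weigh mu b) = weigh f a + weigh mu b.
  by rewrite linearD /= !restr_weigh Sa restrSB.
have Sb1 : restr SB (weigh f b) = weigh f b by rewrite restr_weigh Sb.
have N2 := N_opB c Sa1 Sb1 N1.
pose a2 := weigh f (weigh f a + weigh mu b) + weigh mu (weigh f b).
pose b2 := weigh f (weigh f b).
have Sa2 : restr SA a2 = a2.
  by rewrite /a2 linearD /= !restr_weigh Sa1 restrSB // restr_weigh Sb.
have Sb2 : restr SB b2 = b2 by rewrite /b2 !restr_weigh Sb.
have kill g x : restr (Lp (l :: c :: L)) x = x -> restr (Lp (l :: L)) (weigh (fun z => f z * g z) x) = weigh (fun z => f z * g z) x.
  move=> Lx; rewrite restr_weigh.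
  have := @restr_ext _ _ _ (weigh (fun z => f z * g z) \o restr (Lp (l :: L)) : {linear A -> A}) (weigh (fun z => f z * g z)) _ x Lx.
  apply=> z /=; rewrite restrE /Lp !inE; case: (lam z == l) => //=; case: (lam z \in L); rewrite ?orbT //.
  by rewrite orbF => /eqP lz; rewrite linear0 weighE /f lz subrr mul0r scale0r.
have ea2 : a2 = weigh (fun z => f z * f z) a + 2 *: weigh (fun z => f z * mu z) b.
  rewrite /a2 linearD /= !weighM -addrA; congr (_ + _).
  rewrite scaler_nat mulr2n; congr (_ + _); apply: (weigh_ext Sb) => z _; exact: mulrC.
have eb2 : b2 = weigh (fun z => f z * f z) b by rewrite /b2 weighM.
have La2 : restr (Lp (l :: L)) a2 = a2 by rewrite ea2 linearD linearZ /= !kill.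
have Lb2 : restr (Lp (l :: L)) b2 = b2 by rewrite eb2 kill.
have := IH _ _ lL Sa2 Sb2 La2 Lb2 N2.
set al := restr _ a2; set bl := restr _ b2; pose E := fun z : K => lam z == l.
pose e := l - c; have e0 : e != 0 by rewrite subr_eq0.
have Ef x y : restr E x = x -> weigh (fun z => f z * y z) x = e *: weigh y x.
  by move=> Ex; rewrite -weighM (@weigh_const _ _ E _ e) ?restr_weigh ?Ex // => z /eqP ez; rewrite /f ez.
have EE x : restr E (restr E x) = restr E x.
  by rewrite restr_comp; apply: eq_restr => z /=; rewrite andbb.
have ebl : bl = (e * e) *: restr E b.
  rewrite /bl eb2 restr_weigh Ef // (@weigh_const _ _ E _ e) ?EE ?scalerA // => z /eqP ez.
  by rewrite /f ez.
have eal : al = (e * e) *: restr E a + (2 * e) *: weigh mu (restr E b).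
  rewrite /al ea2 linearD linearZ /= !restr_weigh !Ef // -scalerA; congr (_ + _).
    by rewrite (@weigh_const _ _ E _ e) ?EE ?scalerA // => z /eqP ez; rewrite /f ez.
  by rewrite scalerA mulrC.
move=> Nl; have Sal : restr SA al = al.
  by rewrite /al restr_comp -[in RHS]Sa2 restr_comp; apply: eq_restr => z /=; rewrite andbC.
have Sbl : restr SB bl = bl.
  by rewrite /bl restr_comp -[in RHS]Sb2 restr_comp; apply: eq_restr => z /=; rewrite andbC.
have zl x : restr E x = x -> weigh (fun z => lam z - l) x = 0.
  by move=> Ex; rewrite (@weigh_const _ _ E _ 0) ?scale0r // => z /eqP ->; rewrite subrr.
have := N_opB l Sal Sbl Nl.
rewrite !zl ?EE // add0r linear0 addr0 ebl linearZ /= linearZ /= => Ne.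
have Ny : N (sT (weigh mu (restr E b))).
  by have := NZ (e * e)^-1 Ne; rewrite scalerA mulVf ?scale1r // mulf_neq0.
move: Nl; rewrite eal ebl linearD !linearZ /= addrAC -scalerDr => Nl.
have := NZ (e * e)^-1 (NB Nl (NZ (2 * e) Ny)).
by rewrite addrK scalerA mulVf ?scale1r // mulf_neq0.
Qed.

End GeneralizedEigenspaces.

(** * Localization at the negligible shifts *)

Section Localization.
Variables (F : fieldType) (n : nat) (q : F) (M : Uq_module n q) (G : zmodType).
Variables (S : G -> M -> M) (t0 : M) (I : finType) (c : I -> G) (gen : I -> M) (phi : M -> F).
Implicit Types (f : G) (x y : M).
Hypothesis S_lin : forall f, linear (S f).
Hypothesis S0 : forall x, S 0 x = x.
Hypothesis SD : forall f f' x, S (f + f') x = S f (S f' x).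
Hypothesis S_act : forall g f x, valid_gen n g -> Uq_act g (S f x) = S f (Uq_act g x).
Hypothesis genE : forall p, gen p = S (c p) t0 - t0.
Hypothesis c_gen : forall D : G -> Prop, D 0 -> (forall f f', D f -> D f' -> D (f - f')) ->
  (forall p, D (c p)) -> forall f, D f.
Hypothesis phi_lin : scalar phi.
Hypothesis phi_S : forall f x, phi (S f x) = phi x.
Hypothesis phi_t0 : phi t0 != 0.

Definition stable_pred (N : M -> Prop) := [/\ is_subspace N,
  forall g x, valid_gen n g -> N x -> N (Uq_act g x) & forall f x, N x -> N (S f x)].

Hypothesis all_of_t0 : forall N, stable_pred N -> N t0 -> forall x, N x.
Hypothesis all_of_big : forall N K, stable_pred N -> is_subspace K -> (forall x, K x -> N x) ->
  (forall f x, K (S f x - x)) -> (exists x, N x /\ ~ K x) -> forall x, N x.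

Local Notation U := (ugen [set t0]%classic).
Hypothesis gen_U : forall p, U (gen p).
Local Notation L := (usub_module U).
Local Notation W := (fun p => ugen [set y : L | usub_val y = gen p]%classic).

Lemma act_linear g : valid_gen n g -> linear (Uq_act (u := M) g).
Proof. by move=> vg; apply: (Uq_linear (Uq_actP M)). Qed.

Lemma S_sub f x y : S f (x - y) = S f x - S f y.
Proof. by rewrite addrC -scaleN1r S_lin scaleN1r addrC. Qed.

Lemma U_subspace : is_subspace U. Proof. exact: sub_setP. Qed.

Lemma U_act g x : valid_gen n g -> U x -> U (Uq_act g x). Proof. by move=> vg; apply: usub_stable. Qed.

Lemma U_t0 : U t0. Proof. by move=> N; apply. Qed.

(** Submodules of U live on a subtype; they are compared inside M, where the shifts act. *)
Definition lift_set (X : L -> Prop) x := exists y : L, usub_val y = x /\ X y.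

Lemma val_U (y : L) : U (usub_val y). Proof. exact/asboolP/(valP y). Qed.

Lemma lift_set_U X x : lift_set X x -> U x. Proof. by case=> y [<- _]; apply: val_U. Qed.

Lemma lift_setP (X : L -> Prop) (y : L) : lift_set X (usub_val y) -> X y.
Proof. by case=> y' [/val_inj <-]. Qed.

Lemma lift_set_subspace (X : Uq_submodule L) : is_subspace (lift_set X).
Proof.
have [X0 Xl] := sub_setP X; split; first by exists 0; split=> //; exact: (raddf0 (val : L -> M)).
move=> a _ _ [y [<- Xy]] [y' [<- Xy']]; exists (a *: y + y'); split; last exact: Xl.
exact: usub_val_linear.
Qed.

Lemma lift_set_act (X : Uq_submodule L) g x : valid_gen n g -> lift_set X x -> lift_set X (Uq_act g x).
Proof.
move=> vg [y [<- Xy]]; exists (Uq_act g y); split; first exact: val_usub_act.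
exact: usub_stable.
Qed.

Local Notation J := (lift_set (usum W)).

Definition negligible f := forall x, U x -> J (S f x - x).

Lemma neg_U f x : negligible f -> U x -> U (S f x).
Proof.
move=> nf Ux; rewrite -[S f x](subrK x); apply: (subspaceD U_subspace) => //.
by apply: lift_set_U (nf x Ux).
Qed.

Lemma negligible0 : negligible 0.
Proof. by move=> x _; rewrite S0 subrr; case: (lift_set_subspace (usum W)). Qed.

Lemma negligibleD f f' : negligible f -> negligible f' -> negligible (f + f').
Proof.
move=> nf nf' x Ux; rewrite SD -[S f _](subrK (S f' x)) -addrA.
apply: (subspaceD (lift_set_subspace _)); last exact: nf'.
by apply/nf/neg_U.
Qed.

Lemma usumW p (y : L) : W p y -> usum W y.
Proof.
move=> Wy; exists (fun p' => if p' == p then y else 0); split=> [p'|].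
  by case: eqP => [->|_] //; case: (sub_setP (W p')).
by rewrite (bigD1 p) //= eqxx big1 ?addr0 // => p' /negPf ->.
Qed.

(* The vectors x with S (c p) x - x in J form a submodule. *)
Lemma negligible_c p : negligible (c p).
Proof.
have [J0 Jl] := lift_set_subspace (usum W); have [U0 Ul] := U_subspace.
pose X x := U x /\ J (S (c p) x - x).
have Xs : is_subspace X.
  split=> [|a x y [Ux Jx] [Uy Jy]].
    by split=> //; rewrite -(subrr 0) S_sub !subrr.
  split; first exact: Ul.
  by rewrite S_lin opprD addrACA -scalerBr; apply: Jl.
have Xa g : valid_gen n g -> forall x, Subspace Xs x -> Subspace Xs (Uq_act g x).
  move=> vg x [Ux Jx]; split; first exact: U_act.
  rewrite -S_act // addrC -scaleN1r -act_linear // scaleN1r addrC.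
  exact: lift_set_act.
move=> x Ux; suff : X x by case.
apply: (Ux (@UqSubmodule _ _ _ M (Subspace Xs) Xa)) => _ ->; split; first exact: U_t0.
have ug := gen_U p; exists (USub (introT (asboolP _) ug)); rewrite -genE; split=> //.
apply: (@usumW p) => N; exact.
Qed.

(** The negligible shifts form a monoid containing the generators [c p], so the group generated
    consists of differences. *)
Lemma negligible_sub f : exists a b, [/\ negligible a, negligible b & f = a - b].
Proof.
elim/c_gen: f => [|f f' [a [b [na nb ->]]] [a' [b' [na' nb' ->]]]|p].
- exists 0, 0; split; [exact: negligible0 | exact: negligible0 | by rewrite subrr].
- exists (a + b'), (b + a'); split; [exact: negligibleD | exact: negligibleD |].
  by rewrite !opprD opprK [- a' + _]addrC addrACA.
- exists (c p), 0; split; [exact: negligible_c | exact: negligible0 | by rewrite subr0].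
Qed.

(* Negligible shifts are trivial modulo J and generate all shifts, so inverting
   them makes X stable under every shift. *)
Definition loc (X : M -> Prop) x := exists2 a, negligible a & X (S a x).

Lemma neg_stable (X : Uq_submodule L) f x : (forall y, J y -> lift_set X y) ->
  negligible f -> lift_set X x -> lift_set X (S f x).
Proof.
move=> JX nf Xx; rewrite -[S f x](subrK x).
apply: (subspaceD (lift_set_subspace X)) => //; apply/JX/nf; exact: lift_set_U Xx.
Qed.

Lemma neg_reflect (X : Uq_submodule L) f x : (forall y, J y -> lift_set X y) ->
  negligible f -> U x -> lift_set X (S f x) -> lift_set X x.
Proof.
move=> JX nf Ux Xx; rewrite -[x](subKr (S f x)).
by apply: (subspaceB (lift_set_subspace X)) => //; apply/JX/nf.
Qed.

Lemma loc_stable (X : Uq_submodule L) : (forall y, J y -> lift_set X y) ->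
  stable_pred (loc (lift_set X)).
Proof.
move=> JX; have [X0 Xl] := lift_set_subspace X; split.
- split; first by exists 0; [exact: negligible0 | rewrite S0].
  move=> a x y [f nf Xx] [f' nf' Xy]; exists (f + f'); first exact: negligibleD.
  rewrite S_lin; apply: Xl; last by rewrite SD; apply: neg_stable.
  by rewrite addrC SD; apply: neg_stable.
- move=> g x vg [f nf Xx]; exists f => //; rewrite -S_act //; exact: lift_set_act.
move=> f x [d nd Xx]; have [a [b [na nb ->]]] := negligible_sub f.
(* The shift d moves x into X, and the summand b clears the denominator of a - b. *)
exists (d + b); first exact: negligibleD.
by rewrite -SD addrACA subrr addr0 addrC SD; apply: neg_stable.
Qed.

Fact full_subspace : is_subspace (fun _ : L => True). Proof. by []. Qed.

Definition full_submodule : Uq_submodule L :=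
  @UqSubmodule F n q L (Subspace full_subspace) (fun _ _ _ _ => Logic.I).

Lemma lift_full x : U x -> lift_set full_submodule x.
Proof. by move=> Ux; exists (USub (introT (asboolP _) Ux)). Qed.

(** The localization of U itself is stable under U_q and all shifts and contains [t0], so
    [all_of_t0] makes it the whole of M. *)
Lemma loc_U x : exists2 a, negligible a & U (S a x).
Proof.
have h : stable_pred (loc (lift_set full_submodule)).
  by apply: loc_stable => y [y' [<- _]]; exists y'.
have [|a na Xa] := all_of_t0 h _ x; last by exists a => //; apply: lift_set_U Xa.
by exists 0; [exact: negligible0 | rewrite S0; apply/lift_full/U_t0].
Qed.

Lemma loc_J_shift f x : loc J (S f x - x).
Proof.
have [a [b [na nb ->]]] := negligible_sub f; have [d nd Ud] := loc_U x.
exists (d + b); first exact: negligibleD.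
have -> : S (d + b) (S (a - b) x - x) = (S a (S d x) - S d x) - (S b (S d x) - S d x).
  have e1 : d + b + (a - b) = a + d by rewrite addrACA subrr addr0 addrC.
  by rewrite S_sub -SD e1 [d + b]addrC !SD opprB addrA subrK.
by apply: (subspaceB (lift_set_subspace _)); [apply: na | apply: nb].
Qed.

Lemma phi0 : phi 0 = 0. Proof. by have := phi_lin (-1) 0 0; rewrite scaler0 addr0 mulN1r addNr. Qed.

Lemma phiB x y : phi (x - y) = phi x - phi y.
Proof. by rewrite addrC -scaleN1r phi_lin mulN1r addrC. Qed.

Lemma phiD x y : phi (x + y) = phi x + phi y.
Proof. by rewrite -[x]scale1r phi_lin mul1r scale1r. Qed.

(* W p consists of vectors of the form S (c p) x - x, which phi annihilates. *)
Lemma phi_W p (y : L) : W p y -> phi (usub_val y) = 0.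
Proof.
pose X (y : L) := exists x, usub_val y = S (c p) x - x.
have Xs : is_subspace X.
  split=> [|a y1 y2 [x1 e1] [x2 e2]].
    by exists 0; rewrite subr0 -[X in S _ X](subrr 0) S_sub subrr; exact: (raddf0 (val : L -> M)).
  exists (a *: x1 + x2); rewrite S_lin opprD addrACA -scalerBr -e1 -e2.
  exact: usub_val_linear.
have Xa g : valid_gen n g -> forall y : L, Subspace Xs y -> Subspace Xs (Uq_act g y).
  move=> vg y1 [x1 e1]; exists (Uq_act g x1).
  have -> : usub_val (Uq_act g y1 : L) = Uq_act g (usub_val y1) by exact: val_usub_act.
  by rewrite e1 -S_act // addrC -scaleN1r act_linear // scaleN1r addrC.
move=> Wy; suff [x ->] : X y by rewrite phiB phi_S subrr.
by apply: (Wy (@UqSubmodule _ _ _ L (Subspace Xs) Xa)) => y' ey'; exists t0; rewrite ey' genE.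
Qed.

Lemma t0_notin_J : ~ J t0.
Proof.
case=> y [yt [w [Ww yw]]]; move/eqP: phi_t0; apply; rewrite -yt yw.
have h (s : seq I) : phi (usub_val (\sum_(p <- s) w p)) = 0.
  elim: s => [|p s IH]; first by rewrite big_nil -phi0; congr phi; exact: (raddf0 (val : L -> M)).
  rewrite big_cons; have -> (a b : L) : usub_val (a + b) = usub_val a + usub_val b.
    exact: (raddfD (val : L -> M)).
  by rewrite phiD IH addr0 (phi_W (Ww p)).
exact: h.
Qed.

Local Notation Q := (uquot_module (usum W)).

(** Let P be the preimage of a nonzero submodule. A vector of P outside J stays outside [loc J],
    because negligible shifts can be undone modulo J ([neg_reflect]). Hence [all_of_big] makes
    [loc P] everything, and [neg_reflect] brings [t0] back into P. *)
Lemma simple_quotient : Uq_simple Q.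
Proof.
split.
  exists (lquot_pi (usum W) (USub (introT (asboolP _) U_t0))) => e.
  apply: t0_notin_J; set y := USub _ in e; exists y; split=> //.
  have /lquot_eqP/asboolP : lquot_pi (usum W) y = lquot_pi (usum W) 0.
    by apply: etrans e _; apply: esym; exact: (linear0 (lquot_pi (usum W))).
  by rewrite subr0.
move=> N; have [N0 Nl] := sub_setP N.
case: (pselect (sub_set N = [set 0]%classic)) => [|Nn]; [by left | right].
have Ps : is_subspace (fun y : L => N (lquot_pi (usum W) y)).
  split; first by rewrite (linear0 (lquot_pi (usum W))).
  by move=> a x y Nx Ny; rewrite linearP; apply: Nl.
have Pa g : valid_gen n g -> forall y : L, Subspace Ps y -> Subspace Ps (Uq_act g y).
  move=> vg y Ny; rewrite /= (uquot_actE (usum W) vg).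
  exact: (@usub_stable F n q Q N g vg _ Ny).
pose P : Uq_submodule L := @UqSubmodule _ _ _ L (Subspace Ps) Pa.
have JP y : J y -> lift_set P y.
  case=> y' [<- Wy']; exists y'; split=> //=.
  have <- : lquot_pi (usum W) 0 = lquot_pi (usum W) y'.
    by apply/esym/lquot_eqP/asboolP; rewrite subr0.
  by rewrite (linear0 (lquot_pi (usum W))).
have [y Ny yn] : exists2 y : L, P y & ~ usum W y.
  apply: contrapT => h; apply: Nn; apply/seteqP; split=> [x Nx|x ->] //=.
  rewrite -[x]lquot_reprK -(linear0 (lquot_pi (usum W))); apply/lquot_eqP/asboolP.
  rewrite subr0; apply: contrapT => nx; apply: h; exists (lquot_repr x) => //.
  by rewrite /= lquot_reprK.
have [Js _ _] : stable_pred (loc J) by apply: loc_stable.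
have all := @all_of_big (loc (lift_set P)) (loc J) (loc_stable JP) Js.
apply/seteqP; split=> // x _.
suff PU u : U u -> lift_set P u.
  by rewrite -[x]lquot_reprK; apply: (lift_setP (X := P)); apply/PU/val_U.
have Pt0 : lift_set P t0.
  have [||a na Pa0] := all _ loc_J_shift _ t0.
  - by move=> z [a na Ja]; exists a => //; apply: JP.
  - exists (usub_val y); split; first by exists 0; [exact: negligible0 | rewrite S0; exists y].
    by case=> a na /(neg_reflect (fun _ => id) na (val_U y))/lift_setP.
  - exact: neg_reflect JP na U_t0 Pa0.
move=> Uu; apply: (Uu (@UqSubmodule _ _ _ M (Subspace (lift_set_subspace P)) (fun g vg x => @lift_set_act P g x vg))).
by move=> _ ->.
Qed.

End Localization.

(** * Tableaux modulo m and the coefficients of the action *)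

Section Tableaux.
Variables (R : realType) (n m k i j : nat).
Hypotheses (m_ge3 : (3 <= m)%N) (m_odd : odd m).
Hypotheses (i_gt0 : (1 <= i)%N) (ij : (i < j)%N) (jk : (j <= k)%N) (kn : (k < n)%N).
Local Notation C := R[i].
Variable v : nat -> nat -> C.
Hypothesis v_sing : v k i = v k j.
Hypothesis v_reg : forall r s t, (1 <= s <= r)%N -> (1 <= t <= r)%N -> (r < n)%N ->
  s != t -> (r, s, t) \notin [:: (k, i, j); (k, j, i)] -> ~ half_integer (v r s - v r t).
Local Notation I := (GTindex n m k i j).
Local Notation E := (@entry n m k i j).
Local Notation ge := (@generic_entry R n m k i j v).
Local Notation del := (delta n m k i j).
Local Notation lattice := {ffun rpos n k i j -> int}.
Local Notation jetP := (@jetP R m m_ge3).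
Implicit Types (z d : I) (p : rpos n k i j).

Let m_gt1 : (1 < m)%N. Proof. exact: ltnW. Qed.
Let ik : (1 <= i <= k)%N. Proof. by rewrite i_gt0 (leq_trans (ltnW ij)). Qed.
Let jk' : (1 <= j <= k)%N. Proof. by rewrite jk (leq_trans i_gt0) // ltnW. Qed.
Let ji : (j == i) = false. Proof. exact: gtn_eqF. Qed.
Let ij' : (i == j) = false. Proof. exact: ltn_eqF. Qed.
Let k_gt0 : (0 < k)%N. Proof. by case/andP: ik => i1; apply: leq_trans. Qed.
Let k1k : (k.-1 < k)%N. Proof. by rewrite prednK. Qed.
Let k1n : (k.-1 < n)%N. Proof. exact: ltn_trans kn. Qed.
Let kn' : (1 <= k < n)%N. Proof. by rewrite k_gt0. Qed.

(** * Entries, and congruence modulo m on the rows <= r *)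

Lemma tauK : involutive (@tau n m k i j).
Proof. by case=> z1 [z2 z3]. Qed.

Lemma tauD z z' : tau (z + z') = tau z + tau z'.
Proof. by []. Qed.

(** As T and DT at z and [tau z] agree up to sign, only tau-symmetric sets of indices define
    projections of V(T(v)). *)
Definition tausym (S : pred I) : pred I := fun z => S z || S (tau z).

Lemma tausym_tau S z : tausym S (tau z) = tausym S z.
Proof. by rewrite /tausym tauK orbC. Qed.

Let ki_neq_kj : ((k, i) == (k, j)) = false.
Proof. by apply/negP => /eqP[e]; move: ij; rewrite e ltnn. Qed.

Lemma entry_ki z : E z k i = (z.2.1 : nat).
Proof. by rewrite /entry eqxx. Qed.

Lemma entry_kj z : E z k j = (z.2.2 : nat).
Proof. by rewrite /entry eq_sym ki_neq_kj eqxx. Qed.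

Lemma pos_inj p p' : pos_row p = pos_row p' -> pos_col p = pos_col p' -> p = p'.
Proof.
case: p p' => -[a b] ab [[a' b'] ab']; rewrite /pos_row /pos_col /= => e1 e2.
apply: val_inj => /=; congr pair; exact: val_inj.
Qed.

Lemma pos_regular p :
  [/\ (1 <= pos_col p)%N, (pos_col p <= pos_row p)%N, (pos_row p < n)%N,
     (pos_row p, pos_col p) != (k, i) & (pos_row p, pos_col p) != (k, j)].
Proof.
case: p => -[a b] rp; move: (rp); rewrite /regular_pos /pos_row /pos_col /= !inE negb_or.
by move=> /andP[/andP[-> ->] /andP[-> ->]].
Qed.

Lemma entry_pos z p : E z (pos_row p) (pos_col p) = z.1 p.
Proof.
have [_ _ _ ni nj] := pos_regular p; rewrite /entry (negPf ni) (negPf nj).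
case: pickP => [p' /eqP[e1 e2]|/(_ p)]; last by rewrite eqxx.
by rewrite (pos_inj e1 e2).
Qed.

Variant entry_spec a b : bool -> bool -> Prop :=
| EntryKI of a = k & b = i : entry_spec a b true false
| EntryKJ of a = k & b = j : entry_spec a b false true
| EntryPos p of a = pos_row p & b = pos_col p : entry_spec a b false false.

Lemma entryP a b : (1 <= b <= a)%N -> (a < n)%N ->
  entry_spec a b ((a, b) == (k, i)) ((a, b) == (k, j)).
Proof.
move=> ba an; have [[-> ->]|ni] := altP ((a, b) =P (k, i)).
  by rewrite ki_neq_kj; constructor.
have [[-> ->]|nj] := altP ((a, b) =P (k, j)); first by constructor.
have bn : (b < n)%N by case/andP: ba => _ /leq_ltn_trans; apply.
have rp : regular_pos k i j (Ordinal an, Ordinal bn).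
  by rewrite /regular_pos /= ba !inE negb_or ni nj.
exact: (@EntryPos _ _ (exist _ (Ordinal an, Ordinal bn) rp)).
Qed.

Lemma val_Zp_add (x y : 'Z_m) : (m%:Z %| (x + y : 'Z_m)%R%:Z - (x%:Z + y%:Z))%Z.
Proof.
rewrite -PoszD -eqz_mod_dvd; apply/eqP; rewrite !modz_nat; congr Posz.
by rewrite /=; move: (nat_of_ord x) (nat_of_ord y) => a b; rewrite Zp_cast // modn_mod.
Qed.

Lemma entry0 a b : E 0 a b = 0.
Proof.
rewrite /entry; case: ifP => // _; case: ifP => // _.
by case: pickP => // p _; rewrite ffunE.
Qed.

(** Only a congruence holds, because [entry] takes representatives in {0, ..., m-1} at (k, i) and
    (k, j). *)
Lemma entryD z d a b : (m%:Z %| E (z + d) a b - (E z a b + E d a b))%Z.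
Proof.
rewrite /entry; case: ifP => _; first exact: val_Zp_add.
case: ifP => _; first exact: val_Zp_add.
by case: pickP => [p _|_]; rewrite ?ffunE subrr.
Qed.

Lemma entryB z d a b : (m%:Z %| E (z - d) a b - (E z a b - E d a b))%Z.
Proof.
have := entryD (z - d) d a b; rewrite subrK; set x := E (z - d) a b => h.
by rewrite (_ : x - _ = - (E z a b - (x + E d a b))) ?rpredN //; ring.
Qed.

Lemma entry_tau z a b : a != k -> E (tau z) a b = E z a b.
Proof. by move=> ak; rewrite /entry !xpair_eqE (negPf ak). Qed.

Lemma val_Zp1 : nat_of_ord (1%R : 'Z_m) = 1%N.
Proof. by rewrite /= ?Zp_cast // modn_small. Qed.

Lemma entry_delta r s a b : (1 <= s <= r)%N -> (r < n)%N -> (1 <= b <= a)%N -> (a < n)%N ->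
  E (delta n m k i j r s) a b = ((a, b) == (r, s))%:Z.
Proof.
move=> sr rn ba an; rewrite /delta; case: (entryP ba an) => // [-> ->|-> ->|p -> ->].
- by rewrite entry_ki /= eq_sym; case: eqP => _; rewrite ?val_Zp1.
- by rewrite entry_kj /= eq_sym; case: eqP => _; rewrite ?val_Zp1.
- by rewrite entry_pos ffunE natz.
Qed.

(** At (k, i) and (k, j) the index is itself a residue, so divisibility by m becomes vanishing
    there. *)
Definition latrow r d : bool :=
  [forall p : rpos n k i j, (pos_row p <= r)%N ==> (m%:Z %| d.1 p)%Z] && ((k <= r)%N ==> (d.2 == 0)).

Definition eqrow r z z' := latrow r (z - z').

Lemma latrowP r d : reflect
  (forall a b, (1 <= b <= a)%N -> (a < n)%N -> (a <= r)%N -> (m%:Z %| E d a b)%Z)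
  (latrow r d).
Proof.
apply: (iffP andP) => [[/forallP hp hk] a b ba an ar|H].
  case: (entryP ba an) ar => [-> ->|-> ->|p -> ->] ar.
  - by rewrite entry_ki; move: hk; rewrite ar => /eqP ->; rewrite dvdz0.
  - by rewrite entry_kj; move: hk; rewrite ar => /eqP ->; rewrite dvdz0.
  - by rewrite entry_pos; have /implyP := hp p; apply.
split; first apply/forallP => p; apply/implyP => pr.
  by have [? ? ? _ _] := pos_regular p; rewrite -entry_pos H //; apply/andP.
have hz (x : 'Z_m) : (m%:Z %| (nat_of_ord x)%:Z)%Z -> x = 0.
  move=> h; apply: val_inj; apply/eqP; move: h; rewrite /dvdz /=.
  have xm : (x < m)%N by rewrite -[m in (_ < m)%N](Zp_cast m_gt1) ltn_ord.
  by case: (posnP x) => [->//|x0 /dvdn_leq-/(_ x0)]; rewrite leqNgt xm.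
apply/eqP; case: d H => d1 [d2 d3] H; congr pair; apply: hz.
  by have := H k i ik kn pr; rewrite entry_ki.
by have := H k j jk' kn pr; rewrite entry_kj.
Qed.

Lemma latrow0 r : latrow r 0.
Proof. by apply/latrowP => a b _ _ _; rewrite entry0 dvdz0. Qed.

Lemma latrowB r d d' : latrow r d -> latrow r d' -> latrow r (d - d').
Proof.
move=> /latrowP h /latrowP h'; apply/latrowP => a b ba an ar.
have e := entryB d d' a b; rewrite -(subrK (E d a b - E d' a b) (E (d - d') a b)).
by rewrite rpredD // rpredB ?h ?h'.
Qed.

Lemma latrowN r d : latrow r (- d) = latrow r d.
Proof.
have h e : latrow r e -> latrow r (- e) by rewrite -[- e]add0r; apply: latrowB (latrow0 r).
by apply/idP/idP => /h //; rewrite opprK.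
Qed.

Lemma latrowD r d d' : latrow r d -> latrow r d' -> latrow r (d + d').
Proof. by move=> h h'; rewrite -(opprK d') latrowB ?latrowN. Qed.

Lemma eqrow_refl r z : eqrow r z z.
Proof. by rewrite /eqrow subrr latrow0. Qed.

Lemma eqrow_sym r z z' : eqrow r z z' = eqrow r z' z.
Proof. by rewrite /eqrow -latrowN opprB. Qed.

Lemma eqrow_trans r z2 z1 z3 : eqrow r z1 z2 -> eqrow r z2 z3 -> eqrow r z1 z3.
Proof. by rewrite /eqrow => h h'; have := latrowD h h'; rewrite addrA subrK. Qed.

Lemma eqrowDr r z z' d : eqrow r (z + d) (z' + d) = eqrow r z z'.
Proof. by rewrite /eqrow opprD addrACA subrr addr0. Qed.

Lemma latrow_le r r' d : (r' <= r)%N -> latrow r d -> latrow r' d.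
Proof.
move=> rr /latrowP h; apply/latrowP => a b ba an ar; apply: h => //.
exact: leq_trans rr.
Qed.

Lemma eqrow_le r r' z z' : (r' <= r)%N -> eqrow r z z' -> eqrow r' z z'.
Proof. exact: latrow_le. Qed.

Lemma eqrow_tau r z z' : eqrow r (tau z) (tau z') = eqrow r z z'.
Proof.
rewrite /eqrow /latrow /=; congr (_ && (_ ==> _)).
case: z z' => z1 [a b] [z1' [a' b']].
change (((b - b', a - a') == (0, 0) :> 'Z_m * 'Z_m) = ((a - a', b - b') == (0, 0))).
by rewrite !xpair_eqE andbC.
Qed.

Lemma eqrow_entry r z z' a b : eqrow r z z' -> (1 <= b <= a)%N -> (a < n)%N -> (a <= r)%N ->
  (m%:Z %| E z a b - E z' a b)%Z.
Proof.
move=> /latrowP h ba an ar; have := entryB z z' a b; have := h a b ba an ar.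
set x := E (z - z') a b; set y := E z a b - _ => h1 h2.
by rewrite -(subKr x y) rpredB.
Qed.

Lemma eqrowP r z z' : reflect
  (forall a b, (1 <= b <= a)%N -> (a < n)%N -> (a <= r)%N -> (m%:Z %| E z a b - E z' a b)%Z)
  (eqrow r z z').
Proof.
apply: (iffP idP) => [h a b|H]; first exact: eqrow_entry.
apply/latrowP => a b ba an ar; have := entryB z z' a b; have := H a b ba an ar.
set x := E z a b - E z' a b => h1 h2.
by rewrite -(subrK x (E _ a b)) rpredD.
Qed.

Definition lat (f : lattice) : I := ([ffun p => f p * m%:Z], 0).

Lemma tau_lat z f : tau (z + lat f) = tau z + lat f.
Proof. by rewrite tauD; congr (_ + _). Qed.

Lemma latD f g : lat (f + g) = lat f + lat g.
Proof.
by congr pair; [apply/ffunP => p; rewrite !ffunE mulrDl | rewrite addr0].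
Qed.

Lemma lat0 : lat 0 = 0.
Proof. by congr pair; apply/ffunP => p; rewrite !ffunE mul0r. Qed.

Lemma entry_lat z f a b : (m%:Z %| E (z + lat f) a b - E z a b)%Z.
Proof.
have h : (m%:Z %| E (lat f) a b)%Z.
  rewrite /entry; case: ifP => //= _; case: ifP => //= _.
  by case: pickP => // p _; rewrite ffunE dvdz_mull.
have := entryD z (lat f) a b; move: h; move: (E (z + lat f) a b) (E z a b) (E (lat f) a b) => x y u hu hx.
by rewrite -(subrK (y + u) x) -addrA rpredD // addrAC subrr add0r.
Qed.

Definition ent z r s : C := v r s + (E z r s)%:~R.

Lemma qpow_dvd (x y : C) (d : int) : x - y = d%:~R -> (m%:Z %| d)%Z -> qpow m x = qpow m y.
Proof. by move=> e dm; apply: qpow_mod; rewrite e qpow_int_eq1. Qed.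

Lemma qnum_dvd (x y : C) (d : int) : x - y = d%:~R -> (m%:Z %| d)%Z -> qnum m x = qnum m y.
Proof.
move=> e dm; rewrite /qnum !(@qpow_dvd x y d) //; congr ((_ - _) / _).
by apply: (@qpow_dvd _ _ (- d)); rewrite ?rpredN // mulrNz -e; ring.
Qed.

Lemma qnumK_dvd (x y : affine R) (d : int) : x.1 - y.1 = d%:~R -> x.2 = y.2 ->
  (m%:Z %| d)%Z -> qnumK m x = qnumK m y.
Proof.
move=> e e2 dm; rewrite /qnumK /qpowK.
have -> : (- x).1 = - x.1 by [].
have -> : (- y).1 = - y.1 by [].
have -> : (- x).2 = - x.2 by [].
have -> : (- y).2 = - y.2 by [].
rewrite !qpowN // (@qpow_dvd x.1 y.1 d) // e2 //.
Qed.

(** * The coefficients of E and F and their expansions *)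

Definition adj (up : bool) r := if up then r.+1 else r.-1.

Definition gen (up : bool) r := if up then UE r else UF r.

Definition mv (up : bool) r s z : I := if up then z + del r s else z - del r s.

(** E_r and F_r have coefficients of one shape: a numerator over the adjacent row [adj up r] and a
    denominator over row r. The sign is the minus in the formula for E_r. *)
Definition actK (up : bool) r s z : ratK R := (-1) ^+ up *
  ((\prod_(1 <= t < (adj up r).+1) qnumK m (ge z r s - ge z (adj up r) t)) /
   (\prod_(1 <= t < r.+1 | t != s) qnumK m (ge z r s - ge z r t))).

Definition actnum (up : bool) r s z : C :=
  \prod_(1 <= t < (adj up r).+1) qnum m (ent z r s - ent z (adj up r) t).
Definition actden r s z : C := \prod_(1 <= t < r.+1 | t != s) qnum m (ent z r s - ent z r t).

Definition actc (up : bool) r s z : C := (-1) ^+ up * (actnum up r s z / actden r s z).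

Definition actd (up : bool) r s z : C := Dv m (actK up r s z).

(** The entries enter only through powers of q, and q^m = 1. Row n, which occurs for E_(n-1),
    carries no index and is treated apart. *)
Lemma eq_actK (up : bool) r s z z' : (1 <= s <= r)%N -> (r < n)%N ->
  (forall a b, (1 <= b <= a)%N -> (a < n)%N -> a = r \/ a = adj up r ->
     (m%:Z %| E z a b - E z' a b)%Z) ->
  actK up r s z = actK up r s z'.
Proof.
move=> sr rn H; have top a b : (n <= a)%N -> E z a b = E z' a b.
  move=> na; have ka : (a == k) = false by apply: gtn_eqF; apply: leq_trans na.
  rewrite /entry !xpair_eqE ka /=; case: pickP => // p /eqP[pa _].
  by have [_ _ + _ _] := pos_regular p; rewrite pa ltnNge na.
have H' a b : (1 <= b <= a)%N -> a = r \/ a = adj up r -> (m%:Z %| E z a b - E z' a b)%Z.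
  by move=> ba ha; have [an|/top ->] := ltnP a n; [apply: H | rewrite subrr dvdz0].
have e1 : \prod_(1 <= t < (adj up r).+1) qnumK m (ge z r s - ge z (adj up r) t) =
    \prod_(1 <= t < (adj up r).+1) qnumK m (ge z' r s - ge z' (adj up r) t).
  apply: eq_big_nat => t /andP[t1 tr].
  apply: (@qnumK_dvd _ _ ((E z r s - E z' r s) - (E z (adj up r) t - E z' (adj up r) t))) => //=.
    by rewrite /ent /= !intrB; ring.
  by apply: rpredB; apply: H'; rewrite ?t1 //; [left | right].
have e2 : \prod_(1 <= t < r.+1 | t != s) qnumK m (ge z r s - ge z r t) =
    \prod_(1 <= t < r.+1 | t != s) qnumK m (ge z' r s - ge z' r t).
  rewrite big_nat_cond [RHS]big_nat_cond; apply: eq_bigr => t /andP[/andP[t1 tr] _].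
  apply: (@qnumK_dvd _ _ ((E z r s - E z' r s) - (E z r t - E z' r t))) => //=.
    by rewrite /ent /= !intrB; ring.
  by apply: rpredB; apply: H'; rewrite ?t1 //; left.
by rewrite /actK e1 e2.
Qed.

Lemma jet_sign (up : bool) : jet m ((-1) ^+ up : ratK R) ((-1) ^+ up) 0.
Proof.
have -> : (-1 : ratK R) ^+ up = Kconst ((-1) ^+ up); last exact: jet_const.
by rewrite /Kconst !(rmorphXn, rmorphN1).
Qed.

Lemma jetM0 f g (a c : C) : jet m f a 0 -> jet m g c 0 -> jet m (f * g) (a * c) 0.
Proof.
move=> jf jg; have := jetM jf jg.
by have -> : a * 0 + 0 * c = 0 by rewrite mulr0 mul0r addr0.
Qed.

Lemma jetV0 f (a : C) : a != 0 -> jet m f a 0 -> jet m f^-1 a^-1 0.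
Proof.
move=> a0 jf; have := jetV a0 jf.
by have -> : - 0 / a ^+ 2 = 0 by rewrite oppr0 mul0r.
Qed.

Lemma jet_prod0 (s : seq nat) (P : pred nat) (F : nat -> ratK R) (a : nat -> C) :
  (forall t, P t -> t \in s -> jet m (F t) (a t) 0) ->
  jet m (\prod_(t <- s | P t) F t) (\prod_(t <- s | P t) a t) 0.
Proof.
elim: s => [|t s IH] H.
  rewrite !big_nil; have := @jet_const R m 1.
  by rewrite /Kconst !rmorph1.
rewrite !big_cons; have IH' := IH (fun u Pu us => H u Pu (mem_behead (s := t :: s) us)).
case: ifP => // Pt; have := jetM (H t Pt (mem_head _ _)) IH'.
by rewrite mulr0 mul0r addr0.
Qed.

Lemma jet_prod (s : seq nat) (P : pred nat) (F : nat -> ratK R) (a : nat -> C) :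
  (forall t, P t -> t \in s -> exists b, jet m (F t) (a t) b) ->
  exists b, jet m (\prod_(t <- s | P t) F t) (\prod_(t <- s | P t) a t) b.
Proof.
elim: s => [|t s IH] H.
  exists 0; rewrite !big_nil; have := @jet_const R m 1.
  by rewrite /Kconst !rmorph1.
rewrite !big_cons; have [b IH'] := IH (fun u Pu us => H u Pu (mem_behead (s := t :: s) us)).
case: ifP => Pt; last by exists b.
have [b' Hb'] := H t Pt (mem_head _ _).
by exists (a t * b + b' * \prod_(u <- s | P u) a u); apply: jetM.
Qed.

Lemma jet_entry z r s r' t : exists b,
  jet m (qnumK m (ge z r s - ge z r' t)) (qnum m (ent z r s - ent z r' t)) b.
Proof. by eexists; apply: jet_qnumK. Qed.

Lemma jet_entry0 z r s r' t : r != k -> r' != k ->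
  jet m (qnumK m (ge z r s - ge z r' t)) (qnum m (ent z r s - ent z r' t)) 0.
Proof.
move=> rk rk'; have := jet_qnumK m_ge3 (ge z r s - ge z r' t).
rewrite /generic_entry !xpair_eqE (negPf rk) (negPf rk') /=.
by rewrite !subrr mulr0z !mul0r.
Qed.

Lemma jet_actK (up : bool) r s z : actden r s z != 0 -> exists b, jet m (actK up r s z) (actc up r s z) b.
Proof.
move=> d0; have [bn jn] : exists b, jet m (\prod_(1 <= t < (adj up r).+1)
    qnumK m (ge z r s - ge z (adj up r) t)) (actnum up r s z) b.
  by apply: jet_prod => t _ _; apply: jet_entry.
have [bd jd] : exists b, jet m (\prod_(1 <= t < r.+1 | t != s) qnumK m (ge z r s - ge z r t))
    (actden r s z) b.
  by apply: jet_prod => t _ _; apply: jet_entry.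
by eexists; apply: jetM (jet_sign up) (jetM jn (jetV d0 jd)).
Qed.

Lemma jet_actK0 (up : bool) r s z : r != k -> adj up r != k -> actden r s z != 0 ->
  jet m (actK up r s z) (actc up r s z) 0.
Proof.
move=> rk ak d0; have jn : jet m (\prod_(1 <= t < (adj up r).+1)
    qnumK m (ge z r s - ge z (adj up r) t)) (actnum up r s z) 0.
  by apply: jet_prod0 => t _ _; apply: jet_entry0.
have jd : jet m (\prod_(1 <= t < r.+1 | t != s) qnumK m (ge z r s - ge z r t))
    (actden r s z) 0.
  by apply: jet_prod0 => t _ _; apply: jet_entry0.
exact: jetM0 (jet_sign up) (jetM0 jn (jetV0 d0 jd)).
Qed.

Definition regular_at r z := (r != k) || (z.2.1 != z.2.2).

(** Outside the singular pair a zero would make v_rs - v_rt a half-integer. Inside it v_ki = v_kj,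
    the argument is an integer, and a zero means z_ki = z_kj. *)
Lemma qnum_row_neq0 r s t z : (1 <= s <= r)%N -> (1 <= t <= r)%N -> (r < n)%N -> s != t ->
  regular_at r z -> qnum m (ent z r s - ent z r t) != 0.
Proof.
move=> sr tr rn st reg; apply/eqP => q0.
have [|sing] := boolP ((r, s, t) \notin [:: (k, i, j); (k, j, i)]).
  move=> /(v_reg sr tr rn st); apply.
  have [p [e _]] := qnum_eq0_half m_ge3 q0; exists (p - (E z r s - E z r t) * 2).
  rewrite intrB intrM mulrBl -e mulfK ?pnatr_eq0 // /ent !intrB; ring.
have m1 : (1 < m)%N by apply: ltnW.
have val_lt (x : 'Z_m) : (x < m)%N by rewrite -[m in (_ < m)%N](Zp_cast m1) ltn_ord.
have fin (a b : 'Z_m) : qnum m ((a : nat)%:~R - (b : nat)%:~R : C) = 0 -> a = b.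
  rewrite -intrB => /(qnum_int_eq0 m_ge3 m_odd); rewrite -eqz_mod_dvd !modz_nat.
  by rewrite eqz_nat !modn_small ?val_lt // => /eqP/val_inj.
move: sing q0; rewrite negbK !inE => /orP[] /eqP[er es et]; subst r s t;
  rewrite /ent entry_ki entry_kj // v_sing opprD addrACA subrr add0r => /fin e;
  by move: reg; rewrite /regular_at eqxx e eqxx.
Qed.

Lemma actden_neq0 r s z : (1 <= s <= r)%N -> (r < n)%N -> regular_at r z -> actden r s z != 0.
Proof.
move=> sr rn reg; rewrite /actden big_nat_cond prodf_seq_neq0; apply/allP => t _.
apply/implyP => /andP[/andP[t1 tr] ts]; apply: qnum_row_neq0 => //.
  by rewrite t1.
by rewrite eq_sym.
Qed.

Lemma jet_qnum_xy : jet m (qnum_xy R m) 0 1.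
Proof.
have e1 : qnum m (0 : C) = 0 by rewrite /qnum oppr0 subrr mul0r.
have e2 : (1 - (-1) : int)%:~R / 4 * (qpow m 0 + qpow m (- 0)) = 1 :> C.
  rewrite oppr0 qpow0 opprK -[(1 + 1 : int)%:~R]/(2 : C) -[1 + 1]/(2 : C) mulrAC.
  by rewrite -natrM mulfV // pnatr_eq0.
suff : jet m (qnum_xy R m) (qnum m 0)
    ((1 - (-1) : int)%:~R / 4 * (qpow m 0 + qpow m (- 0))) by rewrite e1 e2.
exact: (jet_qnumK m_ge3 (0, (1, -1))).
Qed.

(** The factor [x - y]_q turns D^v into evaluation: where the coefficients are regular, T transforms
    by the classical formulas and yields no DT. *)
Lemma jet_xyM f a b : jet m f a b -> jet m (qnum_xy R m * f) 0 a.
Proof. by move=> jf; have := jetM jet_qnum_xy jf; rewrite !mul0r add0r mul1r. Qed.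

Lemma mv_inj up r s s' z : (1 <= s <= r)%N -> (1 <= s' <= r)%N -> (r < n)%N ->
  mv up r s z = mv up r s' z -> s = s'.
Proof.
move=> sr sr' rn e; have de : del r s = del r s'.
  by case: up e => [/addrI|/addrI/oppr_inj].
have := congr1 (fun d => E d r s) de.
rewrite !entry_delta // eqxx /= => /eqP; rewrite eqz_nat eq_sym eqb1.
by case/eqP.
Qed.

Lemma KDv0 : Kval m (0 : ratK R) = 0 /\ Dv m (0 : ratK R) = 0.
Proof.
have := @jet_const R m 0; rewrite /Kconst !rmorph0 => j0.
by have [-> ->] := jetP j0.
Qed.

Lemma actd0 up r s z : (1 <= s <= r)%N -> (r < n)%N -> r != k -> adj up r != k -> actd up r s z = 0.
Proof.
move=> sr rn rk ak; have reg : regular_at r z by rewrite /regular_at rk.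
have jf := jet_actK0 rk ak (actden_neq0 sr rn reg).
by have [_] := jetP jf.
Qed.

Lemma mv_lat up r s z f : mv up r s (z + lat f) = mv up r s z + lat f.
Proof. by case: up; rewrite /mv addrAC. Qed.

Definition wt z r : C := (generic_weight v z r).1.

Lemma wtE z r : wt z r = \sum_(1 <= s < r.+1) ent z r s - \sum_(1 <= s < r) ent z r.-1 s + r%:R.
Proof.
by rewrite /wt /generic_weight /= !(big_morph (fun w : affine R => w.1) (id1 := 0) (op1 := +%R)).
Qed.

(** * The pole of F_k and the derivative of E_(k-1) *)

Lemma prod_extract (A : comNzRingType) (r : seq nat) (P : pred nat) (F : nat -> A) x :
  uniq r -> x \in r -> P x ->
  \prod_(t <- r | P t) F t = F x * \prod_(t <- r | P t && (t != x)) F t.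
Proof.
move=> ur xr Px; rewrite (bigID (pred1 x)) /=; congr (_ * _).
rewrite (eq_bigl (pred1 x)) => [|t /=]; first by rewrite -big_filter filter_pred1_uniq // big_seq1.
by case: eqP => [->|]; rewrite ?Px ?andbF.
Qed.

Lemma ent_diag z : z.2.1 = z.2.2 -> ent z k j = ent z k i.
Proof. by move=> zz; rewrite /ent entry_ki entry_kj zz v_sing. Qed.

Definition nonpair_prod (u : C) z : C :=
  \prod_(1 <= t < k.+1 | (t != i) && (t != j)) qnum m (u - ent z k t).

(* The residue of F_k at the pole z_ki = z_kj, up to sign. *)
Definition pole_coef z : C := (\prod_(1 <= t < k) qnum m (ent z k i - ent z k.-1 t)) / nonpair_prod (ent z k i) z.

Lemma nonpair_prod_neq0 z : nonpair_prod (ent z k i) z != 0.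
Proof.
rewrite /nonpair_prod big_nat_cond prodf_seq_neq0; apply/allP => t _.
apply/implyP => /andP[/andP[t1 tk] /andP[ti tj]]; apply/eqP => q0.
apply: (@v_reg k i t) => //; [by rewrite t1 | by rewrite eq_sym| |].
  by rewrite !inE !xpair_eqE !eqxx (negPf tj) /= (ltn_eqF ij).
have [p [e _]] := qnum_eq0_half m_ge3 q0; exists (p - (E z k i - E z k t) * 2).
rewrite intrB intrM mulrBl -e mulfK ?pnatr_eq0 // /ent !intrB; ring.
Qed.

Lemma qnumK_opp (w : affine R) : qnumK m (- w) = - qnumK m w.
Proof. by rewrite /qnumK (opprK w) -[RHS]mulNr opprB. Qed.

Lemma qnum_xy_neq0 : qnum_xy R m != 0.
Proof.
apply/eqP => e; have [_] := jetP jet_qnum_xy.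
by rewrite e KDv0.2 => /eqP; rewrite eq_sym oner_eq0.
Qed.

(** Here (s, s') is (i, j) or (j, i). The factor [x - y]_q cancels, up to the sign (-1)^e, the
    factor of the denominator that vanishes; what is left is regular. *)
Lemma Kval_diag s s' (e : bool) z : (1 <= s' <= k)%N -> s' != s ->
  qnumK m (ge z k s - ge z k s') = (-1) ^+ e * qnum_xy R m ->
  (forall t, ((t != s) && (t != s')) = ((t != i) && (t != j))) ->
  ent z k s = ent z k i ->
  Kval m (qnum_xy R m * actK false k s z) = (-1) ^+ e * pole_coef z.
Proof.
move=> sk' ss' eK eP es.
pose num := \prod_(1 <= t < k) qnumK m (ge z k s - ge z k.-1 t).
pose rst := \prod_(1 <= t < k.+1 | (t != i) && (t != j)) qnumK m (ge z k s - ge z k t).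
have -> : qnum_xy R m * actK false k s z = (-1) ^+ e * (num / rst).
  rewrite /actK /adj prednK; last exact: leq_ltn_trans (leq0n _) (leq_trans ij jk).
  rewrite (@prod_extract _ _ (fun t => t != s) _ s') ?iota_uniq ?mem_index_iota //= eK.
  rewrite (eq_bigl _ _ eP) -/num -/rst expr0 mul1r.
  have sg : ((-1) ^+ e : ratK R) ^-1 = (-1) ^+ e by case: (e); rewrite ?expr1 ?invrN1 // expr0 invr1.
  have fe (F : fieldType) (x y u w : F) : x != 0 -> u^-1 = u -> x * (y / (u * x * w)) = u * (y / w).
    move=> x0 eu; rewrite !invfM eu -[RHS](mulfK x0); ring.
  exact: fe qnum_xy_neq0 sg.
have [b1 j1] : exists b, jet m num (\prod_(1 <= t < k) qnum m (ent z k s - ent z k.-1 t)) b.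
  by apply: jet_prod => t _ _; apply: jet_entry.
have [b2 j2] : exists b, jet m rst (nonpair_prod (ent z k s) z) b.
  by apply: jet_prod => t _ _; apply: jet_entry.
have r0 := nonpair_prod_neq0 z; rewrite -es in r0.
have [-> _] := jetP (jetM (jet_sign e) (jetM j1 (jetV r0 j2))).
by rewrite /pole_coef -es.
Qed.

Lemma Kval_diag_j z : z.2.1 = z.2.2 -> Kval m (qnum_xy R m * actK false k j z) = - pole_coef z.
Proof.
move=> zz; rewrite -mulN1r; apply: (@Kval_diag j i true) => //; rewrite ?ent_diag ?(ltn_eqF ij) //.
  rewrite expr1 mulN1r -qnumK_opp; congr (qnumK m _).
  have -> : ge z k j - ge z k i = (ent z k j - ent z k i, (0 - 1, 1 - 0) : int * int).
    by rewrite /generic_entry !xpair_eqE !eqxx (gtn_eqF ij) (ltn_eqF ij).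
  rewrite (ent_diag zz) subrr.
  transitivity ((- 0 : C, (-1, 1)) : affine R); first by congr pair; rewrite oppr0.
  by [].

by move=> t; rewrite andbC.
Qed.

Lemma Kval_diag_i z : z.2.1 = z.2.2 -> Kval m (qnum_xy R m * actK false k i z) = pole_coef z.
Proof.
move=> zz; rewrite -[RHS]mul1r; apply: (@Kval_diag i j false) => //; rewrite ?(gtn_eqF ij) //.
rewrite expr0 mul1r; congr (qnumK m _).
have -> : ge z k i - ge z k j = (ent z k i - ent z k j, (1 - 0, 0 - 1) : int * int).
  by rewrite /generic_entry !xpair_eqE !eqxx (gtn_eqF ij) (ltn_eqF ij).
by rewrite ent_diag // subrr.
Qed.

Lemma prod_pair (A : comNzRingType) (F : nat -> A) : \prod_(1 <= t < k.+1) F t =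
  F i * F j * \prod_(1 <= t < k.+1 | (t != i) && (t != j)) F t.
Proof.
rewrite (@prod_extract _ _ xpredT _ i) ?iota_uniq ?mem_index_iota //= -mulrA; congr (_ * _).
by rewrite (@prod_extract _ _ (fun t => t != i) _ j) ?iota_uniq ?mem_index_iota ?(gtn_eqF ij).
Qed.

(* The derivative of [A - x][B - y] in the direction (1, -1) is a multiple of [A - B]. *)
Lemma qnum_wronskian (a b : C) :
  qnum m a * (4^-1 * (qpow m b + qpow m (- b))) + - (4^-1) * (qpow m a + qpow m (- a)) * qnum m b =
  qnum m (a - b) / 2.
Proof.
rewrite /qnum opprB !qpowD !qpowN.
have d0 := qdiff_neq0 R m_ge3; have a0 := qpow_neq0 m a; have b0 := qpow_neq0 m b.
have fe (F : numFieldType) (x y d : F) : d != 0 -> x != 0 -> y != 0 ->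
  (x - x^-1) / d * (4^-1 * (y + y^-1)) + - 4^-1 * (x + x^-1) * ((y - y^-1) / d) =
  (x / y - y / x) / d / 2.
  by move=> dn xn yn; field; rewrite dn xn yn.
exact: fe.
Qed.

(** In the coefficient of E_(k-1) only the factors at (k, i) and (k, j) depend on x and y;
    [qnum_wronskian] differentiates their product. *)
Lemma actd_pair s z : (1 < k)%N -> (1 <= s <= k.-1)%N ->
  actd true k.-1 s z = - (nonpair_prod (ent z k.-1 s) z * (qnum m (ent z k j - ent z k i) / 2)) /
    actden k.-1 s z.
Proof.
move=> k1 sk; have kp : (k.-1.+1 = k)%N by rewrite prednK // ltnW.
have kk : (k.-1 == k) = false by rewrite -{2}kp ltn_eqF.
set u := ent z k.-1 s.
have j1 : jet m (qnumK m (ge z k.-1 s - ge z k i)) (qnum m (u - ent z k i))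
    (- (4^-1) * (qpow m (u - ent z k i) + qpow m (- (u - ent z k i)))).
  have := jet_qnumK m_ge3 (ge z k.-1 s - ge z k i).
  have -> : ge z k.-1 s - ge z k i = (u - ent z k i, (0 - 1, 0 - 0) : int * int).
    by rewrite /generic_entry !xpair_eqE kk !eqxx (ltn_eqF ij).
  by rewrite !subr0 sub0r mulNr mul1r.
have j2 : jet m (qnumK m (ge z k.-1 s - ge z k j)) (qnum m (u - ent z k j))
    (4^-1 * (qpow m (u - ent z k j) + qpow m (- (u - ent z k j)))).
  have := jet_qnumK m_ge3 (ge z k.-1 s - ge z k j).
  have -> : ge z k.-1 s - ge z k j = (u - ent z k j, (0 - 0, 0 - 1) : int * int).
    by rewrite /generic_entry !xpair_eqE kk !eqxx (gtn_eqF ij).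
  by rewrite subr0 sub0r opprK mul1r.
have j3 : jet m (\prod_(1 <= t < k.+1 | (t != i) && (t != j)) qnumK m (ge z k.-1 s - ge z k t))
    (nonpair_prod u z) 0.
  apply: jet_prod0 => t /andP[ti tj] _; have := jet_qnumK m_ge3 (ge z k.-1 s - ge z k t).
  have -> : ge z k.-1 s - ge z k t = (u - ent z k t, (0 - 0, 0 - 0) : int * int).
    by rewrite /generic_entry !xpair_eqE kk !eqxx (negPf ti) (negPf tj).
  by rewrite !subr0 mulr0z !mul0r.
have d0 : actden k.-1 s z != 0.
  by apply: actden_neq0 => //; rewrite /regular_at kk.
have j4 : jet m (\prod_(1 <= t < k.-1.+1 | t != s) qnumK m (ge z k.-1 s - ge z k.-1 t))
    (actden k.-1 s z) 0.
  by apply: jet_prod0 => t _ _; apply: jet_entry0; rewrite ?kk.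
have [_] := jetP (jetM (jet_sign true) (jetM (jetM (jetM j1 j2) j3) (jetV0 d0 j4))).
rewrite -prod_pair {1}/actd /actK /adj kp => ->.
rewrite mulr0 mul0r addr0 !mulr0 add0r expr1 mulN1r mulNr -mulNr.
have -> : ent z k j - ent z k i = u - ent z k i - (u - ent z k j) by ring.
by rewrite qnum_wronskian add0r mulNr [nonpair_prod u z * _]mulrC.
Qed.

(** * Residues of the entries and moves between classes *)

Lemma Zp_int_eq0 (x : int) : (x%:~R == 0 :> 'Z_m) = (m%:Z %| x)%Z.
Proof.
have h (p : nat) : (p%:R == 0 :> 'Z_m) = (m %| p)%N.
  by rewrite -val_eqE /= val_Zp_nat.
by case: x => p; rewrite ?NegzE ?mulrNz ?oppr_eq0 -pmulrn h // rpredN.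
Qed.

Lemma Zp_int_eq (x y : int) : (x%:~R == y%:~R :> 'Z_m) = (m%:Z %| x - y)%Z.
Proof. by rewrite -subr_eq0 -intrB Zp_int_eq0. Qed.

Lemma Zp_val_int (x : 'Z_m) : (nat_of_ord x)%:~R = x :> 'Z_m.
Proof. by rewrite -pmulrn natr_Zp. Qed.

(* As q^m = 1, the coefficients of the action only depend on these residues. *)
Definition ez z r s : 'Z_m := (E z r s)%:~R.

Lemma ezD z d a b : ez (z + d) a b = ez z a b + ez d a b.
Proof. by rewrite /ez -intrD; apply/eqP; rewrite Zp_int_eq entryD. Qed.

Lemma ezB z d a b : ez (z - d) a b = ez z a b - ez d a b.
Proof. by rewrite /ez -intrB; apply/eqP; rewrite Zp_int_eq entryB. Qed.

Lemma ez0 a b : ez 0 a b = 0.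
Proof. by rewrite /ez entry0. Qed.

Lemma ez_delta r s a b : (1 <= s <= r)%N -> (r < n)%N -> (1 <= b <= a)%N -> (a < n)%N ->
  ez (del r s) a b = ((a, b) == (r, s))%:R.
Proof. by move=> sr rn ba an; rewrite /ez entry_delta // -pmulrn. Qed.

Lemma ez_ki z : ez z k i = z.2.1.
Proof. by rewrite /ez entry_ki Zp_val_int. Qed.

Lemma ez_kj z : ez z k j = z.2.2.
Proof. by rewrite /ez entry_kj Zp_val_int. Qed.

Lemma eqrow_ez r z z' : reflect
  (forall a b, (1 <= b <= a)%N -> (a < n)%N -> (a <= r)%N -> ez z a b = ez z' a b)
  (eqrow r z z').
Proof.
apply: (iffP (eqrowP r z z')) => H a b ba an ar; have := H a b ba an ar.
  by rewrite -Zp_int_eq => /eqP.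
by rewrite -Zp_int_eq => e; apply/eqP.
Qed.

Lemma eqrow_pair r z z' : (k <= r)%N -> eqrow r z z' -> z.2 = z'.2.
Proof.
move=> kr /andP[_]; rewrite kr => /eqP e; apply/eqP; rewrite -subr_eq0; exact/eqP.
Qed.

Definition tableau (e : nat -> nat -> 'Z_m) : I :=
  ([ffun p => (nat_of_ord (e (pos_row p) (pos_col p)))%:Z], (e k i, e k j)).

Lemma ez_tableau e a b : (1 <= b <= a)%N -> (a < n)%N -> ez (tableau e) a b = e a b.
Proof.
move=> ba an; rewrite /ez; case: (entryP ba an) => [-> ->|-> ->|p -> ->].
- by rewrite entry_ki Zp_val_int.
- by rewrite entry_kj Zp_val_int.
- by rewrite entry_pos ffunE Zp_val_int.
Qed.

Lemma ez_tau z a b : a != k -> ez (tau z) a b = ez z a b.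
Proof. by move=> ak; rewrite /ez entry_tau. Qed.

Lemma ez_tau_row z b : b != i -> b != j -> ez (tau z) k b = ez z k b.
Proof. by move=> bi bj; rewrite /ez /entry !xpair_eqE !eqxx (negPf bi) (negPf bj). Qed.

Lemma ez_mv up r s z a b : (1 <= s <= r)%N -> (r < n)%N -> (1 <= b <= a)%N -> (a < n)%N ->
  ez (mv up r s z) a b = ez z a b + (-1) ^+ (~~ up) * ((a, b) == (r, s))%:R.
Proof.
move=> sr rn ba an; case: up; rewrite /mv /=; first by rewrite ezD ez_delta // expr0 mul1r.
by rewrite ezB ez_delta // expr1 mulN1r.
Qed.

(* At the pole of F_k the terms s = i and s = j both contribute to the same
   tableau; elsewhere the term s is singled out by its class. *)
Definition simple_at r s z := [|| r != k, (s != i) && (s != j) | z.2.1 != z.2.2].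

Lemma regular_simple r s z : regular_at r z -> simple_at r s z.
Proof. by rewrite /regular_at /simple_at => /orP[->//|->]; rewrite !orbT. Qed.

Lemma signb_neq0 (b : bool) : (-1) ^+ b != 0 :> 'Z_m.
Proof. by case: b; rewrite ?expr0 ?expr1 ?oppr_eq0 oner_eq0. Qed.

(** The moved entry can be read off from the residues, so different terms land in different classes.
    Only [tau] could identify two of them, the moves at (k, i) and (k, j), and then z_ki = z_kj,
    which [simple_at] excludes. *)
Lemma mv_class up r r' s u z z' : (1 <= s <= r')%N -> (1 <= u <= r')%N -> (r' <= r)%N ->
  (r' < n)%N -> eqrow r z z' -> simple_at r' s z ->
  tausym (eqrow r (mv up r' s z)) (mv up r' u z') = (u == s).
Proof.
move=> sr ur r'r rn zz' sim; have s0 := signb_neq0 (~~ up); have zz := elimT (eqrow_ez r z z') zz'.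
apply/idP/eqP => [|->]; last first.
  apply/orP; left; apply/eqrow_ez => a b ba an ar.
  by rewrite !ez_mv // zz.
have key a b : (1 <= b <= a)%N -> (a < n)%N -> (a <= r)%N ->
    ez (mv up r' s z) a b = ez (mv up r' u z') a b -> ((a, b) == (r', s)) = ((a, b) == (r', u)).
  move=> ba an ar; rewrite !ez_mv // zz // => /addrI/eqP; rewrite -subr_eq0 -mulrBr.
  case: ((a, b) == (r', s)); case: ((a, b) == (r', u)) => //=;
    by rewrite ?subr0 ?sub0r ?mulrN mulr1 ?oppr_eq0 (negPf s0).
have done : ((r', s) == (r', s)) = ((r', s) == (r', u)) -> u = s.
  by rewrite eqxx => /esym/eqP[].
case/orP => /eqrow_ez h; first by apply: done; apply: key => //; apply: h.
have [r'k|r'k] := eqVneq r' k; last first.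
  by apply: done; apply: key => //; rewrite h // ez_tau.
subst r'; have [sij|sij] := boolP ((s != i) && (s != j)).
  by have /andP[si sj] := sij; apply: done; apply: key => //; rewrite h // ez_tau_row.
have [uij|uij] := boolP ((u != i) && (u != j)).
  have /andP[ui uj] := uij; have : ((k, u) == (k, s)) = ((k, u) == (k, u)).
    by apply: key => //; rewrite h // ez_tau_row.
  by rewrite eqxx => /eqP[].
move: sim; rewrite /simple_at eqxx (negPf sij) /= => zne.
have e1 : z.2 = z'.2 by apply: eqrow_pair zz'.
move: sij uij; rewrite !negb_and !negbK => /orP[] /eqP es /orP[] /eqP eu; subst s u => //.
  have := h k i ik kn r'r; rewrite ez_mv // eqxx ez_ki [in RHS]/ez entry_ki Zp_val_int /=.
  have -> : (mv up k j z').2.2 = z'.2.2 + (-1) ^+ (~~ up) * 1.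
    by rewrite -ez_kj ez_mv // eqxx ez_kj.
  by move/addIr => e; move: zne; rewrite e e1 eqxx.
have := h k j jk' kn r'r; rewrite ez_mv // eqxx ez_kj [in RHS]/ez entry_kj Zp_val_int /=.
have -> : (mv up k i z').2.1 = z'.2.1 + (-1) ^+ (~~ up) * 1.
  by rewrite -ez_ki ez_mv // eqxx ez_ki.
by move/addIr => e; move: zne; rewrite e e1 eqxx.
Qed.

(* The factor of F_r that vanishes when the entry (r, s) is blocked by (r - 1, t). *)
Definition unblocked z r s t := qnum m (ent z r s - ent z r.-1 t) != 0.

Lemma ent_qnum_eq (x y : int) (c : C) : x%:~R = y%:~R :> 'Z_m ->
  qnum m (c + x%:~R) = qnum m (c + y%:~R).
Proof.
move/eqP; rewrite Zp_int_eq => h; apply: (@qnum_dvd _ _ (x - y)) => //.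
by rewrite intrB; ring.
Qed.

Lemma entE z r s r' t : ent z r s - ent z r' t = (v r s - v r' t) + (E z r s - E z r' t)%:~R.
Proof. by rewrite /ent intrB; ring. Qed.

Lemma eq_unblocked z z' r s t : ez z r s - ez z r.-1 t = ez z' r s - ez z' r.-1 t ->
  unblocked z r s t = unblocked z' r s t.
Proof.
by move=> e; rewrite /unblocked !entE; congr (_ != 0); apply: ent_qnum_eq; rewrite !intrB.
Qed.

Lemma qnum_succ_neq0 (x : C) : qnum m x = 0 -> qnum m (x + 1) != 0.
Proof.
have qN y : qnum m (- y) = - qnum m y by rewrite /qnum opprK -[RHS]mulNr opprB.
move=> x0; have := @qnum_pred_neq0 R m m_ge3 (- x); rewrite qN x0 oppr0 => /(_ erefl).
by rewrite -opprD qN oppr_eq0.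
Qed.

Lemma unblocked_next z z' r s t : ez z' r s - ez z' r.-1 t = ez z r s - ez z r.-1 t + 1 ->
  ~~ unblocked z r s t -> unblocked z' r s t.
Proof.
rewrite /unblocked negbK !entE => e /eqP f0.
have -> : qnum m (v r s - v r.-1 t + (E z' r s - E z' r.-1 t)%:~R) =
   qnum m (v r s - v r.-1 t + (E z r s - E z r.-1 t + 1)%:~R).
  by apply: ent_qnum_eq; rewrite [RHS]intrD !intrB.
by rewrite [(_ + 1)%:~R]intrD addrA; apply: qnum_succ_neq0.
Qed.

(** Vanishing above row r is exact and not modulo m, so that a displacement which is also 0 modulo m
    on the rows <= r is a shift ([vanish_above_lat]). *)
Definition vanish_above r (d : I) :=
  (forall p : rpos n k i j, (r < pos_row p)%N -> d.1 p = 0) /\ ((r < k)%N -> d.2 = 0).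

Lemma vanish_above0 r : vanish_above r 0.
Proof. by split=> // p _; rewrite ffunE. Qed.

Lemma vanish_aboveB r d d' : vanish_above r d -> vanish_above r d' -> vanish_above r (d - d').
Proof.
move=> [h1 h2] [h3 h4]; split=> [p pr|rk]; first by rewrite !ffunE h1 ?h3 ?subr0.
have -> : (d - d').2 = d.2 - d'.2 by [].
by rewrite h2 ?h4 ?subr0.
Qed.

Lemma vanish_aboveD r d d' : vanish_above r d -> vanish_above r d' -> vanish_above r (d + d').
Proof.
move=> h h'; rewrite -(opprK d'); apply: vanish_aboveB => //.
by rewrite -[- d']add0r; apply: vanish_aboveB => //; apply: vanish_above0.
Qed.

Lemma vanish_above_le r r' d : (r <= r')%N -> vanish_above r d -> vanish_above r' d.
Proof.
move=> rr [h1 h2]; split=> [p pr|rk]; first by apply: h1; apply: leq_ltn_trans pr.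
by apply: h2; apply: leq_ltn_trans rk.
Qed.

Lemma vanish_above_delta r s : vanish_above r (del r s).
Proof.
split=> [p pr|rk]; first by rewrite ffunE xpair_eqE (gtn_eqF pr).
by rewrite /= !xpair_eqE (ltn_eqF rk).
Qed.

Lemma vanish_above_ez r d a b : vanish_above r d -> (1 <= b <= a)%N -> (a < n)%N -> (r < a)%N ->
  ez d a b = 0.
Proof.
move=> [h1 h2] ba an; rewrite /ez; case: (entryP ba an) => [-> ->|-> ->|p -> ->] ra.
- by rewrite entry_ki h2.
- by rewrite entry_kj h2.
- by rewrite entry_pos h1.
Qed.

Lemma vanish_above_lat r d : vanish_above r d -> eqrow r d 0 -> exists f, d = lat f.
Proof.
move=> [h1 h2]; rewrite /eqrow subr0 => /andP[/forallP hp hk].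
exists [ffun p => (d.1 p %/ m%:Z)%Z]; case: d h1 h2 hp hk => d1 d2 /= h1 h2 hp hk.
congr pair; last by case: (leqP k r) hk => [_ /eqP//|/h2].
apply/ffunP => p; rewrite !ffunE; have := hp p; case: leqP => [_|/h1 ->]; last by rewrite div0z mul0r.
by move=> /= /divzK ->.
Qed.

(** * Reaching residues by lowering entries *)

Section Paths.
Variables (P : I -> Prop) (z0 : I) (r0 : nat).
Hypothesis r0n : (r0 < n)%N.
Hypothesis P_step : forall d r s, (1 <= s <= r)%N -> (r <= r0)%N ->
  (forall t, (1 <= t < r)%N -> unblocked (z0 + d) r s t) -> P d -> P (d - del r s).

(* The entry (r, s) can always be lowered: the entries of row r - 1 that block
   it are lowered first, which changes nothing in the rows r, r + 1, ... *)
Lemma lower_entry r s d : (r <= r0)%N -> (1 <= s <= r)%N -> P d ->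
  exists2 e, vanish_above r.-1 e & P (d + e - del r s).
Proof.
elim: r s d => [|r IH] s d rr sr Pd; first by case/andP: sr => s1 s0; have := leq_trans s1 s0.
have rn : (r.+1 < n)%N by apply: leq_ltn_trans r0n.
have rn' : (r < n)%N by apply: ltnW.
suff [e [ve Pe fe]] : exists e, [/\ vanish_above r e, P (d + e) &
    forall t, (1 <= t <= r)%N -> unblocked (z0 + (d + e)) r.+1 s t].
  by exists e => //; apply: P_step.
suff H T : (T <= r)%N -> exists e, [/\ vanish_above r e, P (d + e) &
    forall t, (1 <= t <= T)%N -> unblocked (z0 + (d + e)) r.+1 s t] by apply: H.
elim: T => [_|T IHT Tr].
  exists 0; rewrite addr0; split=> [||t] //; first exact: vanish_above0.
  by case/andP => t1 t0; have := leq_trans t1 t0.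
have [e [ve Pe fe]] := IHT (ltnW Tr).
have [f1|nf] := boolP (unblocked (z0 + (d + e)) r.+1 s T.+1).
  exists e; split=> // t /andP[t1]; rewrite leq_eqVlt => /orP[/eqP -> //|tT].
  by apply: fe; rewrite t1.
have Tr' : (1 <= T.+1 <= r)%N by [].
have [e' ve' Pe'] := IH T.+1 (d + e) (ltnW rr) Tr' Pe.
(* Lowering the blocking entry (r, T + 1) raises the difference by 1 and so moves it off its zero.
   The other differences keep their residues. *)
exists (e + e' - del r T.+1); split.
- apply: vanish_aboveB (vanish_above_delta _ _); apply: vanish_aboveD => //.
  exact: vanish_above_le (leq_pred r) ve'.
- by rewrite !addrA in Pe' *.
move=> t /andP[t1 tT]; have tr : (1 <= t <= r)%N by rewrite t1 (leq_trans tT).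
have r1 : (r.-1 < r)%N by rewrite prednK //; case/andP: Tr' => _; apply: leq_ltn_trans.
have r2 : (r.-1 < r.+1)%N by apply: leq_trans r1 _.
have e1 : ez (z0 + (d + (e + e' - del r T.+1))) r.+1 s = ez (z0 + (d + e)) r.+1 s.
  rewrite !(ezB, ezD) (vanish_above_ez ve') // ez_delta // !xpair_eqE (gtn_eqF (ltnSn r)).
  by rewrite addr0 subr0.
have e2 : ez (z0 + (d + (e + e' - del r T.+1))) r t = ez (z0 + (d + e)) r t - (t == T.+1)%:R.
  rewrite !(ezB, ezD) (vanish_above_ez ve') // ez_delta // !xpair_eqE eqxx /=.
  by rewrite addr0 !addrA.
have [et|nt] := eqVneq t T.+1.
  by subst t; apply: unblocked_next nf; rewrite /= e1 e2 eqxx opprB addrA addrAC.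
rewrite (@eq_unblocked _ (z0 + (d + e))); first by apply: fe; rewrite t1 -ltnS ltn_neqAle nt.
by rewrite /= e1 e2 (negPf nt) subr0.
Qed.

(** Lowering alone suffices because Z_m is cyclic: c lowerings, for the representative c of the
    difference of the residues. *)
Lemma reach_entry r s d x : (r <= r0)%N -> (1 <= s <= r)%N -> P d ->
  exists e, [/\ vanish_above r e, P (d + e), ez (z0 + (d + e)) r s = x &
    forall s', (1 <= s' <= r)%N -> s' != s -> ez e r s' = 0].
Proof.
move=> rr sr Pd; have rn : (r < n)%N by apply: leq_ltn_trans r0n.
have [c ec] : exists c : nat, ez (z0 + d) r s - c%:R = x.
  by exists (nat_of_ord (ez (z0 + d) r s - x)); rewrite natr_Zp subKr.
elim: c d Pd ec => [|c IH] d Pd ec.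
  exists 0; rewrite addr0; split=> //; first exact: vanish_above0.
    by rewrite -ec subr0.
  by move=> s' _ _; rewrite ez0.
have r1 : (r.-1 < r)%N by rewrite prednK //; case/andP: sr => s1; apply: leq_trans.
have [e1 ve1 Pe1] := lower_entry rr sr Pd.
have [|e2 [ve2 Pe2 he2 ze2]] := IH _ Pe1.
  rewrite -ec -natr1 !(ezB, ezD) (vanish_above_ez ve1) // ez_delta // eqxx addr0 opprD !addrA.
  by rewrite [LHS]addrAC.
exists (e1 - del r s + e2); split=> //.
- apply: vanish_aboveD => //; apply: vanish_aboveB (vanish_above_delta _ _).
  exact: vanish_above_le (leq_pred r) ve1.
- by rewrite !addrA in Pe2 *.
- by rewrite -he2 !addrA.
move=> s' sr' ns; rewrite !(ezB, ezD) (vanish_above_ez ve1) // ez_delta // ze2 //.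
by rewrite xpair_eqE (negPf ns) andbF subr0 addr0.
Qed.

(** Rows are adjusted from r0 downwards and each row from left to right. [reach_entry] disturbs only
    lower rows and no other residue of its own row, so what is adjusted stays so. *)
Lemma reach_class d z1 : P d ->
  exists e, [/\ vanish_above r0 e, P (d + e) & eqrow r0 (z0 + (d + e)) z1].
Proof.
move=> Pd.
suff H r : (r <= r0)%N -> exists e, [/\ vanish_above r0 e, P (d + e) &
    forall a b, (1 <= b <= a)%N -> (a <= r0)%N -> (r0 - r < a)%N ->
      ez (z0 + (d + e)) a b = ez z1 a b].
  have [e [ve Pe he]] := H r0 (leqnn _); exists e; split=> //.
  apply/eqrow_ez => a b ba _ ar; apply: he => //; rewrite subnn.
  by case/andP: ba => b1; apply: leq_trans.
elim: r => [_|r IHr rr].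
  exists 0; rewrite addr0; split=> //; first exact: vanish_above0.
  by move=> a b _ ar; rewrite subn0 ltnNge ar.
have [e [ve Pe he]] := IHr (ltnW rr).
pose l := (r0 - r)%N; have lr : (l <= r0)%N by apply: leq_subr.
have el : (r0 - r.+1 = l.-1)%N by rewrite subnS.
have l1 : (0 < l)%N by rewrite subn_gt0.
suff [e' [ve' Pe' he']] : exists e', [/\ vanish_above r0 e', P (d + e') &
    forall a b, (1 <= b <= a)%N -> (a <= r0)%N -> (l < a)%N || ((a == l) && (b <= l))%N ->
      ez (z0 + (d + e')) a b = ez z1 a b].
  exists e'; split=> // a b ba ar; rewrite el prednK // leq_eqVlt => h; apply: he' => //.
  case/orP: h => [/eqP ea|->//]; apply/orP; right.
  by rewrite -ea eqxx; case/andP: ba => _; rewrite -ea.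
suff H s : (s <= l)%N -> exists e', [/\ vanish_above r0 e', P (d + e') &
    forall a b, (1 <= b <= a)%N -> (a <= r0)%N -> (l < a)%N || ((a == l) && (b <= s))%N ->
      ez (z0 + (d + e')) a b = ez z1 a b] by apply: H.
elim: s => [_|s IHs sl].
  exists e; split=> // a b ba ar /orP[|/andP[_]]; first exact: he.
  by case/andP: ba; case: b.
have [e1 [ve1 Pe1 he1]] := IHs (ltnW sl).
have [e2 [ve2 Pe2 xe2 ze2]] := @reach_entry l s.+1 _ (ez z1 l s.+1) lr sl Pe1.
exists (e1 + e2); split.
- by apply: vanish_aboveD => //; apply: vanish_above_le ve2.
- by rewrite addrA.
move=> a b ba ar hab; have an : (a < n)%N by apply: leq_ltn_trans r0n.
have [[ea eb]|nab] := eqVneq (a, b) (l, s.+1); first by rewrite ea eb -xe2 !addrA.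
have z2 : ez e2 a b = 0.
  case/orP: hab => [la|/andP[/eqP al bs]]; first exact: vanish_above_ez ve2 _ _ _.
  by subst a; apply: ze2 => //; move: nab; rewrite xpair_eqE eqxx.
rewrite [d + _]addrA [z0 + _]addrA ezD z2 addr0; apply: he1 => //.
case/orP: hab => [->//|/andP[/eqP al bs]]; subst a; rewrite eqxx /= ltnn /=.
by move: nab bs; rewrite xpair_eqE eqxx /= leq_eqVlt => /negPf ->.
Qed.

End Paths.

(** * Good subspaces *)

Section Submodules.
Variables (V : lmodType C) (T DT : I -> V) (proj : pred I -> V -> V).
Variables (tshift : {ffun rpos n k i j -> int} -> V -> V) (act : Ugen -> V -> V).
Local Notation A := {freeg I / C}.
Local Notation sT := (fglift T : A -> V).
Local Notation sD := (fglift DT : A -> V).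
Hypothesis T_tau : forall z, T (tau z) = T z.
Hypothesis DT_tau : forall z, DT (tau z) = - DT z.
Hypothesis span : forall x, exists a b, x = sT a + sD b.
Hypothesis orient : forall S x,
  exists a b, [/\ proj S x = sT a + sD b, restr S a = a & restr S b = b].
Hypothesis proj_lin : forall S, linear (proj S).
Hypothesis proj_T : forall S z, proj S (T z) = if tausym S z then T z else 0.
Hypothesis proj_DT : forall S z, proj S (DT z) = if tausym S z then DT z else 0.
Hypothesis tshift_lin : forall f, linear (tshift f).
Hypothesis tshift_T : forall f z, tshift f (T z) = T (z + lat f).
Hypothesis tshift_DT : forall f z, tshift f (DT z) = DT (z + lat f).
Hypothesis act_lin : forall g, valid_gen n g -> linear (act g).
Hypothesis act_T : forall up r z, (1 <= r < n)%N -> act (gen up r) (T z) =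
  \sum_(1 <= s < r.+1) (Dv m (qnum_xy R m * actK up r s z) *: T (mv up r s z) +
                        Kval m (qnum_xy R m * actK up r s z) *: DT (mv up r s z)).
Hypothesis act_DT : forall up r z, (1 <= r < n)%N -> z.2.1 != z.2.2 ->
  act (gen up r) (DT z) =
  \sum_(1 <= s < r.+1) (actc up r s z *: DT (mv up r s z) + actd up r s z *: T (mv up r s z)).
Hypothesis act_K : forall r z, (1 <= r <= n)%N ->
  act (UK r) (T z) = qpow m (wt z r) *: T z /\ act (UK r) (DT z) = qpow m (wt z r) *: DT z.

Variable N : V -> Prop.
Hypothesis N_sub : is_subspace N.
Hypothesis N_act : forall g x, valid_gen n g -> N x -> N (act g x).
Hypothesis N_shift : forall f x, N x -> N (tshift f x).

Local Notation NZ c := (subspaceZ N_sub c).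
Local Notation ND := (subspaceD N_sub).
Local Notation NB := (subspaceB N_sub).

(** * Moving a whole family of tableaux with F *)

Definition supported (S : pred I) (a : A) := restr S a = a.

Definition proj_stable r := forall z x, N x -> N (proj (eqrow r z) x).

Lemma DT_diag z : z.2.1 = z.2.2 -> DT z = 0.
Proof.
move=> zz; apply: eq_opp0; rewrite -DT_tau; congr DT.
by case: z zz => z1 [a b] /= ->.
Qed.

Lemma sT_lin : linear sT. Proof. exact: linearP. Qed.

Lemma sD_lin : linear sD. Proof. exact: linearP. Qed.

Lemma translate_lin d : linear (translate d : A -> A). Proof. exact: linearP. Qed.

Lemma actden_simple r s z : (1 <= s <= r)%N -> (r < n)%N -> simple_at r s z ->
  actden r s z != 0.
Proof.
move=> sr rn; have [reg _|] := boolP (regular_at r z); first exact: actden_neq0.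
rewrite /regular_at /simple_at negb_or !negbK => /andP[/eqP rk /eqP zz].
subst r; rewrite eqxx zz eqxx orbF /= => /andP[si sj].
rewrite /actden big_nat_cond prodf_seq_neq0; apply/allP => t _.
apply/implyP => /andP[/andP[t1 tk] ts]; apply/eqP => q0.
apply: (@v_reg k s t) => //; [by rewrite t1 | by rewrite eq_sym| |].
  by rewrite !inE !xpair_eqE (negPf si) (negPf sj) !andbF.
have [p [e _]] := qnum_eq0_half m_ge3 q0; exists (p - (E z k s - E z k t) * 2).
rewrite intrB intrM mulrBl -e mulfK ?pnatr_eq0 // /ent !intrB; ring.
Qed.

Lemma simple_class r' s r z z' : (r' <= r)%N -> eqrow r z z' -> simple_at r' s z -> simple_at r' s z'.
Proof.
move=> r'r zz'; rewrite /simple_at; case: eqP => //= rk; subst r'.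
by rewrite (eqrow_pair r'r zz').
Qed.

Lemma coef_simple up r s z : (1 <= s <= r)%N -> (r < n)%N -> simple_at r s z ->
  Dv m (qnum_xy R m * actK up r s z) = actc up r s z /\
  Kval m (qnum_xy R m * actK up r s z) = 0.
Proof.
move=> sr rn sim; have [b jf] := jet_actK up (actden_simple sr rn sim).
by have [-> ->] := jetP (jet_xyM jf).
Qed.

Lemma actK_class up r' s r z z' : (1 <= s <= r')%N -> (r' < n)%N -> (r' <= r)%N ->
  (adj up r' <= r)%N -> eqrow r z z' -> actK up r' s z = actK up r' s z'.
Proof.
move=> sr rn rr ar zz'; apply: eq_actK => // a b ba an [] ea; subst a.
  exact: eqrow_entry zz' _ _ _.
exact: eqrow_entry zz' _ _ _.
Qed.

Lemma actcF_class r' s r z z' : (1 <= s <= r')%N -> (r' < n)%N -> (r' <= r)%N ->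
  eqrow r z z' -> simple_at r' s z -> actc false r' s z = actc false r' s z'.
Proof.
move=> sr rn rr zz' sim; have sim' := simple_class rr zz' sim.
rewrite -(coef_simple false sr rn sim).1 -(coef_simple false sr rn sim').1.
by rewrite (actK_class sr rn rr _ zz') //= (leq_trans (leq_pred _)).
Qed.

Lemma actcF_neq0 r s z : (1 <= s <= r)%N -> (r < n)%N -> simple_at r s z ->
  (forall t, (1 <= t < r)%N -> unblocked z r s t) -> actc false r s z != 0.
Proof.
move=> sr rn sim fr; rewrite /actc expr0 mul1r mulf_neq0 ?invr_eq0 ?actden_simple //.
rewrite /actnum /adj prednK; last by case/andP: sr => s1; apply: leq_trans.
rewrite big_nat_cond prodf_seq_neq0; apply/allP => t _; apply/implyP; rewrite andbT => tr.
exact: fr.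
Qed.

Lemma proj_extract up r r' s z z' (f g : nat -> C) : (1 <= s <= r')%N -> (r' <= r)%N ->
  (r' < n)%N -> eqrow r z z' -> simple_at r' s z ->
  proj (eqrow r (mv up r' s z))
    (\sum_(1 <= u < r'.+1) (f u *: T (mv up r' u z') + g u *: DT (mv up r' u z'))) =
  f s *: T (mv up r' s z') + g s *: DT (mv up r' s z').
Proof.
move=> sr rr rn zz' sim; rewrite (linear_fun_sum (proj_lin _)).
have cl u : (1 <= u <= r')%N -> tausym (eqrow r (mv up r' s z)) (mv up r' u z') = (u == s).
  by move=> ur; apply: mv_class.
rewrite (bigD1_seq s) ?iota_uniq ?mem_index_iota //= big_nat_cond big1 ?addr0.
  by rewrite (linear_fun_comb (proj_lin _)) proj_T proj_DT cl // eqxx.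
move=> u /andP[ur us]; rewrite (linear_fun_comb (proj_lin _)) proj_T proj_DT cl //.
by rewrite (negPf us) !scaler0 addr0.
Qed.

Lemma proj_actT up r r' s z z' : (1 <= s <= r')%N -> (r' <= r)%N -> (r' < n)%N ->
  eqrow r z z' -> simple_at r' s z ->
  proj (eqrow r (mv up r' s z)) (act (gen up r') (T z')) = actc up r' s z' *: T (mv up r' s z').
Proof.
move=> sr rr rn zz' sim; rewrite act_T; last first.
  by rewrite rn andbT; case/andP: sr => s1; apply: leq_trans.
rewrite (proj_extract _ _ _ sr rr rn zz' sim).
have [-> ->] := coef_simple up sr rn (simple_class rr zz' sim).
by rewrite scale0r addr0.
Qed.

Lemma proj_actDT up r r' s z z' : (1 <= s <= r')%N -> (r' <= r)%N -> (r' < n)%N ->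
  eqrow r z z' -> simple_at r' s z -> z'.2.1 != z'.2.2 ->
  proj (eqrow r (mv up r' s z)) (act (gen up r') (DT z')) =
  actc up r' s z' *: DT (mv up r' s z') + actd up r' s z' *: T (mv up r' s z').
Proof.
move=> sr rr rn zz' sim zn; rewrite act_DT //; last first.
  by rewrite rn andbT; case/andP: sr => s1; apply: leq_trans.
rewrite [RHS]addrC.
have <- := proj_extract up (fun u => actd up r' u z') (fun u => actc up r' u z') sr rr rn zz' sim.
by congr (proj _ _); apply: eq_bigr => u _; rewrite addrC.
Qed.

Lemma mv_pair up r s z : (r < k)%N -> (mv up r s z).2 = z.2.
Proof.
move=> rk; have e : (del r s).2 = 0 by rewrite /= !xpair_eqE (ltn_eqF rk).
case: up; first by rewrite -[LHS]/(z.2 + (del r s).2) e addr0.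
by rewrite -[LHS]/(z.2 - (del r s).2) e subr0.
Qed.

Lemma valid_gen_row up r s : (1 <= s <= r)%N -> (r < n)%N -> valid_gen n (gen up r).
Proof. by case/andP=> s1 sr rn; case: up => /=; rewrite rn (leq_trans s1 sr). Qed.

(** F_r' reads only the rows r' and r' - 1, so on a class of the rows <= r its coefficient at s is
    one nonzero constant. Projecting onto the target class leaves this constant times a translation.
    For DT this requires r' < k, where the coefficient has derivative 0. *)
Lemma lower_step r r' s z a b : proj_stable r -> (1 <= s <= r')%N -> (r' <= r)%N -> (r' < n)%N ->
  (forall t, (1 <= t < r')%N -> unblocked z r' s t) -> simple_at r' s z ->
  supported (eqrow r z) a -> supported (eqrow r z) b -> b = 0 \/ (r' < k)%N ->
  N (sT a + sD b) -> N (sT (translate (- del r' s) a) + sD (translate (- del r' s) b)).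
Proof.
move=> PN sr rr rn fr sim Sa Sb mode Nx.
have c0 := actcF_neq0 sr rn sim fr; set c := actc _ _ _ _ in c0.
have vg := valid_gen_row false sr rn.
have := PN (mv false r' s z) _ (N_act vg Nx).
rewrite (linear_funD (act_lin vg)) (linear_funD (proj_lin _)).
have -> : proj (eqrow r (mv false r' s z)) (act (gen false r') (sT a)) =
    c *: sT (translate (- del r' s) a).
  apply: (@restr_ext_fun _ _ _ (fun a => proj (eqrow r (mv false r' s z)) (act (gen false r') (sT a))) (fun a => c *: sT (translate (- del r' s) a)) _ _ _ _ Sa).
  - exact: linear_comp (proj_lin _) (linear_comp (act_lin vg) sT_lin).
  - exact: linear_scaled (linear_comp sT_lin (translate_lin _)).
  move=> z' zz'; rewrite translateE !fglift1 (proj_actT _ sr rr rn zz' sim).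
  by rewrite -(actcF_class sr rn rr zz' sim).
have -> : proj (eqrow r (mv false r' s z)) (act (gen false r') (sD b)) =
    c *: sD (translate (- del r' s) b).
  case: mode => [->|rk].
    by rewrite !linear0 (linear_fun0 (act_lin vg)) (linear_fun0 (proj_lin _)) ?scaler0.
  apply: (@restr_ext_fun _ _ _ (fun b => proj (eqrow r (mv false r' s z)) (act (gen false r') (sD b))) (fun b => c *: sD (translate (- del r' s) b)) _ _ _ _ Sb).
  - exact: linear_comp (proj_lin _) (linear_comp (act_lin vg) sD_lin).
  - exact: linear_scaled (linear_comp sD_lin (translate_lin _)).
  move=> z' zz'; rewrite translateE !fglift1; have [zz|zz] := eqVneq z'.2.1 z'.2.2.
    have -> : DT (z' - del r' s) = 0.
      by apply: DT_diag; rewrite -/(mv false r' s z') mv_pair.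
    by rewrite DT_diag // (linear_fun0 (act_lin vg)) (linear_fun0 (proj_lin _)) scaler0.
  rewrite (proj_actDT _ sr rr rn zz' sim zz) actd0 ?scale0r ?addr0 ?(ltn_eqF rk) //.
    by rewrite -(actcF_class sr rn rr zz' sim).
  by rewrite /adj ltn_eqF // (leq_ltn_trans (leq_pred _)).
by rewrite -scalerDr => /(NZ c^-1); rewrite scalerA mulVf // scale1r.
Qed.

(* F_k mixes T and DT: it produces DT from T at the pole and T from DT elsewhere.
   Hence for r0 >= k only families without DT part are moved. *)
Definition movable r r0 := forall r' s z a b, (1 <= s <= r')%N -> (r' <= r0)%N ->
  (forall t, (1 <= t < r')%N -> unblocked z r' s t) ->
  supported (eqrow r z) a -> supported (eqrow r z) b -> b = 0 \/ (r0 < k)%N ->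
  N (sT a + sD b) -> N (sT (translate (- del r' s) a) + sD (translate (- del r' s) b)).

Lemma movable_lt r r0 : proj_stable r -> (r < n)%N -> (r0 <= r)%N -> (r0 < k)%N -> movable r r0.
Proof.
move=> PN rn r0r r0k r' s z a b sr rr fr Sa Sb _; apply: (@lower_step r r' s z a b PN sr) => //.
- exact: leq_trans rr r0r.
- exact: leq_ltn_trans rr (leq_ltn_trans r0r rn).
- by rewrite /simple_at ltn_eqF // (leq_ltn_trans rr).
- by right; apply: leq_ltn_trans rr r0k.
Qed.

Lemma supported_translate r z d a : supported (eqrow r z) a -> supported (eqrow r (z + d)) (translate d a).
Proof.
move=> Sa; rewrite /supported (@restr_translate _ _ _ (eqrow r z)) ?Sa // => z'.
by rewrite eqrowDr.
Qed.

Lemma transport r r0 z z1 a b : (r0 < n)%N -> movable r r0 ->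
  supported (eqrow r z) a -> supported (eqrow r z) b -> b = 0 \/ (r0 < k)%N -> N (sT a + sD b) ->
  exists d, [/\ vanish_above r0 d, N (sT (translate d a) + sD (translate d b)) &
    eqrow r0 (z + d) z1].
Proof.
move=> r0n mov Sa Sb mode Nx.
pose P d := N (sT (translate d a) + sD (translate d b)).
have P0 : P 0 by rewrite /P !translate0.
have [|e [ve Pe he]] := @reach_class P z r0 r0n _ 0 z1 P0; last first.
  by exists e; rewrite !add0r in Pe he.
move=> d r' s sr rr fr Pd; rewrite /P -!(translateD (- _) d).
apply: (mov _ _ (z + d)) => //; try exact: supported_translate.
by case: mode => [->|]; [left; rewrite linear0 | right].
Qed.

(** A path that is closed for the residues need not be closed for the integer entries; the defect is
    a shift, under which N is stable. *)
Lemma translate_back r z d a b : vanish_above r d -> eqrow r (z + d) z ->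
  N (sT (translate d a) + sD (translate d b)) -> N (sT a + sD b).
Proof.
move=> vd ed; have [f df] : exists f, d = lat f.
  by apply: vanish_above_lat vd _; rewrite -(eqrowDr _ _ _ z) add0r addrC.
subst d; have hT g c : tshift g (sT c) = sT (translate (lat g) c).
  apply: (@freeg_ext_fun _ _ _ (fun c => tshift g (sT c)) (fun c => sT (translate (lat g) c))).
  - exact: linear_comp (tshift_lin _) sT_lin.
  - exact: linear_comp sT_lin (translate_lin _).
  by move=> z'; rewrite translateE !fglift1 tshift_T.
have hD g c : tshift g (sD c) = sD (translate (lat g) c).
  apply: (@freeg_ext_fun _ _ _ (fun c => tshift g (sD c)) (fun c => sD (translate (lat g) c))).
  - exact: linear_comp (tshift_lin _) sD_lin.
  - exact: linear_comp sD_lin (translate_lin _).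
  by move=> z'; rewrite translateE !fglift1 tshift_DT.
move=> /(N_shift (- f)); rewrite (linear_funD (tshift_lin _)) hT hD.
by rewrite !translateD -latD subrr lat0 !translate0.
Qed.

Lemma supported_class r z z' a : eqrow r z z' -> supported (eqrow r z) a -> supported (eqrow r z') a.
Proof.
move=> zz'; apply: restr_sub => u zu; apply: eqrow_trans zu.
by rewrite eqrow_sym.
Qed.

Lemma supported_le r r' z a : (r' <= r)%N -> supported (eqrow r z) a -> supported (eqrow r' z) a.
Proof. by move=> rr; apply: restr_sub => u; apply: eqrow_le. Qed.

Lemma supported_weigh S (f : I -> C) a : supported S a -> supported S (weigh f a).
Proof. by move=> Sa; rewrite /supported restr_weigh Sa. Qed.

(** * Round trips at an entry of row r *)

Lemma qnum_ent z z' r s r' t : ez z r s - ez z r' t = ez z' r s - ez z' r' t ->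
  qnum m (ent z r s - ent z r' t) = qnum m (ent z' r s - ent z' r' t).
Proof. by move=> e; rewrite !entE; apply: ent_qnum_eq; rewrite // !intrB. Qed.

Lemma qnum_ent_base (c : nat) z z' r s r' t :
  ez z r s = c%:R -> ez z r' t = ez z' r' t ->
  qnum m (ent z r s - ent z r' t) = qnum m (v r s + c%:R - ent z' r' t).
Proof.
move=> e1 e2; have -> : v r s + c%:R - ent z' r' t = (v r s - v r' t) + (c%:Z - E z' r' t)%:~R.
  by rewrite /ent intrB -pmulrn; ring.
by rewrite entE; apply: ent_qnum_eq; rewrite // !intrB -pmulrn -e1 -/(ez z r' t) e2.
Qed.

Lemma actden_class r s z z' : (1 <= s <= r)%N -> (r < n)%N -> eqrow r z z' ->
  actden r s z = actden r s z'.
Proof.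
move=> sr rn /eqrow_ez zz'; rewrite /actden big_nat_cond [RHS]big_nat_cond.
by apply: eq_bigr => t /andP[tr _]; apply: qnum_ent; rewrite !zz'.
Qed.

(** Lowering contributes a constant, and so does the denominator of E_r on the way back. Only the
    numerator of E_r, a product over row r + 1, varies: this is [lam]. Its derivative [mu] can be
    nonzero only for r + 1 = k. *)
Lemma roundtrip r s z a b : proj_stable r -> (1 <= s <= r)%N -> (r.+1 < n)%N ->
  (forall t, (1 <= t < r)%N -> unblocked z r s t) ->
  regular_at r z -> regular_at r (z - del r s) ->
  supported (eqrow r z) a -> supported (eqrow r z) b -> b = 0 \/ (r < k)%N -> N (sT a + sD b) ->
  let lam z' := actnum true r s (z' - del r s) in
  let mu z' := if r.+1 == k then nonpair_prod (ent (z' - del r s) r s) (z' - del r s) *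
    (qnum m (ent (z' - del r s) k j - ent (z' - del r s) k i) / 2) else 0 in
  N (sT (weigh lam a + weigh mu b) + sD (weigh lam b)).
Proof.
move=> PN sr rn1 fr reg reg' Sa Sb mode Nx lam mu; have rn := ltnW rn1.
have := lower_step PN sr (leqnn r) rn fr (regular_simple _ reg) Sa Sb mode Nx.
have Sa1 := supported_translate (- del r s) Sa; have Sb1 := supported_translate (- del r s) Sb.
set a1 := translate _ a in Sa1 *; set b1 := translate _ b in Sb1 *; set z1 := z - del r s in Sa1 Sb1 reg'.
have vg := valid_gen_row true sr rn => Nx1.
have ez1 : mv true r s z1 = z by rewrite /mv subrK.
have sim1 := regular_simple s reg'.
have d0 := actden_neq0 sr rn reg'; set d := actden _ _ _ in d0.
pose lam0 z' := actnum true r s z'.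
pose mu0 z' := if r.+1 == k then nonpair_prod (ent z' r s) z' * (qnum m (ent z' k j - ent z' k i) / 2) else 0.
have cE z' : eqrow r z1 z' -> actc true r s z' = - d^-1 * lam0 z'.
  by move=> zz'; rewrite /actc -(actden_class sr rn zz') expr1 mulN1r mulNr mulrC.
have := PN z _ (N_act vg Nx1).
rewrite (linear_funD (act_lin vg)) (linear_funD (proj_lin _)).
have -> : proj (eqrow r z) (act (gen true r) (sT a1)) =
    - d^-1 *: sT (translate (del r s) (weigh lam0 a1)).
  apply: (@restr_ext_fun _ _ _ (fun a => proj (eqrow r z) (act (gen true r) (sT a)))
    (fun a => - d^-1 *: sT (translate (del r s) (weigh lam0 a))) _ _ _ _ Sa1).
  - exact: linear_comp (proj_lin _) (linear_comp (act_lin vg) sT_lin).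
  - apply: linear_scaled; apply: linear_comp sT_lin _.
    by apply: linear_comp (translate_lin _) _; exact: linearP.
  move=> z' zz'; rewrite weighE linearZ /= translateE linearZ /= !fglift1 -ez1.
  by rewrite (proj_actT _ sr (leqnn r) rn zz' sim1) cE // scalerA.
have -> : proj (eqrow r z) (act (gen true r) (sD b1)) =
    - d^-1 *: (sT (translate (del r s) (weigh mu0 b1)) + sD (translate (del r s) (weigh lam0 b1))).
  case: mode => [b0|rk].
    have -> : b1 = 0 by rewrite /b1 b0 linear0.
    by rewrite !linear0 (linear_fun0 (act_lin vg)) (linear_fun0 (proj_lin _)) addr0 ?scaler0.
  apply: (@restr_ext_fun _ _ _ (fun b => proj (eqrow r z) (act (gen true r) (sD b)))
    (fun b => - d^-1 *: (sT (translate (del r s) (weigh mu0 b)) +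
                         sD (translate (del r s) (weigh lam0 b)))) _ _ _ _ Sb1).
  - exact: linear_comp (proj_lin _) (linear_comp (act_lin vg) sD_lin).
  - apply: linear_scaled; apply: linear_addf.
      by apply: linear_comp sT_lin _; apply: linear_comp (translate_lin _) _; exact: linearP.
    by apply: linear_comp sD_lin _; apply: linear_comp (translate_lin _) _; exact: linearP.
  move=> z' zz'; rewrite !weighE !linearZ /= !translateE ?linearZ /= !fglift1.
  have [zz|zz] := eqVneq z'.2.1 z'.2.2.
    have -> : DT (z' + del r s) = 0 by apply: DT_diag; rewrite -/(mv true r s z') mv_pair.
    have -> : mu0 z' = 0.
      rewrite /mu0; case: eqP => // _; rewrite (ent_diag zz) subrr.
      by rewrite /qnum oppr0 subrr !mul0r mulr0.
    by rewrite DT_diag // (linear_fun0 (act_lin vg)) (linear_fun0 (proj_lin _)) !scale0r !scaler0 addr0 ?scaler0.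
  rewrite -ez1 (proj_actDT _ sr (leqnn r) rn zz' sim1 zz) cE // addrC scalerDr !scalerA.
  congr (_ *: _ + _); rewrite /mu0; have [rk1|rk1] := eqVneq r.+1 k; last first.
    by rewrite mulr0 actd0 // ?(ltn_eqF rk).
  have er : r = k.-1 by rewrite -rk1.
  have k1 : (1 < k)%N by rewrite -rk1 ltnS; case/andP: sr => s1; apply: leq_trans.
  have sr' : (1 <= s <= k.-1)%N by rewrite -er.
  have := @actd_pair s z' k1 sr'; rewrite -er => ->.
  by rewrite -(actden_class sr rn zz') -/d mulNr mulNr [d^-1 * _]mulrC.
have back (g : I -> C) x : translate (del r s) (weigh g (translate (- del r s) x)) =
    weigh (fun z' => g (z' - del r s)) x.
  by rewrite weigh_translate translateD addNr translate0.
rewrite /a1 /b1 !back => Nx2; rewrite (linear_funD sT_lin) -addrA.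
have := NZ (- d) Nx2; rewrite -scalerDr scalerA mulrNN mulfV // scale1r.
exact.
Qed.

(** This is the eigenvalue of the round trip in which (r, s) is lowered to the residue c. It depends
    on row r + 1 alone. *)
Definition node r s (c : nat) z' : C :=
  \prod_(1 <= t < r.+2) qnum m (v r s + c%:R - ent z' r.+1 t).
(* The coefficient of T when the operator of node_op is applied to DT. *)
Definition slope r s (c : nat) z' : C := if r.+1 == k then
  nonpair_prod (v r s + c%:R) z' * (qnum m (ent z' k j - ent z' k i) / 2) else 0.

Lemma Zp_two_neq0 : 2 != 0 :> 'Z_m.
Proof.
have := Zp_int_eq0 2; rewrite -[2%:~R]/(2 : 'Z_m) => ->.
by apply/negP; rewrite /dvdz /= => /dvdn_leq-/(_ isT); rewrite leqNgt m_ge3.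
Qed.

(* A configuration of the rows <= r in which the entry (r, s) can be lowered from
   c + 1 to c, and stays away from the poles while doing so. *)
Lemma unblocked_configuration r s (c : nat) : (1 <= s <= r)%N -> (r < n)%N ->
  exists z, [/\ ez z r s = c.+1%:R, forall t, (1 <= t < r)%N -> unblocked z r s t,
    regular_at r z & regular_at r (z - del r s)].
Proof.
move=> sr rn.
(* Row r - 1 is raised by 1 where it would block. If r = k, the pair must have distinct residues
   before and after the lowering. If (r, s) belongs to it, the partner is c + 2, at distance 1 from
   c + 1 and 2 from c, both nonzero as m >= 3; otherwise the residues are 0 and 1. *)
pose e a b : 'Z_m := if (a, b) == (r, s) then c.+1%:R else
  if a == r then (if b == i then (if s == j then c.+2%:R else 0)
                  else if b == j then (if s == i then c.+2%:R else 1) else 0)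
  else (qnum m (v r s + c.+1%:R - v r.-1 b) == 0)%:R.
have es : ez (tableau e) r s = c.+1%:R by rewrite ez_tableau // /e !eqxx.
have two := Zp_two_neq0.
exists (tableau e); split=> //.
- move=> t /andP[t1 tr]; have r1 : (r.-1 < r)%N by rewrite prednK // (leq_trans _ tr).
  have tr1 : (1 <= t <= r.-1)%N by rewrite t1 -ltnS prednK // (leq_trans _ tr).
  have et : ez (tableau e) r.-1 t = (qnum m (v r s + c.+1%:R - v r.-1 t) == 0)%:R.
    by rewrite ez_tableau ?(ltn_trans r1) // /e xpair_eqE (ltn_eqF r1).
  rewrite /unblocked entE.
  set x := qnum m _ == 0 in et; rewrite (@ent_qnum_eq _ (c.+1%:Z - x%:Z)); last first.
    by rewrite !intrB -/(ez _ _ _) -/(ez _ _ _) es et -!pmulrn.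
  have -> : v r s - v r.-1 t + (c.+1%:Z - x%:Z)%:~R = v r s + c.+1%:R - v r.-1 t - x%:R.
    by rewrite intrB -!pmulrn; ring.
  rewrite /x; have [q0|q0] := eqVneq (qnum m (v r s + c.+1%:R - v r.-1 t)) 0.
    exact: qnum_pred_neq0.
  by rewrite subr0.
- rewrite /regular_at; apply/orP; case: (eqVneq r k) => [rk|rk]; [right | by left].
  rewrite -[(tableau e).2.1]ez_ki -[(tableau e).2.2]ez_kj !ez_tableau // /e -rk !xpair_eqE !eqxx /=.
  have [eis|si] := eqVneq i s; have [ejs|sj] := eqVneq j s; rewrite ?ji //=.
  - by move: ij'; rewrite eis ejs eqxx.
  - by rewrite eq_sym -subr_eq0 -natr1 addrAC subrr add0r oner_eq0.
  - by rewrite -subr_eq0 -natr1 addrAC subrr add0r oner_eq0.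
rewrite /regular_at; apply/orP; case: (eqVneq r k) => [rk|rk]; [right | by left].
rewrite -[(_ - _).2.1]ez_ki -[(_ - _).2.2]ez_kj !ezB !ez_tableau // !ez_delta // /e -rk !xpair_eqE !eqxx /=.
have [eis|si] := eqVneq i s; have [ejs|sj] := eqVneq j s; rewrite ?ji //=.
- by move: ij'; rewrite eis ejs eqxx.
- rewrite subr0 eq_sym -subr_eq0 -[c.+2%:R]natr1.
  by rewrite (_ : _ - _ = 2) ?two //; ring.
- rewrite subr0 -subr_eq0 -[c.+2%:R]natr1.
  by rewrite (_ : _ - _ = 2) ?two //; ring.
by rewrite !subr0 eq_sym oner_eq0.
Qed.

(* Move to an unblocked configuration, lower and raise the entry (r, s) there, and
   move back. *)
Lemma node_op r s c z a b : proj_stable r -> movable r r -> (1 <= s <= r)%N -> (r.+1 < n)%N ->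
  supported (eqrow r z) a -> supported (eqrow r z) b -> b = 0 \/ (r < k)%N -> N (sT a + sD b) ->
  N (sT (weigh (node r s c) a + weigh (slope r s c) b) + sD (weigh (node r s c) b)).
Proof.
move=> PN mov sr rn1 Sa Sb mode Nx; have rn := ltnW rn1.
have [zs [es fr reg reg']] := @unblocked_configuration r s c sr rn.
have [d [vd Nd ed]] := @transport r r z zs a b rn mov Sa Sb mode Nx.
have sup_zs x : supported (eqrow r z) x -> supported (eqrow r zs) (translate d x).
  by move=> Sx; apply: (supported_class ed); apply: supported_translate.
have mode' x : b = 0 \/ (r < k)%N -> weigh x b = 0 \/ (r < k)%N.
  by case=> [->|]; [left; rewrite linear0 | right].
have mode'' x (y : A) : y = 0 \/ (r < k)%N -> translate x y = 0 \/ (r < k)%N.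
  by case=> [->|]; [left; rewrite linear0 | right].
pose lam z' := actnum true r s (z' - del r s).
pose mu z' := if r.+1 == k then nonpair_prod (ent (z' - del r s) r s) (z' - del r s) *
    (qnum m (ent (z' - del r s) k j - ent (z' - del r s) k i) / 2) else 0.
pose a1 := weigh (fun z' => lam (z' + d)) a + weigh (fun z' => mu (z' + d)) b.
pose b1 := weigh (fun z' => lam (z' + d)) b.
have N1 : N (sT (translate d a1) + sD (translate d b1)).
  have := roundtrip PN sr rn1 fr reg reg' (sup_zs _ Sa) (sup_zs _ Sb) (mode'' d _ mode) Nd.
  rewrite -/lam -/mu /= !weigh_translate.
  by rewrite /a1 /b1 (linear_funD (translate_lin d)).
have Sa1 : supported (eqrow r z) a1.
  by rewrite /supported /a1 linearD /= !restr_weigh Sa Sb.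
have Sb1 : supported (eqrow r z) b1 by apply: supported_weigh.
have Sa1' := supported_translate d Sa1; have Sb1' := supported_translate d Sb1.
have [d' [vd' N2 ed']] := @transport r r (z + d) z _ _ rn mov Sa1' Sb1' (mode'' d _ (mode' _ mode)) N1.
have zd z' : eqrow r z z' -> ez (z' + d - del r s) r s = c%:R.
  move=> zz'; have h1 := elimT (eqrow_ez r _ _) ed r s sr rn (leqnn r).
  have h2 := elimT (eqrow_ez r _ _) zz' r s sr rn (leqnn r).
  move: h1; rewrite es ezB !ezD ez_delta // eqxx -h2 => ->.
  by rewrite -natr1 addrK.
have top z' t : (1 <= t <= r.+1)%N -> ez (z' + d - del r s) r.+1 t = ez z' r.+1 t.
  move=> tr; rewrite ezB ezD (vanish_above_ez vd) // ez_delta // xpair_eqE.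
  by rewrite gtn_eqF // addr0 subr0.
have elam x : supported (eqrow r z) x -> weigh (fun z' => lam (z' + d)) x = weigh (node r s c) x.
  move=> Sx; apply: (weigh_ext Sx) => z' zz'; rewrite /lam /actnum /node /adj.
  by apply: eq_big_nat => t tr; apply: qnum_ent_base; rewrite ?zd ?top.
have emu : weigh (fun z' => mu (z' + d)) b = weigh (slope r s c) b.
  apply: (weigh_ext Sb) => z' zz'; rewrite /mu /slope; case: eqP => // rk.
  have topk t : (1 <= t <= k)%N -> ez (z' + d - del r s) k t = ez z' k t.
    by move=> tk; have := top z' t; rewrite [X in ez _ X t]rk [X in _ = ez _ X t]rk; apply; rewrite rk.
  have -> : qnum m (ent (z' + d - del r s) k j - ent (z' + d - del r s) k i) =
      qnum m (ent z' k j - ent z' k i) by apply: qnum_ent; rewrite !topk.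
  have -> // : nonpair_prod (ent (z' + d - del r s) r s) (z' + d - del r s) = nonpair_prod (v r s + c%:R) z'.
  rewrite /nonpair_prod big_nat_cond [RHS]big_nat_cond; apply: eq_bigr => t /andP[tr _].
  by apply: qnum_ent_base; rewrite ?zd // topk.
have ea : a1 = weigh (node r s c) a + weigh (slope r s c) b by exact: (congr2 +%R (elam a Sa) emu).
have eb : b1 = weigh (node r s c) b by exact: elam.
rewrite -ea -eb; move: N2; rewrite !translateD.
apply: (@translate_back r z); first exact: vanish_aboveD.
by rewrite addrA.
Qed.

(** * Obtaining T from DT and DT from T *)

Lemma nonpair_node_neq0 z : exists2 s, (1 <= s <= k.-1)%N & nonpair_prod (v k.-1 s + 0%:R) z != 0.
Proof.
have kn1 : (k.-1 < n)%N by apply: leq_ltn_trans (leq_pred k) kn.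
(* Pigeonhole: otherwise each of the k - 1 entries of row k - 1 matches, up to a half-integer, an
   entry of row k outside the pair. Two of them cannot match the same entry by 1-singularity, and
   there are only k - 2 such entries. *)
apply: contrapT => H.
have ex s : (1 <= s <= k.-1)%N -> exists t, [&& 1 <= t <= k, t != i & t != j]%N /\
    qnum m (v k.-1 s + 0%:R - ent z k t) = 0.
  move=> sk; apply: contrapT => nt; apply: H; exists s => //.
  rewrite /nonpair_prod big_nat_cond prodf_seq_neq0; apply/allP => t _.
  apply/implyP => /andP[tk /andP[ti tj]]; apply/eqP => q0; apply: nt; exists t.
  by rewrite q0 ti tj !andbT.
pose g s := if pselect ((1 <= s <= k.-1)%N) is left sk then projT1 (cid (ex s sk)) else 0%N.
have gP s : (1 <= s <= k.-1)%N -> [&& 1 <= g s <= k, g s != i & g s != j]%N /\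
    qnum m (v k.-1 s + 0%:R - ent z k (g s)) = 0.
  by move=> sk; rewrite /g; case: pselect => // p; case: cid.
have half x y : qnum m (x : C) = 0 -> qnum m (y : C) = 0 -> half_integer (x - y).
  move=> /(qnum_eq0_half m_ge3)[p [-> _]] /(qnum_eq0_half m_ge3)[p' [-> _]].
  by exists (p - p'); rewrite intrB mulrBl.
have inj : {in iota 1 k.-1 &, injective g}.
  move=> s s'; rewrite !mem_iota !add1n !ltnS => sk sk' e.
  apply/eqP/negP => /negP ss; apply: (@v_reg k.-1 s s') => //.
    by rewrite !inE !xpair_eqE ltn_eqF // ltn_predL.
  have := half _ _ (gP s sk).2 (gP s' sk').2.
  by rewrite e opprB addrA subrK !addr0.
have u : uniq [seq g s | s <- iota 1 k.-1] by rewrite map_inj_in_uniq ?iota_uniq.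
have sub : {subset i :: j :: [seq g s | s <- iota 1 k.-1] <= iota 1 k}.
  move=> t; rewrite !inE mem_iota add1n ltnS => /or3P[/eqP -> //|/eqP -> //|/mapP[s]].
  by rewrite mem_iota add1n ltnS => /gP[/and3P[h _ _] _] ->.
have u2 : uniq (i :: j :: [seq g s | s <- iota 1 k.-1]).
  rewrite /= u inE ij' /= andbT; apply/andP; split; apply/mapP => -[s];
    rewrite mem_iota add1n ltnS => /gP[/and3P[_ h1 h2] _] e; by rewrite -e eqxx in h1 h2.
have := uniq_leq_size u2 sub; rewrite /= size_map !size_iota.
by rewrite -ltnS prednK // ltnS leqNgt ltnS leqnn.
Qed.

Lemma slope_neq0 z : z.2.1 != z.2.2 -> exists2 s, (1 <= s <= k.-1)%N & slope k.-1 s 0 z != 0.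
Proof.
move=> zn; have [s sk rs] := nonpair_node_neq0 z; exists s => //.
rewrite /slope prednK // eqxx mulf_neq0 // mulf_neq0 ?invr_eq0 ?pnatr_eq0 //.
by apply: qnum_row_neq0; rewrite ?ji // /regular_at zn orbT.
Qed.

Lemma slope_class s z z' : eqrow k z z' -> slope k.-1 s 0 z = slope k.-1 s 0 z'.
Proof.
move=> /eqrow_ez zz'; rewrite /slope; case: eqP => // _; congr (_ * (_ / _)); last first.
  by apply: qnum_ent; rewrite !zz'.
rewrite /nonpair_prod big_nat_cond [RHS]big_nat_cond; apply: eq_bigr => t /andP[tr _].
rewrite /ent !opprD !addrA -!intrN; apply: ent_qnum_eq => //.
by rewrite !mulrNz; congr (- _); apply: zz'.
Qed.

Lemma node_class s z z' : eqrow k z z' -> node k.-1 s 0 z = node k.-1 s 0 z'.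
Proof.
move=> /eqrow_ez zz'; rewrite /node prednK //; apply: eq_big_nat => t tr.
rewrite /ent !opprD !addrA -!intrN; apply: ent_qnum_eq => //.
by rewrite !mulrNz; congr (- _); apply: zz'.
Qed.

(* The nilpotent part of the node operators recovers T from DT. *)
Lemma lower_DT z a b : proj_stable k.-1 -> z.2.1 != z.2.2 ->
  supported (eqrow k z) a -> supported (eqrow k z) b -> N (sT a + sD b) -> N (sT b).
Proof.
move=> PN zn Sa Sb Nx; have [s sk s0] := slope_neq0 zn.
have k1 : (k.-1 < k)%N by rewrite prednK.
have kn1 : (k.-1 < n)%N by apply: ltn_trans kn.
have mov := movable_lt PN kn1 (leqnn _) k1.
have kn2 : (k.-1.+1 < n)%N by rewrite prednK.
have := node_op 0 PN mov sk kn2 (supported_le (ltnW k1) Sa) (supported_le (ltnW k1) Sb) (or_intror k1) Nx.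
rewrite (weigh_const Sa (fun z' zz' => esym (node_class s zz'))).
rewrite (weigh_const Sb (fun z' zz' => esym (node_class s zz'))).
rewrite (weigh_const Sb (fun z' zz' => esym (slope_class s zz'))).
rewrite (linear_funD sT_lin) !(linear_funZ sT_lin) (linear_funZ sD_lin) addrAC -scalerDr => N1.
have := NB N1 (NZ (node k.-1 s 0 z) Nx); rewrite addrAC subrr add0r.
by move/(NZ (slope k.-1 s 0 z)^-1); rewrite scalerA mulVf // scale1r.
Qed.

Lemma pole_coef_class r z z' : (k <= r)%N -> eqrow r z z' -> z.2.1 = z.2.2 -> pole_coef z = pole_coef z'.
Proof.
move=> kr zz' zz; have e2 : z.2 = z'.2 := eqrow_pair kr zz'.
have zz1 : z'.2.1 = z'.2.2 by rewrite -e2.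
rewrite -(Kval_diag_i zz).
rewrite -(Kval_diag_i  zz1).
by rewrite (actK_class ik kn kr _ zz') //= (leq_trans (leq_pred k)).
Qed.

Lemma pole_coef_neq0 z : (forall t, (1 <= t < k)%N -> unblocked z k i t) -> pole_coef z != 0.
Proof.
move=> fr; rewrite /pole_coef mulf_neq0 ?invr_eq0 ?nonpair_prod_neq0 //.
rewrite big_nat_cond prodf_seq_neq0; apply/allP => t _; apply/implyP; rewrite andbT => tr.
exact: fr.
Qed.

Lemma tau_mv_diag z : z.2.1 = z.2.2 -> tau (z - del k i) = z - del k j.
Proof.
case: z => z1 [a b] /= ->; rewrite /tau /delta /= !xpair_eqE !eqxx ij' ji /=.
congr pair; apply/ffunP => p; rewrite !ffunE.
have [_ _ _ /negPf ni /negPf nj] := pos_regular p.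
by rewrite ni nj.
Qed.

Lemma tausym_sym r z z' : tausym (eqrow r z) z' = tausym (eqrow r z') z.
Proof.
rewrite /tausym eqrow_sym; congr (_ || _).
by rewrite -eqrow_tau tauK eqrow_sym.
Qed.

(** At the pole the moves at (k, i) and (k, j) are exchanged by [tau] and land in one class. Their
    residues are opposite, but so are the two DT, hence the DT terms add up instead of
    cancelling. *)
Lemma proj_diag r z z' : (k <= r)%N -> eqrow r z z' -> z.2.1 = z.2.2 ->
  proj (eqrow r (z - del k j)) (act (gen false k) (T z')) =
    (Dv m (qnum_xy R m * actK false k i z') + Dv m (qnum_xy R m * actK false k j z'))
      *: T (z' - del k j) + - (2 * pole_coef z') *: DT (z' - del k j).
Proof.
move=> kr zz' zz; have e2 : z.2 = z'.2 := eqrow_pair kr zz'.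
have zz1 : z'.2.1 = z'.2.2 by rewrite -e2.
rewrite act_T // (linear_fun_sum (proj_lin _)).
rewrite (bigD1_seq i) ?iota_uniq ?mem_index_iota //= (big_rem j) ?mem_index_iota //= ji /=.
have cj : tausym (eqrow r (z - del k j)) (z' - del k j).
  by apply/orP; left; rewrite eqrowDr.
have ci : tausym (eqrow r (z - del k j)) (z' - del k i).
  by apply/orP; right; rewrite tau_mv_diag // eqrowDr.
rewrite big_seq_cond big1 => [|t]; last first.
  rewrite mem_rem_uniq ?iota_uniq // inE /= mem_index_iota => /andP[/andP[tj tr] ti].
  have sim : simple_at k t z' by rewrite /simple_at ti tj orbT.
  have jt : (j == t) = false by rewrite eq_sym (negPf tj).
  have zz2 : eqrow r z' z by rewrite eqrow_sym.
  have cl : tausym (eqrow r (z - del k j)) (mv false k t z') = false.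
    rewrite tausym_sym; apply: etrans jt.
    exact: (@mv_class false r k t j z' z tr jk' kr kn zz2 sim).
  by rewrite (linear_fun_comb (proj_lin _)) proj_T proj_DT cl !scaler0 addr0.
rewrite addr0 !(linear_fun_comb (proj_lin _)) !proj_T !proj_DT /= ci cj.
rewrite -(T_tau (z' - del k i)) -[DT (z' - del k i)]opprK -DT_tau tau_mv_diag //.
rewrite (Kval_diag_i  zz1).
rewrite (Kval_diag_j  zz1).
rewrite addrACA -scalerDl; congr (_ + _).
by rewrite scalerN -scaleNr -scalerDl -opprD mulrDl mul1r.
Qed.

(* F_k sends a tableau at the pole to a combination involving DT, from which T is
   recovered by the nilpotent part of the node operators. *)
Lemma step_diag r z a : proj_stable r -> proj_stable k.-1 -> (k <= r < n)%N -> z.2.1 = z.2.2 ->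
  (forall t, (1 <= t < k)%N -> unblocked z k i t) -> supported (eqrow r z) a -> N (sT a) ->
  N (sT (translate (- del k j) a)) /\ N (sD (translate (- del k j) a)).
Proof.
move=> PN PNk /andP[kr rn] zz fr Sa Nx; have vg : valid_gen n (gen false k) by [].
have d0 := pole_coef_neq0 fr; have k1r := leq_trans (leq_pred k) kr.
pose d1 := - del k j; pose z1 := z + d1.
pose h := Dv m (qnum_xy R m * actK false k i z) + Dv m (qnum_xy R m * actK false k j z).
pose c := - (2 * pole_coef z).
have c0 : c != 0 by rewrite oppr_eq0 mulf_neq0 ?pnatr_eq0.
have := PN z1 _ (N_act vg Nx).
have -> : proj (eqrow r z1) (act (gen false k) (sT a)) =
    sT (h *: translate d1 a) + sD (c *: translate d1 a).
  apply: (@restr_ext_fun _ _ _ (fun a => proj (eqrow r z1) (act (gen false k) (sT a)))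
    (fun a => sT (h *: translate d1 a) + sD (c *: translate d1 a)) _ _ _ _ Sa).
  - exact: linear_comp (proj_lin _) (linear_comp (act_lin vg) sT_lin).
  - apply: linear_addf.
      by apply: linear_comp sT_lin _; apply: linear_scaled; exact: translate_lin.
    by apply: linear_comp sD_lin _; apply: linear_scaled; exact: translate_lin.
  move=> z' zz'; rewrite translateE (linear_funZ sT_lin) (linear_funZ sD_lin) !fglift1.
  rewrite (proj_diag kr zz' zz) -(pole_coef_class kr zz' zz).
  by rewrite -!(actK_class _ kn kr _ zz').
have Sa1 : supported (eqrow r z1) (translate d1 a) by apply: supported_translate.
have SZ x : supported (eqrow k z1) (x *: translate d1 a).
  by rewrite /supported linearZ /= (supported_le kr Sa1).
(* The entry (k, j) is now one below (k, i), so this is off the pole and [lower_DT] applies. *)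
have z1n : z1.2.1 != z1.2.2.
  rewrite -ez_ki -ez_kj !ezB !ez_delta // ez_ki ez_kj zz !xpair_eqE !eqxx ij' /= subr0.
  by rewrite eq_sym -subr_eq0 addrAC subrr add0r oppr_eq0 oner_eq0.
move=> N1; have := lower_DT PNk z1n (SZ h) (SZ c) N1.
rewrite (linear_funZ sT_lin) => /(NZ c^-1); rewrite scalerA mulVf // scale1r => N2.
split=> //; move: N1; rewrite (linear_funZ sT_lin) => /NB/(_ (NZ h N2)).
rewrite addrAC subrr add0r (linear_funZ sD_lin) => /(NZ c^-1).
by rewrite scalerA mulVf // scale1r.
Qed.

Lemma movable_diag r : proj_stable r -> proj_stable k.-1 -> (k <= r < n)%N -> movable r r.
Proof.
move=> PN PNk krn; have /andP[kr rn] := krn.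
move=> r' s z a b sr rr fr Sa Sb [b0|]; last by rewrite ltnNge kr.
have rn' := leq_ltn_trans rr rn.
have [sim|] := boolP (simple_at r' s z).
  by apply: (lower_step PN sr rr rn' fr sim Sa Sb); left.
rewrite /simple_at !negb_or !negbK => /and3P[/eqP rk sij /eqP zz].
rewrite b0 !linear0 !addr0 => Nx.
have fri t : (1 <= t < k)%N -> unblocked z k i t.
  move=> tk; have := fr t; rewrite rk => /(_ tk); move: sij; rewrite negb_and !negbK.
  by case/orP=> /eqP -> //; rewrite /unblocked (ent_diag zz).
have [N1 _] := step_diag PN PNk krn zz fri Sa Nx; rewrite rk.
move: sij; rewrite negb_and !negbK => /orP[] /eqP -> //.
have -> // : sT (translate (- del k i) a) = sT (translate (- del k j) a).
apply: (@restr_ext_fun _ _ _ (fun a => sT (translate (- del k i) a))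
  (fun a => sT (translate (- del k j) a)) _ _ _ _ Sa).
- exact: linear_comp sT_lin (translate_lin _).
- exact: linear_comp sT_lin (translate_lin _).
move=> z' zz'; rewrite !translateE !fglift1 -[LHS]T_tau tau_mv_diag //.
by rewrite -(eqrow_pair kr zz').
Qed.

Lemma unblock r s (x : 'Z_m) : (1 <= s <= r)%N -> (r < n)%N ->
  exists z1, forall z', eqrow r.-1 z' z1 -> ez z' r s = x ->
    forall t, (1 <= t < r)%N -> unblocked z' r s t.
Proof.
move=> sr rn; pose u := v r s + (nat_of_ord x)%:R.
exists (tableau (fun _ t => (qnum m (u - v r.-1 t) == 0)%:R)) => z' ez' ex t tr.
have r1 : (r.-1 < r)%N by rewrite prednK //; case/andP: sr => s1; apply: leq_trans.
have tr1 : (1 <= t <= r.-1)%N by case/andP: tr => -> tr /=; rewrite -ltnS prednK // (leq_ltn_trans _ r1).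
have := elimT (eqrow_ez _ _ _) ez' r.-1 t tr1 (ltn_trans r1 rn) (leqnn _).
rewrite ez_tableau ?(ltn_trans r1) //; set y := qnum m _ == 0 => et.
rewrite /unblocked entE (@ent_qnum_eq _ ((nat_of_ord x)%:Z - y%:Z)); last first.
  by rewrite !intrB -!pmulrn natr_Zp -ex -et.
have -> : v r s - v r.-1 t + ((nat_of_ord x)%:Z - y%:Z)%:~R = u - v r.-1 t - y%:R.
  by rewrite intrB -!pmulrn /u; ring.
rewrite /y; have [q0|q0] := eqVneq (qnum m (u - v r.-1 t)) 0.
  exact: qnum_pred_neq0.
by rewrite subr0.
Qed.

(** F_k yields the lowered DT plus a T-term. [lower_DT] gives the T of the family, hence also the
    lowered T, and the T-term can be subtracted. *)
Lemma step_DT r z b : proj_stable r -> proj_stable k.-1 -> (k <= r < n)%N -> z.2.1 != z.2.2 ->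
  (forall t, (1 <= t < k)%N -> unblocked z k j t) -> supported (eqrow r z) b ->
  N (sD b) -> N (sD (translate (- del k j) b)).
Proof.
move=> PN PNk /andP[kr rn] zn fr Sb Nx; have vg : valid_gen n (gen false k) by [].
have sim : simple_at k j z by rewrite /simple_at zn !orbT.
have c0 := actcF_neq0 jk' kn sim fr; set c := actc _ _ _ _ in c0.
pose d1 := - del k j.
have S0 : supported (eqrow r z) 0 by rewrite /supported linear0.
have NT : N (sT b).
  apply: (lower_DT PNk zn (supported_le kr S0) (supported_le kr Sb)).
  by rewrite (linear_fun0 sT_lin) add0r.
have N1 : N (sT (translate d1 b)).
  have := lower_step PN jk' kr kn fr sim Sb S0 (or_introl erefl).
  by rewrite !linear0 !addr0; apply.
have := PN (mv false k j z) _ (N_act vg Nx).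
have -> : proj (eqrow r (mv false k j z)) (act (gen false k) (sD b)) =
    c *: sD (translate d1 b) + actd false k j z *: sT (translate d1 b).
  apply: (@restr_ext_fun _ _ _ (fun b => proj (eqrow r (mv false k j z)) (act (gen false k) (sD b)))
    (fun b => c *: sD (translate d1 b) + actd false k j z *: sT (translate d1 b)) _ _ _ _ Sb).
  - exact: linear_comp (proj_lin _) (linear_comp (act_lin vg) sD_lin).
  - apply: linear_addf; apply: linear_scaled.
      exact: linear_comp sD_lin (translate_lin _).
    exact: linear_comp sT_lin (translate_lin _).
  move=> z' zz'; rewrite translateE !fglift1.
  have zn' : z'.2.1 != z'.2.2 by rewrite -(eqrow_pair kr zz').
  rewrite (proj_actDT _ jk' kr kn zz' sim zn').
  rewrite -(actcF_class jk' kn kr zz' sim) /actd.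
  by rewrite (actK_class jk' kn kr _ zz') //= (leq_trans (leq_pred k)).
move/NB/(_ (NZ (actd false k j z) N1)); rewrite addrK => /(NZ c^-1).
by rewrite scalerA mulVf // scale1r.
Qed.

(** Before each lowering of (k, j) the rows below k are rearranged so that nothing blocks it. This
    is why the result is described in the rows >= k only. *)
Lemma lift_DT_steps r z b c D : proj_stable r -> proj_stable k.-1 -> (k <= r < n)%N ->
  supported (eqrow r z) b -> vanish_above r D -> N (sD (translate D b)) ->
  (forall l, (l < c)%N -> ez (z + D) k j - l%:R != ez (z + D) k i) ->
  exists D', [/\ vanish_above r D', N (sD (translate D' b)) &
    forall a t, (1 <= t <= a)%N -> (k <= a < n)%N ->
      ez (z + D') a t = ez (z + D - del k j *+ c) a t].
Proof.
move=> PN PNk krn Sb; have /andP[kr rn] := krn; elim: c D => [|c IH] D vD Nx hc.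
  by exists D; split=> // a t _ _; rewrite mulr0n subr0.
have zn : ez (z + D) k j != ez (z + D) k i by have := hc 0%N isT; rewrite subr0.
have [zs fs] := unblock (ez (z + D) k j) jk' kn.
have k1r : (k.-1 <= r)%N := leq_trans (leq_pred k) kr.
have Sb1 := supported_translate D Sb.
have S0 : supported (eqrow r (z + D)) 0 by rewrite /supported linear0.
have mov := movable_lt PN rn k1r k1k.
have Nx0 : N (sT 0 + sD (translate D b)) by rewrite (linear_fun0 sT_lin) add0r.
have [d [vd Nd ed]] := transport zs k1n mov S0 Sb1 (or_intror k1k) Nx0.
have dk a t : (1 <= t <= a)%N -> (k <= a < n)%N -> ez d a t = 0.
  by move=> ta /andP[ka an]; apply: (vanish_above_ez vd) => //; apply: leq_trans ka.
have dkj : ez d k j = 0 by rewrite dk ?leqnn.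
have dki : ez d k i = 0 by rewrite dk ?leqnn.
move: Nd; rewrite !linear0 add0r translateD => Nd.
have fr t : (1 <= t < k)%N -> unblocked (z + D + d) k j t.
  by apply: fs => //; rewrite ezD dkj addr0.
have zn' : (z + D + d).2.1 != (z + D + d).2.2.
  by rewrite -ez_ki -ez_kj !(ezD (z + D)) dkj dki !addr0 eq_sym.
have Sb2 := supported_translate d Sb1; rewrite translateD in Sb2.
have := step_DT PN PNk krn zn' fr Sb2 Nd; rewrite translateD => N3.
have [|||D' [vD' N4 e4]] := IH (D + d - del k j).
- apply: vanish_aboveB; last by apply: vanish_above_le kr _; apply: vanish_above_delta.
  by apply: vanish_aboveD => //; apply: vanish_above_le k1r vd.
- exact: N3.
- move=> l lc; have := hc l.+1 lc.
  rewrite addrA addrA !(ezB (z + D + d)) !(ezD (z + D)) dkj dki !addr0 !ez_delta // !xpair_eqE !eqxx ij' /=.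
  by rewrite subr0 -addrA -opprD nat1r.
exists D'; split=> // a t ta kan; rewrite e4 // !addrA mulrS opprD addrA.
by rewrite !(ezB _ (del k j *+ c)) !ezB [ez (z + D + d) a t]ezD dk // addr0.
Qed.

(** The family of T is moved until (k, j) has the residue of (k, i), the rest of the rows >= k
    keeping its residues. At this pole [step_diag] gives DT with (k, j) one lower. Then (k, j)
    descends round Z_m to its original residue, and the rows below k are restored. *)
Lemma lift_DT r z b : proj_stable r -> proj_stable k.-1 -> (k <= r < n)%N -> z.2.1 != z.2.2 ->
  supported (eqrow r z) b -> N (sT b) -> N (sD b).
Proof.
move=> PN PNk krn zn Sb Nx; have /andP[kr rn] := krn.
have k1r : (k.-1 <= r)%N := leq_trans (leq_pred k) kr.
have [zs fs] := unblock z.2.1 ik kn.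
pose e a t : 'Z_m := if (a < k)%N then ez zs a t else if (a, t) == (k, j) then z.2.1 else ez z a t.
have S0 : supported (eqrow r z) 0 by rewrite /supported linear0.
have Nx0 : N (sT b + sD 0) by rewrite (linear_fun0 sD_lin) addr0.
have [d [vd Nd ed]] := transport (tableau e) rn (movable_diag PN PNk krn) Sb S0 (or_introl erefl) Nx0.
move: Nd; rewrite !linear0 addr0 => Nd.
have ezd a t : (1 <= t <= a)%N -> (a < n)%N -> (a <= r)%N -> ez (z + d) a t = e a t.
  by move=> ta an ar; rewrite (elimT (eqrow_ez _ _ _) ed) // ez_tableau.
have ekj : ez (z + d) k j = z.2.1 by rewrite ezd // /e ltnn eqxx.
have eki : ez (z + d) k i = z.2.1 by rewrite ezd // /e ltnn xpair_eqE eqxx ij' /= ez_ki.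
have Sb1 := supported_translate d Sb.
have zz : (z + d).2.1 = (z + d).2.2 by rewrite -ez_ki -ez_kj ekj eki.
have fr t : (1 <= t < k)%N -> unblocked (z + d) k i t.
  apply: fs => //; apply/eqrow_ez => a b' ba an ak.
  have ak' : (a < k)%N by apply: leq_ltn_trans ak k1k.
  by rewrite ezd ?(leq_trans ak) // /e ak'.
have [_ N2] := step_diag PN PNk krn zz fr Sb1 Nd.
rewrite translateD in N2.
pose c := nat_of_ord (z.2.1 - 1 - z.2.2).
have cE : c%:R = z.2.1 - 1 - z.2.2 :> 'Z_m by rewrite natr_Zp.
have vD : vanish_above r (d - del k j).
  by apply: vanish_aboveB => //; apply: vanish_above_le kr _; apply: vanish_above_delta.
have ej : ez (z + (d - del k j)) k j = z.2.1 - 1.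
  by rewrite addrA ezB ekj ez_delta // eqxx.
have ei : ez (z + (d - del k j)) k i = z.2.1.
  by rewrite addrA ezB eki ez_delta // xpair_eqE eqxx ij' subr0.
(* After l < c lowerings (k, j) is l + 1 below (k, i), and 0 < l + 1 <= c < m, so the pole is not
   met again. *)
have hc l : (l < c)%N -> ez (z + (d - del k j)) k j - l%:R != ez (z + (d - del k j)) k i.
  move=> lc; rewrite ej ei -subr_eq0; apply/negP => /eqP h.
  have : (l.+1%:R == 0 :> 'Z_m).
    by rewrite -oppr_eq0 -h -natr1; apply/eqP; ring.
  have cm : (c < m)%N by rewrite -[X in (_ < X)%N](@Zp_cast m) ?ltn_ord // ltnW.
  have := Zp_int_eq0 l.+1; rewrite -pmulrn => -> /dvdn_leq-/(_ isT).
  rewrite absz_nat => ml; have := leq_trans cm ml; by rewrite ltnS leqNgt lc.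
have [D [vD' N3 eD]] := lift_DT_steps PN PNk krn Sb vD N2 hc.
have mov := movable_lt PN rn k1r k1k.
have Nx3 : N (sT 0 + sD (translate D b)) by rewrite (linear_fun0 sT_lin) add0r.
have S0' : supported (eqrow r (z + D)) 0 by rewrite /supported linear0.
have [d' [vd' N4 ed']] := transport z k1n mov S0' (supported_translate D Sb) (or_intror k1k) Nx3.
have := @translate_back r z (D + d') 0 b; rewrite -!translateD linear0 => /(_ _ _ _).
rewrite (linear_fun0 sT_lin) add0r; apply.
- by apply: vanish_aboveD => //; apply: vanish_above_le k1r vd'.
- apply/eqrow_ez => a t ta an ar; rewrite addrA; case: (ltnP a k) => ak.
    by apply: (elimT (eqrow_ez _ _ _) ed') => //; rewrite -ltnS prednK.
  have kan : (k <= a < n)%N by rewrite ak.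
  rewrite ezD (vanish_above_ez vd') ?(leq_trans k1k) // addr0 eD //.
  have dc : ez (del k j *+ c) a t = ((a, t) == (k, j))%:R *+ c.
    elim: (c) => [|c' IH]; first by rewrite !mulr0n ez0.
    by rewrite !mulrS ezD IH ez_delta.
  rewrite ezB dc addrA ezB ezd // ez_delta // /e ltnNge ak /=.
  case: eqP => [[-> ->]|_]; last by rewrite mul0rn !subr0.
  rewrite mulr1n cE ez_kj.
  by ring.
move: N4; rewrite linear0; exact.
Qed.

(** * Separating the classes by row r + 1 *)

Lemma row_prod_tau (F : C -> C) a z : (a < n)%N ->
  \prod_(1 <= t < a.+1) F (ent (tau z) a t) = \prod_(1 <= t < a.+1) F (ent z a t).
Proof.
move=> an; have [ak|ak] := eqVneq a k; last first.
  by apply: eq_bigr => t _; rewrite /ent entry_tau.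
subst a; rewrite !prod_pair; congr (_ * _); last first.
  apply: eq_bigr => t /andP[ti tj]; rewrite /ent /entry !xpair_eqE !eqxx.
  by rewrite (negPf ti) (negPf tj).
by rewrite /ent !entry_ki !entry_kj -!v_sing mulrC.
Qed.

Lemma row_prod_class (F : C -> C) a z z' :
  (forall x (d : int), (m%:Z %| d)%Z -> F (x + d%:~R) = F x) -> (a < n)%N -> eqrow a z z' ->
  \prod_(1 <= t < a.+1) F (ent z a t) = \prod_(1 <= t < a.+1) F (ent z' a t).
Proof.
move=> Fm an zz'; apply: eq_big_nat => t ta.
rewrite -(Fm (ent z' a t) _ (eqrow_entry zz' ta an (leqnn a))); congr F.
by rewrite /ent intrB; ring.
Qed.

Lemma qpow_dvdD x (d : int) : (m%:Z %| d)%Z -> qpow m (x + d%:~R : C) = qpow m x.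
Proof. by move=> md; apply: (qpow_dvd) md; ring. Qed.

Lemma qpow_wt z r : qpow m (wt z r.+1) =
  \prod_(1 <= s < r.+2) qpow m (ent z r.+1 s) / \prod_(1 <= s < r.+1) qpow m (ent z r s)
    * qpow m r.+1%:R.
Proof.
have h (s : seq nat) F : qpow m (\sum_(t <- s) F t : C) = \prod_(t <- s) qpow m (F t).
  by apply: (big_morph (qpow m)) => [x y|]; rewrite ?qpowD ?qpow0.
by rewrite wtE !qpowD qpowN !h.
Qed.

Lemma wt_class z z' r : (r.+1 < n)%N -> tausym (eqrow r.+1 z) z' ->
  qpow m (wt z r.+1) = qpow m (wt z' r.+1).
Proof.
move=> rn; have rn' := ltnW rn; rewrite !qpow_wt.
have cl u u' : eqrow r.+1 u u' -> 
  \prod_(1 <= s < r.+2) qpow m (ent u r.+1 s) / \prod_(1 <= s < r.+1) qpow m (ent u r s) =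
  \prod_(1 <= s < r.+2) qpow m (ent u' r.+1 s) / \prod_(1 <= s < r.+1) qpow m (ent u' r s).
  move=> uu'; rewrite (row_prod_class qpow_dvdD rn uu').
  by rewrite (row_prod_class qpow_dvdD rn' (eqrow_le (leqnSn r) uu')).
case/orP=> /cl -> //; by rewrite !row_prod_tau.
Qed.

Lemma node_tausym r s c z z' : (r.+1 < n)%N -> tausym (eqrow r.+1 z) z' ->
  node r s c z = node r s c z'.
Proof.
move=> rn; pose F x := qnum m (v r s + c%:R - x).
have Fm x (d : int) : (m%:Z %| d)%Z -> F (x + d%:~R) = F x.
  move=> md; rewrite /F; apply: (@qnum_dvd _ _ (- d)); last by rewrite rpredN.
  by rewrite intrN; ring.
case/orP=> /(row_prod_class Fm rn); rewrite /node // => ->.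
exact: (row_prod_tau F).
Qed.

Definition top_poly r z : {poly C} :=
  \prod_(w <- [seq qpow m (2 * ent z r.+1 t) | t <- index_iota 1 r.+2]) ('X - w%:P).

(** [u - w]_q equals q^(2u) - q^(2w) divided by q^u q^w (q - q^-1). Apart from a constant, the only
    extra factor is the product of the q^w, which the weight of K_(r+1) controls. *)
Lemma node_top r s c z : node r s c z =
  (top_poly r z).[qpow m (2 * (v r s + c%:R))] *
  (\prod_(1 <= t < r.+2) (qpow m (- (v r s + c%:R)) / (qroot R m - (qroot R m)^-1)) /
   \prod_(1 <= t < r.+2) qpow m (ent z r.+1 t)).
Proof.
rewrite /node /top_poly horner_prod big_map -prodfV -!big_split; apply: eq_bigr => t _ /=.
rewrite hornerXsubC; move: (v r s + c%:R) (ent z r.+1 t) => u w.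
have fe (F : fieldType) (x y d : F) : x != 0 -> y != 0 -> d != 0 ->
    (x / y - y / x) / d = (x * x - y * y) * (x^-1 / d / y) by move=> *; field; apply/and3P.
rewrite /qnum opprB !mulr_natl !mulr2n !qpowD !qpowN.
by apply: fe; rewrite ?qpow_neq0 // qdiff_neq0.
Qed.

Lemma ent_match a t t' z z' : qnum m (ent z' a t - ent z a t') = 0 -> v a t = v a t' ->
  ez z' a t = ez z a t'.
Proof.
move=> + e; rewrite /ent opprD addrACA e subrr add0r -intrB => /(qnum_int_eq0 m_ge3 m_odd) h.
by apply/eqP; rewrite Zp_int_eq.
Qed.

Lemma top_poly_match r z z' t : top_poly r z = top_poly r z' -> (1 <= t <= r.+1)%N ->
  exists2 t', (1 <= t' <= r.+1)%N & qnum m (ent z' r.+1 t - ent z r.+1 t') = 0.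
Proof.
move=> e tr; have : root (top_poly r z') (qpow m (2 * ent z' r.+1 t)).
  by rewrite root_prod_XsubC; apply/mapP; exists t; rewrite ?mem_index_iota.
rewrite -e root_prod_XsubC => /mapP[t']; rewrite mem_index_iota => tr' et.
exists t' => //; apply/eqP; rewrite (qnum_eq0 m_ge3) mulrBr qpowD qpowN et.
by rewrite mulfV // qpow_neq0.
Qed.

(** Equal polynomials have the same roots q^(2w). Matching different columns would give a
    half-integer difference in v, so it happens only within the pair, where it amounts to [tau]. *)
Lemma top_poly_class r z z' : (r.+1 < n)%N -> eqrow r z z' ->
  top_poly r z = top_poly r z' -> tausym (eqrow r.+1 z) z'.
Proof.
move=> rn zz' e.
have half x : qnum m (x : C) = 0 -> half_integer x.
  by move=> /(qnum_eq0_half m_ge3)[p [-> _]]; exists p.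
have key u u' t : top_poly r u = top_poly r u' -> (1 <= t <= r.+1)%N ->
    (r.+1, t) \notin [:: (k, i); (k, j)] -> ez u' r.+1 t = ez u r.+1 t.
  move=> eu tr nt; have [t' tr' q0] := top_poly_match eu tr.
  have tt' : t = t'.
    apply: contrapT => /eqP ne; apply: (@v_reg r.+1 t t') => //.
      move: nt; rewrite !inE !xpair_eqE !negb_or => /andP[h1 h2].
      by rewrite (negPf h1) (negPf h2).
    have [p hp] := half _ q0; exists (p - (E u' r.+1 t - E u r.+1 t') * 2).
    rewrite intrB intrM mulrBl -hp mulfK ?pnatr_eq0 // /ent !intrB; ring.
  by move: q0; rewrite -tt' => q0; apply: (ent_match q0).
have low a b : (1 <= b <= a)%N -> (a < n)%N -> (a <= r)%N -> ez z a b = ez z' a b.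
  by apply/eqrow_ez.
have [rk|rk] := eqVneq r.+1 k; last first.
  apply/orP; left; apply/eqrow_ez => a b ba an; rewrite leq_eqVlt => /predU1P[ea|]; last exact: low.
  subst a; apply/esym/key => //.
  by rewrite !inE !xpair_eqE (negPf rk).
have pair u u' t : top_poly r u = top_poly r u' -> (t == i) || (t == j) ->
    ez u' k t = ez u k i \/ ez u' k t = ez u k j.
  move=> eu tij; have tr : (1 <= t <= r.+1)%N by rewrite rk; case/orP: tij => /eqP ->.
  have [t' tr' q0] := top_poly_match eu tr; rewrite rk in tr' q0.
  have vt : v k t = v k i by case/orP: tij => /eqP ->.
  have [t'ij|t'ij] := boolP ((t' == i) || (t' == j)).
    have e' : ez u' k t = ez u k t'.
      apply: (ent_match q0); rewrite vt; by case/orP: t'ij => /eqP ->.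
    by rewrite e'; case/orP: t'ij => /eqP ->; [left | right].
  exfalso; move: t'ij; rewrite negb_or => /andP[t'i t'j].
  apply: (@v_reg k t t') => //; first by rewrite rk in tr.
  - by apply: contraTneq tij => ->; rewrite negb_or t'i.
  - by rewrite !inE !xpair_eqE (negPf t'i) (negPf t'j) !andbF.
  have [p hp] := half _ q0; exists (p - (E u' k t - E u k t') * 2).
  rewrite intrB intrM mulrBl -hp mulfK ?pnatr_eq0 // /ent !intrB; ring.
have other b : (1 <= b <= k)%N -> b != i -> b != j -> ez z k b = ez z' k b.
  move=> bk bi bj; have := key z z' b e; rewrite [X in ez z' X b]rk [X in ez z X b]rk => -> //.
    by rewrite rk.
  by rewrite !inE !xpair_eqE (negPf bi) (negPf bj) !andbF.
have fin u : (forall a b, a != k -> ez u a b = ez z' a b) ->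
    (forall b, b != i -> b != j -> ez u k b = ez z' k b) ->
    ez z k i = ez u k i -> ez z k j = ez u k j -> eqrow r.+1 z u.
  move=> ua uk ui uj; apply/eqrow_ez => a b ba an ar; have [ak|ak] := eqVneq a k; last first.
    rewrite ua // low //; move: ar; rewrite leq_eqVlt ltnS => /predU1P[ea|//].
    by rewrite ea rk eqxx in ak.
  subst a; have [->|bi] := eqVneq b i; first by [].
  have [->|bj] := eqVneq b j; first by [].
  by rewrite uk // other.
have ii : (i == i) || (i == j) by rewrite eqxx.
have jj : (j == i) || (j == j) by rewrite eqxx orbT.
have fin1 : ez z k i = ez z' k i -> ez z k j = ez z' k j -> eqrow r.+1 z z' by apply: fin.
have fin2 : ez z k i = ez z' k j -> ez z k j = ez z' k i -> eqrow r.+1 z (tau z').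
  move=> e1 e2; apply: fin => [a b ak|b bi bj||].
  - by rewrite ez_tau.
  - by rewrite ez_tau_row.
  - by rewrite e1 ez_kj ez_ki.
  - by rewrite e2 ez_ki ez_kj.
have [h1|h1] := pair _ _ _ e ii; have [h2|h2] := pair _ _ _ e jj.
- apply/orP; right; apply: fin2; first by rewrite h2.
  by have [->|->] := pair _ _ _ (esym e) jj; rewrite ?h2 ?h1.
- by apply/orP; left; apply: fin1.
- by apply/orP; right; apply: fin2.
- apply/orP; left; apply: fin1; last by rewrite h2.
  by have [->|->] := pair _ _ _ (esym e) ii; rewrite ?h1 ?h2.
Qed.

(* As v_ki = v_kj, the node at (k, j) is shifted by 1 to keep the nodes distinct. *)
Definition shift_node r s : nat := (r, s) == (k, j).

Lemma node_inj r s t : (r < n)%N -> (1 <= s <= r)%N -> (1 <= t <= r)%N ->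
  qpow m (2 * (v r s + (shift_node r s)%:R)) = qpow m (2 * (v r t + (shift_node r t)%:R)) -> s = t.
Proof.
move=> rn sr tr e; apply: contrapT => /eqP ne.
have : qnum m (v r s + (shift_node r s)%:R - (v r t + (shift_node r t)%:R)) = 0.
  by apply/eqP; rewrite (qnum_eq0 m_ge3) mulrBr qpowD qpowN e mulfV // qpow_neq0.
have ex : v r s + (shift_node r s)%:R - (v r t + (shift_node r t)%:R) =
   v r s - v r t + ((shift_node r s)%:Z - (shift_node r t)%:Z)%:~R.
  by rewrite intrB -!pmulrn; ring.
rewrite ex => q0.
have [st|st] := boolP ((r, s, t) \in [:: (k, i, j); (k, j, i)]); last first.
  apply: (@v_reg r s t) => //.
  have [p [hp _]] := qnum_eq0_half m_ge3 q0.
  exists (p - ((shift_node r s)%:Z - (shift_node r t)%:Z) * 2).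
  by rewrite intrB intrM mulrBl -hp mulfK ?pnatr_eq0 // addrK.
have n1 (d : int) : absz d = 1%N -> (m%:Z %| d)%Z -> False.
  by move=> d1; rewrite dvdzE d1 => /dvdn_leq-/(_ isT); rewrite leqNgt absz_nat (leq_trans _ m_ge3).
have eij : v k i - v k j = 0 by rewrite v_sing subrr.
have eji : v k j - v k i = 0 by rewrite v_sing subrr.
move: st q0; rewrite !inE !xpair_eqE -!andbA /shift_node => /orP[] /and3P[/eqP -> /eqP -> /eqP ->].
  rewrite eij add0r => /(qnum_int_eq0 m_ge3 m_odd); apply: n1.
  by rewrite !xpair_eqE !eqxx ij'.
rewrite eji add0r => /(qnum_int_eq0 m_ge3 m_odd); apply: n1.
by rewrite !xpair_eqE !eqxx ij'.
Qed.

(** Both polynomials are monic of degree r + 1, so their difference has degree at most r. It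
    vanishes at the r nodes and at 0, where the value is up to sign the square of the product of the
    q^w; this product is given by K_(r+1), as the rows r agree. *)
Lemma separate r z z' : (r.+1 < n)%N -> eqrow r z z' ->
  (forall s, (1 <= s <= r)%N -> node r s (shift_node r s) z = node r s (shift_node r s) z') ->
  qpow m (wt z r.+1) = qpow m (wt z' r.+1) -> tausym (eqrow r.+1 z) z'.
Proof.
move=> rn1 zz' en ew; have rn := ltnW rn1; apply: top_poly_class => //.
pose W z := \prod_(1 <= t < r.+2) qpow m (ent z r.+1 t).
have eW : W z = W z'.
  have := ew; rewrite !qpow_wt (row_prod_class qpow_dvdD rn zz').
  move/(mulIf (qpow_neq0 _ _)); apply: mulIf.
  by rewrite invr_eq0 prodf_seq_neq0; apply/allP => t _; rewrite qpow_neq0.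
have W0 : W z' != 0.
  by rewrite prodf_seq_neq0; apply/allP => t _; rewrite qpow_neq0.
have top0 u : (top_poly r u).[0] = (-1) ^+ r.+1 * (W u * W u).
  rewrite /top_poly horner_prod big_map -big_split /=.
  have -> : (-1) ^+ r.+1 = \prod_(1 <= t < r.+2) (-1) :> C.
    by rewrite prodr_const_nat subn1.
  rewrite -big_split; apply: eq_bigr => t _ /=.
  by rewrite hornerXsubC sub0r mulN1r mulr_natl mulr2n qpowD.
apply/eqP; rewrite -subr_eq0; apply/eqP.
pose rs := 0 :: [seq qpow m (2 * (v r s + (shift_node r s)%:R)) | s <- index_iota 1 r.+1].
apply: (@roots_geq_poly_eq0 _ _ rs).
- rewrite /= rootE hornerD hornerN !top0 eW subrr eqxx /=; apply/allP => _ /mapP[s + ->].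
  rewrite mem_index_iota => sr; rewrite rootE hornerD hornerN subr_eq0; apply/eqP.
  have := en s sr; rewrite !node_top -/(W z) -/(W z') eW; apply: mulIf.
  rewrite mulf_neq0 ?invr_eq0 // prodf_seq_neq0; apply/allP => t _.
  by rewrite mulf_neq0 ?qpow_neq0 // invr_eq0 qdiff_neq0.
- rewrite /= map_inj_in_uniq ?iota_uniq ?andbT.
    by apply/mapP => -[s _ /esym/eqP]; rewrite (negPf (qpow_neq0 _ _)).
  by move=> s t; rewrite !mem_index_iota => sr tr; apply: node_inj.
have sz u : size (top_poly r u) = r.+2.
  by rewrite size_prod_XsubC size_map size_iota subn1.
have mon u : (top_poly r u)`_r.+1 = 1.
  have /monicP := monic_prod_XsubC [seq qpow m (2 * ent u r.+1 t) | t <- index_iota 1 r.+2] xpredT id.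
  by rewrite lead_coefE -/(top_poly r u) sz.
rewrite /= size_map size_iota subn1 /=; apply/leq_sizeP => l.
rewrite leq_eqVlt => /predU1P[<-|rl]; first by rewrite coefB !mon subrr.
by rewrite coefB !nth_default ?subrr // sz.
Qed.

Lemma act_UK r a b : (1 <= r <= n)%N -> act (UK r) (sT a + sD b) =
  sT (weigh (fun z => qpow m (wt z r)) a) + sD (weigh (fun z => qpow m (wt z r)) b).
Proof.
move=> rn; have vg : valid_gen n (UK r) by [].
rewrite (linear_funD (act_lin vg)); congr (_ + _).
  apply: (@freeg_ext_fun _ _ _ (fun a => act (UK r) (sT a))
    (fun a => sT (weigh (fun z => qpow m (wt z r)) a))).
  - exact: linear_comp (act_lin vg) sT_lin.
  - by apply: linear_comp sT_lin _; exact: linearP.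
  by move=> z; rewrite weighE (linear_funZ sT_lin) !fglift1 (act_K _ rn).1.
apply: (@freeg_ext_fun _ _ _ (fun a => act (UK r) (sD a))
  (fun a => sD (weigh (fun z => qpow m (wt z r)) a))).
- exact: linear_comp (act_lin vg) sD_lin.
- by apply: linear_comp sD_lin _; exact: linearP.
by move=> z; rewrite weighE (linear_funZ sD_lin) !fglift1 (act_K _ rn).2.
Qed.

(** The node operators and K_(r+1) are applied in turn. Within a class of the rows <= r, their joint
    generalized eigenspaces are by [separate] the classes of the rows <= r + 1, up to [tau]. *)
Lemma restr_next_row r z a b : proj_stable r -> movable r r -> (r.+1 < n)%N ->
  supported (eqrow r z) a -> supported (eqrow r z) b -> b = 0 \/ (r < k)%N -> N (sT a + sD b) ->
  N (sT (restr (tausym (eqrow r.+1 z)) a) + sD (restr (tausym (eqrow r.+1 z)) b)).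
Proof.
move=> PN mov rn1 Sa Sb mode Nx.
(* The empty support encodes b = 0, the only case allowed for r >= k. *)
pose SB : pred I := if (r < k)%N then eqrow r z else pred0.
have SBA z' : SB z' -> eqrow r z z' by rewrite /SB; case: ifP.
have SBb : supported SB b by rewrite /SB; case: ifP mode => // _ [->|//]; rewrite /supported linear0.
have SBmode b' : supported SB b' -> b' = 0 \/ (r < k)%N.
  by rewrite /supported /SB; case: ifP => [|_ <-]; [right | left; rewrite restr_pred0].
pose f s z' := node r s (shift_node r s) z'.
pose G (L : seq nat) : pred I := fun z' => all (fun s => f s z' == f s z) L.
have GS L x S : supported S x -> supported S (restr (G L) x).
  by move=> Sx; rewrite /supported restr_comp -{2}Sx restr_comp; apply: eq_restr => z' /=; rewrite andbC.
have NG L : all (fun s => (1 <= s <= r)%N) L -> N (sT (restr (G L) a) + sD (restr (G L) b)).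
  elim: L => [_|s L IH /= /andP[sr Lr]].
    have eG x : restr (G [::]) x = x by apply: (@restr_sub _ _ (fun z' => z' \in dom x)) => //; exact: restr_dom.
    by rewrite !eG.
  have op a' b' : restr (eqrow r z) a' = a' -> restr SB b' = b' -> N (sT a' + sD b') ->
      N (sT (weigh (f s) a' + weigh (slope r s (shift_node r s)) b') + sD (weigh (f s) b')).
    move=> Sa' Sb'; apply: (@node_op r s _ z) => //; last exact: SBmode.
    exact: (restr_sub SBA Sb').
  have := generalized_eigen N_sub SBA op (f s z) (GS L _ _ Sa) (GS L _ _ SBb) (IH Lr).
  have eG x : restr (fun z' => f s z' == f s z) (restr (G L) x) = restr (G (s :: L)) x.
    by rewrite restr_comp; apply: eq_restr.
  by rewrite !eG.
pose L := index_iota 1 r.+1; pose w z' := qpow m (wt z' r.+1).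
have NL : N (sT (restr (G L) a) + sD (restr (G L) b)).
  by apply: NG; apply/allP => s; rewrite mem_index_iota.
have opK a' b' : restr (eqrow r z) a' = a' -> restr SB b' = b' -> N (sT a' + sD b') ->
    N (sT (weigh w a' + weigh (fun=> 0) b') + sD (weigh w b')).
  move=> Sa' Sb' N'; rewrite (weigh_const Sb' (fun _ _ => erefl)) scale0r addr0.
  have rn2 : (1 <= r.+1 <= n)%N by rewrite /= ltnW.
  by rewrite -act_UK //; apply: N_act.
have := generalized_eigen N_sub SBA opK (w z) (GS L _ _ Sa) (GS L _ _ SBb) NL.
have eG x : supported (eqrow r z) x ->
    restr (fun z' => w z' == w z) (restr (G L) x) = restr (tausym (eqrow r.+1 z)) x.
  move=> Sx; rewrite -Sx !restr_comp; apply: eq_restr => z' /=.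
  have [zz'|] := boolP (eqrow r z z'); last by rewrite !andbF.
  rewrite !andbT; apply/andP/idP => [[/eqP ew /allP eL]|Q].
    apply: separate => // s sr; apply/esym/eqP/eL.
    by rewrite mem_index_iota.
  split; first by apply/eqP/esym/wt_class.
  by apply/allP => s _; apply/eqP/esym/node_tausym.
by rewrite !eG.
Qed.

Lemma proj_sT S a : proj S (sT a) = sT (restr (tausym S) a).
Proof.
apply: (@freeg_ext_fun _ _ _ (fun a => proj S (sT a)) (fun a => sT (restr (tausym S) a))).
- exact: linear_comp (proj_lin _) sT_lin.
- by apply: linear_comp sT_lin _; exact: linearP.
move=> z; rewrite restrE fglift1 proj_T; case: ifP => _; first by rewrite fglift1.
by rewrite (linear_fun0 sT_lin).
Qed.

Lemma proj_sD S a : proj S (sD a) = sD (restr (tausym S) a).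
Proof.
apply: (@freeg_ext_fun _ _ _ (fun a => proj S (sD a)) (fun a => sD (restr (tausym S) a))).
- exact: linear_comp (proj_lin _) sD_lin.
- by apply: linear_comp sD_lin _; exact: linearP.
move=> z; rewrite restrE fglift1 proj_DT; case: ifP => _; first by rewrite fglift1.
by rewrite (linear_fun0 sD_lin).
Qed.

Lemma proj_le r z x : proj (eqrow r.+1 z) x = proj (eqrow r.+1 z) (proj (eqrow r z) x).
Proof.
have [a [b ->]] := span x.
have e y : restr (tausym (eqrow r.+1 z)) y = restr (tausym (eqrow r.+1 z)) (restr (tausym (eqrow r z)) y).
  rewrite restr_comp; apply: eq_restr => z' /=.
  apply/idP/andP => [h|[]//]; split=> //; rewrite /tausym.
  by case/orP: h => h; rewrite (eqrow_le (leqnSn r) h) ?orbT.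
by rewrite !(linear_funD (proj_lin _)) !proj_sT !proj_sD -!e.
Qed.

Lemma sD_diag r z b : (k <= r)%N -> z.2.1 = z.2.2 -> supported (eqrow r z) b -> sD b = 0.
Proof.
move=> kr zz Sb; apply: (@restr_ext_fun _ _ _ sD (fun=> 0) _ _ sD_lin _ Sb).
  by move=> c x y; rewrite scaler0 addr0.
by move=> z' zz'; rewrite fglift1 DT_diag // -(eqrow_pair kr zz').
Qed.

(** For r < k, T and DT are separated together. For r >= k only families of T can be moved. At the
    pole there is no DT; off it [lower_DT] and [lift_DT] give [sT b] and then [sD b], so [sT a] too.
    The T are separated, and [lift_DT] returns to DT. *)
Lemma proj_stable_succ r : (r.+1 < n)%N -> proj_stable r ->
  ((k <= r)%N -> proj_stable k.-1) -> proj_stable r.+1.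
Proof.
move=> rn1 PN PNk z x Nx; have rn := ltnW rn1.
rewrite proj_le; have := PN z x Nx; have [a [b [-> Sa Sb]]] := orient (eqrow r z) x.
rewrite (linear_funD (proj_lin _)) proj_sT proj_sD => {x}Nx.
have [rk|kr] := ltnP r k.
  by apply: restr_next_row => //; [apply: movable_lt | right].
have krn : (k <= r < n)%N by rewrite kr.
have mov := movable_diag PN (PNk kr) krn.
have S0 : supported (eqrow r z) 0 by rewrite /supported linear0.
have sepT y : supported (eqrow r z) y -> N (sT y) -> N (sT (restr (tausym (eqrow r.+1 z)) y)).
  move=> Sy Ny; have := restr_next_row PN mov rn1 Sy S0 (or_introl erefl).
  by rewrite !linear0 !addr0; apply.
have SQ y : supported (eqrow r z) y -> supported (eqrow r z) (restr (tausym (eqrow r.+1 z)) y).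
  by move=> Sy; rewrite /supported restr_comp -{2}Sy restr_comp; apply: eq_restr => z' /=; rewrite andbC.
have [zz|zn] := eqVneq z.2.1 z.2.2.
  rewrite (sD_diag kr zz (SQ _ Sb)) addr0; apply: sepT => //.
  by move: Nx; rewrite (sD_diag kr zz Sb) addr0.
have NTb := lower_DT (PNk kr) zn (supported_le kr Sa) (supported_le kr Sb) Nx.
have NDb := lift_DT PN (PNk kr) krn zn Sb NTb.
apply: ND; first by apply: sepT => //; have := NB Nx NDb; rewrite addrK.
by apply: (lift_DT PN (PNk kr) krn zn (SQ _ Sb)); apply: sepT.
Qed.

Lemma proj_stable_all r : (r < n)%N -> proj_stable r.
Proof.
(* Strong induction, since the step at r >= k also uses the case k - 1. *)
have [p] := ubnP r; elim: p r => // p IH [|r] rp rn; last first.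
  apply: proj_stable_succ => // [|kr]; first by apply: IH => //; apply: ltnW.
  by apply: IH k1n; apply: leq_ltn_trans (leq_trans (leq_pred k) kr) _.
move=> z x; have -> // : proj (eqrow 0 z) x = x.
have [a [b ->]] := span x.
have e y : restr (tausym (eqrow 0 z)) y = y.
  apply: (@restr_sub _ _ (fun z' => z' \in dom y)); last exact: restr_dom.
  move=> z' _; apply/orP; left; apply/eqrow_ez => c d /andP[d1 dc] _.
  by rewrite leqn0 => /eqP c0; move: (leq_trans d1 dc); rewrite c0.
by rewrite (linear_funD (proj_lin _)) proj_sT proj_sD !e.
Qed.

(** F reaches a tableau congruent to any given one in all rows < n, and a shift does the rest. The
    DT follow by [lift_DT] off the pole, and vanish at it. *)
Lemma all_of_tableau z : N (T z) -> forall x, N x.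
Proof.
move=> Nz; have rn : (n.-1 < n)%N by rewrite prednK // (leq_ltn_trans _ kn).
have krn : (k <= n.-1 < n)%N by rewrite rn andbT -ltnS prednK // (leq_ltn_trans _ kn).
have PN := proj_stable_all rn; have PNk := proj_stable_all k1n.
have mov := movable_diag PN PNk krn.
have sup1 u : supported (eqrow n.-1 u) << u >> by rewrite /supported restrE eqrow_refl.
have NT u : N (T u).
  have S0 : supported (eqrow n.-1 z) 0 by rewrite /supported linear0.
  have Nz' : N (sT << z >> + sD 0) by rewrite (linear_fun0 sD_lin) addr0 fglift1.
  have [d [_ Nd ed]] := transport u rn mov (sup1 z) S0 (or_introl erefl) Nz'.
  move: Nd; rewrite !linear0 addr0 translateE fglift1 => Nd.
  have [f ef] : exists f, u = z + d + lat f.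
    have [||f hf] := @vanish_above_lat n.-1 (u - (z + d)).
    - split=> [p|]; last by case/andP: krn => h _; rewrite ltnNge h.
      by have [_ _ pn _ _] := pos_regular p; rewrite ltnNge -ltnS prednK ?pn // (leq_ltn_trans _ kn).
    - by rewrite eqrow_sym -(eqrowDr _ _ _ (z + d)) add0r subrK.
    by exists f; rewrite -hf addrC subrK.
  by rewrite ef -tshift_T; apply: N_shift.
have NDT u : N (DT u).
  have [uu|un] := eqVneq u.2.1 u.2.2; first by rewrite DT_diag //; case: N_sub.
  have := lift_DT PN PNk krn un (sup1 u); rewrite !fglift1; apply; exact: NT.
have Nspan (X : I -> V) a : (forall u, N (X u)) -> N (fglift X a).
  move=> NX; elim/freeg_ind: a => [|c u y IH]; first by rewrite linear0; case: N_sub.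
  by rewrite linearP /= fglift1; apply: (subspaceP N_sub).
by move=> x; have [a [b ->]] := span x; apply: ND; apply: Nspan.
Qed.

Lemma tausym_trans r z1 z2 z3 : tausym (eqrow r z1) z2 -> tausym (eqrow r z2) z3 ->
  tausym (eqrow r z1) z3.
Proof.
case/orP=> h1 /orP[] h2; apply/orP.
- by left; apply: eqrow_trans h1 h2.
- by right; apply: eqrow_trans h1 h2.
- by right; apply: eqrow_trans h1 _; rewrite eqrow_tau.
- by left; apply: eqrow_trans h1 _; rewrite -(tauK z3) eqrow_tau.
Qed.

(** * Vectors outside a subspace modulo which all shifts are trivial *)

Variable K : V -> Prop.
Hypothesis K_sub : is_subspace K.
Hypothesis KN : forall x, K x -> N x.
Hypothesis K_shift : forall f x, K (tshift f x - x).
Local Notation KD := (subspaceD K_sub).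

(** A vector meets finitely many classes, and up to [tau] these are disjoint, so it is the sum of
    its components. *)
Lemma proj_components r x : (forall z, K (proj (eqrow r z) x)) -> K x.
Proof.
have [a [b ->]] := span x => Kx.
pose Q z := tausym (eqrow r z); pose H (L : seq I) : pred I := fun z' => has (fun z => Q z z') L.
have HK L : K (sT (restr (H L) a) + sD (restr (H L) b)).
  elim: L => [|z L IH].
    have e (y : A) : restr (H [::]) y = 0 by rewrite -[RHS](restr_pred0 y); apply: eq_restr.
    by rewrite !e !linear0 addr0; case: K_sub.
  have [zL|zL] := boolP (H L z).
    have e (y : A) : restr (H (z :: L)) y = restr (H L) y.
      apply: eq_restr => z' /=; apply/orb_idl => zz'.
      by case/hasP: zL => y' yL yz; apply/hasP; exists y' => //; apply: tausym_trans zz'.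
    by rewrite !e.
  have e (y : A) : restr (H (z :: L)) y = restr (Q z) y + restr (H L) y.
    apply: (@freeg_ext_fun _ _ _ (fun y => restr (H (z :: L)) y) (fun y => restr (Q z) y + restr (H L) y)).
    - exact: linearP.
    - by apply: linear_addf; exact: linearP.
    move=> z'; rewrite !restrE /=; have [zz'|] := boolP (Q z z'); last by rewrite add0r.
    case: ifP => [/hasP[y' yL yz']|]; last by rewrite addr0.
    case/negP: zL; apply/hasP; exists y' => //; apply: tausym_trans yz' _.
    by rewrite tausym_sym.
  have := KD (Kx z) IH; rewrite (linear_funD (proj_lin _)) proj_sT proj_sD.
  by rewrite !e (linear_funD sT_lin) (linear_funD sD_lin) addrACA.
have e L (y : A) : {subset dom y <= L} -> restr (H L) y = y.
  move=> yL; apply: (@restr_sub _ _ (fun z' => z' \in dom y)); last exact: restr_dom.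
  by move=> z' /yL z'L; apply/hasP; exists z' => //; rewrite /Q /tausym eqrow_refl.
have := HK (dom a ++ dom b); rewrite !e // => z; rewrite mem_cat => ->; by rewrite ?orbT.
Qed.

Lemma eqrow_lat z z' : eqrow n.-1 z z' -> exists f, z' = z + lat f.
Proof.
move=> zz'; have n0 : (0 < n)%N by apply: leq_ltn_trans kn.
have [||f hf] := @vanish_above_lat n.-1 (z' - z).
- split=> [p|]; last by rewrite ltnNge -ltnS prednK // kn.
  by have [_ _ pn _ _] := pos_regular p; rewrite ltnNge -ltnS prednK ?pn.
- by rewrite eqrow_sym -(eqrowDr _ _ _ z) add0r subrK.
by exists f; rewrite -hf addrC subrK.
Qed.

Lemma collapse z a : exists c, K (sT (restr (eqrow n.-1 z) a) - c *: T z) /\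
  K (sD (restr (eqrow n.-1 z) a) - c *: DT z).
Proof.
elim/freeg_ind: a => [|c u a [c' [IHT IHD]]].
  by exists 0; rewrite !linear0 !scale0r subrr; case: K_sub.
rewrite !linearP /= !restrE; case: ifP => [/eqrow_lat[f ->]|_]; last first.
  by exists c'; rewrite !linear0 ?scaler0 !add0r.
exists (c + c'); rewrite !fglift1 !scalerDl !opprD -!tshift_T -!tshift_DT.
have e (x y w : V) : c *: x + y + (- (c *: w) - c' *: w) = c *: (x - w) + (y - c' *: w).
  by rewrite scalerBr addrACA.
by rewrite !e; split; apply: (subspaceP K_sub) => //; apply: K_shift.
Qed.

(** Modulo K a component is al T(z) + be DT(z) by [collapse]. If be != 0 off the pole, [lower_DT]
    gives be T(z) modulo K; otherwise the T part alone is outside K, so al != 0. *)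
Lemma all_of_outside x : N x -> ~ K x -> forall y, N y.
Proof.
move=> Nx nKx; have n0 : (0 < n)%N by apply: leq_ltn_trans kn.
have rn : (n.-1 < n)%N by rewrite prednK.
have kr : (k <= n.-1)%N by rewrite -ltnS prednK.
have [z nKz] : exists z, ~ K (proj (eqrow n.-1 z) x).
  apply: contrapT => h; apply: nKx; apply: (@proj_components n.-1) => z.
  by apply: contrapT => nK; apply: h; exists z.
have := proj_stable_all rn z Nx; move: nKz.
have [a [b [-> Sa Sb]]] := orient (eqrow n.-1 z) x => nK Nab.
suff : N (T z) by apply: all_of_tableau.
have [al [KTa _]] := collapse z a; rewrite Sa in KTa.
have [be [KTb KDb]] := collapse z b; rewrite Sb in KTb KDb.
have unit_case c (y : V) : K (y - c *: T z) -> N y -> c != 0 -> N (T z).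
  move=> Kd Ny c0; have := NZ c^-1 (NB Ny (KN Kd)).
  by rewrite subKr scalerA mulVf // scale1r.
have al0 : ~ K (sT a) -> al != 0.
  by move=> nKa; apply/eqP => a0; apply: nKa; move: KTa; rewrite a0 scale0r subr0.
have [zz|zn] := eqVneq z.2.1 z.2.2.
  move: nK Nab; rewrite (sD_diag kr zz Sb) addr0 => nK Na.
  exact: unit_case KTa Na (al0 nK).
have NTb := lower_DT (proj_stable_all k1n) zn (supported_le kr Sa) (supported_le kr Sb) Nab.
have [b0|b0] := eqVneq be 0; last exact: unit_case KTb NTb b0.
have KD' : K (sD b) by move: KDb; rewrite b0 scale0r subr0.
have Na : N (sT a) by have := NB Nab (KN KD'); rewrite addrK.
by apply: unit_case KTa Na (al0 _) => Ka; apply: nK; apply: KD.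
Qed.

End Submodules.

(** * The module V(T(v)) *)

Section TableauSpace.
Local Notation V := (VT R n m k i j).
Local Notation A := {freeg I / C}.
Local Notation T := (@tabT R n m k i j).
Local Notation DT := (@tabDT R n m k i j).
Implicit Types (a b : A) (x : V).

Lemma mem_linspan (B : set (freeVT R n m k i j)) (y : freeVT R n m k i j) : B y -> linspan B y.
Proof. by move=> Bx S; apply. Qed.

Lemma tabT_tau z : T (tau z) = T z.
Proof.
apply/esym/lquot_eqP/asboolP/mem_linspan; left; by exists z.
Qed.

Lemma tabDT_tau z : DT (tau z) = - DT z.
Proof.
apply/eqP; rewrite eq_sym -subr_eq0 -opprD oppr_eq0; apply/eqP.
rewrite /tabDT -lquot_piD -[RHS](linear0 (lquot_pi (linspan (@VT_relations R n m k i j)))).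
by apply/lquot_eqP/asboolP; rewrite subr0; apply: mem_linspan; right; exists z.
Qed.

Lemma tabDT_fix z : tau z = z -> DT z = 0.
Proof.
by move=> tz; apply: eq_opp0; rewrite -tabDT_tau tz.
Qed.

Definition spanT : A -> V := fglift T.

Definition spanDT : A -> V := fglift DT.
HB.instance Definition _ := GRing.Linear.on spanT.
HB.instance Definition _ := GRing.Linear.on spanDT.

Lemma spanTE z : spanT << z >> = T z. Proof. exact: fglift1. Qed.

Lemma spanDTE z : spanDT << z >> = DT z. Proof. exact: fglift1. Qed.

Lemma tabT_span x : exists a b, x = spanT a + spanDT b.
Proof.
rewrite -[x]lquot_reprK; elim/freeg_ind: (lquot_repr x) => [|c w y [a [b IH]]].
  by exists 0, 0; rewrite !linear0 addr0.
rewrite linearP /= IH; case: w => z.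
  by exists (c *: << z >> + a), b; rewrite linearP /= spanTE addrA.
by exists a, (c *: << z >> + b); rewrite linearP /= spanDTE addrCA.
Qed.

Section Lift.
Variables (W : lmodType C) (f g : I -> W).

(** The universal property of V(T(v)), computed on representatives; it is meaningful once [f] is
    tau-invariant and [g] changes sign under [tau]. *)
Definition VTlift : V -> W :=
  fglift (fun w => match w with inl z => f z | inr z => g z end) \o @lquot_repr _ _ _.

Hypotheses (f_tau : forall z, f (tau z) = f z) (g_tau : forall z, g (tau z) = - g z).

Local Notation h := (fun w : I + I => match w with inl z => f z | inr z => g z end).

Fact lift_ker_subspace : is_subspace [set y : freeVT R n m k i j | fglift h y = 0]%classic.
Proof.
by split=> [|c x y /= hx hy]; rewrite /= ?linear0 // linearP /= hx hy scaler0 addr0.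
Qed.

Lemma VTlift_pi y : VTlift (lquot_pi _ y) = fglift h y.
Proof.
rewrite /VTlift /=; apply/eqP; rewrite -subr_eq0 -linearB /=; apply/eqP.
have /lquot_eqP/asboolP hy := lquot_reprK (lquot_pi (linspan (@VT_relations R n m k i j)) y).
apply: (hy (Subspace lift_ker_subspace)) => _ [] [z ->] /=.
  by rewrite linearB /= /freeT !fglift1 f_tau subrr.
by rewrite linearD /= /freeDT !fglift1 g_tau subrr.
Qed.

Lemma VTlift_linear : linear VTlift.
Proof.
move=> c x y; rewrite -[x]lquot_reprK -[y]lquot_reprK -linearP !VTlift_pi.
exact: linearP.
Qed.

Lemma VTliftT z : VTlift (T z) = f z.
Proof. by rewrite VTlift_pi fglift1. Qed.

Lemma VTliftDT z : VTlift (DT z) = g z.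
Proof. by rewrite VTlift_pi fglift1. Qed.

End Lift.

Lemma VT_ext (W : lmodType C) (f g : {linear V -> W}) :
  (forall z, f (T z) = g (T z)) -> (forall z, f (DT z) = g (DT z)) -> f =1 g.
Proof.
move=> fgT fgD x; have [a [b ->]] := tabT_span x; rewrite !linearD.
have h1 := @freeg_ext _ _ _ (f \o spanT : {linear _ -> _}) (g \o spanT : {linear _ -> _}).
have h2 := @freeg_ext _ _ _ (f \o spanDT : {linear _ -> _}) (g \o spanDT : {linear _ -> _}).
congr (_ + _); [apply: h1|apply: h2] => z /=; by rewrite ?spanTE ?spanDTE.
Qed.

Definition proj (S : pred I) : V -> V :=
  VTlift (fun z => if tausym S z then T z else 0) (fun z => if tausym S z then DT z else 0).

Lemma proj_linear S : linear (proj S).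
Proof.
apply: VTlift_linear => z; rewrite tausym_tau ?tabT_tau ?tabDT_tau //.
by case: ifP; rewrite ?oppr0.
Qed.
HB.instance Definition _ S := GRing.isLinear.Build C V V *:%R (proj S) (proj_linear S).

Lemma projT S z : proj S (T z) = if tausym S z then T z else 0.
Proof.
apply: VTliftT => {}z; rewrite tausym_tau ?tabT_tau ?tabDT_tau //.
by case: ifP; rewrite ?oppr0.
Qed.

Lemma projDT S z : proj S (DT z) = if tausym S z then DT z else 0.
Proof.
apply: VTliftDT => {}z; rewrite tausym_tau ?tabT_tau ?tabDT_tau //.
by case: ifP; rewrite ?oppr0.
Qed.

Lemma proj_spanT S a : proj S (spanT a) = spanT (restr (tausym S) a).
Proof.
have := @freeg_ext _ _ _ (proj S \o spanT : {linear _ -> _}) (spanT \o restr (tausym S) : {linear _ -> _}).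
by apply=> z /=; rewrite spanTE projT restrE; case: ifP; rewrite ?spanTE ?linear0.
Qed.

Lemma proj_spanDT S a : proj S (spanDT a) = spanDT (restr (tausym S) a).
Proof.
have := @freeg_ext _ _ _ (proj S \o spanDT : {linear _ -> _}) (spanDT \o restr (tausym S) : {linear _ -> _}).
by apply=> z /=; rewrite spanDTE projDT restrE; case: ifP; rewrite ?spanDTE ?linear0.
Qed.

(* A tau-symmetric family can be rewritten with indices in S only: replace z by
   tau z whenever z is not in S. *)
Lemma proj_oriented S x :
  exists a b, [/\ proj S x = spanT a + spanDT b, restr S a = a & restr S b = b].
Proof.
have [a [b ->]] := tabT_span x; rewrite linearD /= proj_spanT proj_spanDT.
pose oT : A -> A := fglift (fun z => if S z then << z >> else if S (tau z) then << tau z >> else 0).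
pose oD : A -> A := fglift (fun z => if S z then << z >> else if S (tau z) then - << tau z >> else 0).
exists (oT a), (oD b); split.
- congr (_ + _).
    have := @freeg_ext _ _ _ (spanT \o restr (tausym S) : {linear _ -> _}) (spanT \o fglift _ : {linear _ -> _}).
    apply=> z /=; rewrite restrE fglift1 /tausym; case: (S z) => //=; case: (S (tau z)); rewrite ?linear0 //.
    by rewrite !spanTE tabT_tau.
  have := @freeg_ext _ _ _ (spanDT \o restr (tausym S) : {linear _ -> _}) (spanDT \o fglift _ : {linear _ -> _}).
  apply=> z /=; rewrite restrE fglift1 /tausym; case: (S z) => //=; case: (S (tau z)); rewrite ?linear0 //.
  by rewrite linearN /= !spanDTE tabDT_tau opprK.
- have := @freeg_ext _ _ _ (restr S \o fglift _ : {linear _ -> _}) (fglift _).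
  apply=> z /=; rewrite !fglift1; case: ifP => Sz; first by rewrite restrE Sz.
  by case: ifP => Stz; rewrite ?linear0 // restrE Stz.
- have := @freeg_ext _ _ _ (restr S \o fglift _ : {linear _ -> _}) (fglift _).
  apply=> z /=; rewrite !fglift1; case: ifP => Sz; first by rewrite restrE Sz.
  by case: ifP => Stz; rewrite ?linear0 // linearN /= restrE Stz.
Qed.

Definition tshift (f : lattice) : V -> V :=
  VTlift (fun z => T (z + lat f)) (fun z => DT (z + lat f)).

Lemma tshift_linear f : linear (tshift f).
Proof. by apply: VTlift_linear => z; rewrite -tau_lat ?tabT_tau ?tabDT_tau. Qed.
HB.instance Definition _ f := GRing.isLinear.Build C V V *:%R (tshift f) (tshift_linear f).

Lemma tshiftT f z : tshift f (T z) = T (z + lat f).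
Proof. by apply: VTliftT => {}z; rewrite -tau_lat ?tabT_tau ?tabDT_tau. Qed.

Lemma tshiftDT f z : tshift f (DT z) = DT (z + lat f).
Proof. by apply: VTliftDT => {}z; rewrite -tau_lat ?tabT_tau ?tabDT_tau. Qed.

Lemma tshiftD f g x : tshift (f + g) x = tshift f (tshift g x).
Proof.
have := @VT_ext _ (tshift (f + g)) (tshift f \o tshift g : {linear _ -> _}).
by apply=> z /=; rewrite ?tshiftT ?tshiftDT ?tshiftT ?tshiftDT latD -addrA [lat g + _]addrC.
Qed.

Lemma tshift0 x : tshift 0 x = x.
Proof.
have := @VT_ext _ (tshift 0) (idfun : {linear V -> V}).
by apply=> z /=; rewrite ?tshiftT ?tshiftDT lat0 addr0.
Qed.

Variable act : Ugen -> V -> V.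
Hypothesis act_GT : is_GT_action v act.
Hypothesis act_linear : forall g, valid_gen n g -> linear (act g).

(** Injectivity of [Z] keeps coefficients from merging. [DvT] runs over the support only, but
    vanishing coefficients contribute nothing ([KDv0]). *)
Lemma DvT_sum (r : seq nat) (F : nat -> ratK R) (Z : nat -> I) :
  uniq r -> {in r &, injective Z} ->
  DvT (\sum_(s <- r) << F s *g Z s >>) =
  \sum_(s <- r) (Dv m (F s) *: T (Z s) + Kval m (F s) *: DT (Z s)).
Proof.
move=> ur injZ; set u := (X in DvT X).
have [K0 D0] := KDv0.
pose phi z := Dv m (coeff z u) *: T z + Kval m (coeff z u) *: DT z.
have cu s : s \in r -> coeff (Z s) u = F s.
  move=> sr; rewrite /u raddf_sum /=.
  rewrite (bigD1_seq s)  //= coeffU eqxx mulr1 big_seq_cond big1 ?addr0 //.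
  move=> s' /andP[sr' ns]; rewrite coeffU; case: eqP => [e|]; last by rewrite mulr0.
  by move: ns; rewrite (injZ s' s sr' sr e) eqxx.
rewrite /DvT -/u (_ : \sum_(z <- dom u) _ = \sum_(z <- [seq Z s | s <- r]) phi z); last first.
  have pu : perm_eq (dom u) [seq z <- [seq Z s | s <- r] | z \in dom u].
    apply: uniq_perm; rewrite ?uniq_dom ?filter_uniq ?map_inj_in_uniq // => z; rewrite mem_filter.
    case: (boolP (z \in dom u)) => //= zu; apply/esym.
    have := dom_sum_subset zu; move=> /flatten_mapP[s].
    rewrite filter_predT => sr; have [->|f0] := eqVneq (F s) 0; first by rewrite freegU0 dom0.
    by rewrite domU // inE => /eqP ->; apply: map_f.
  rewrite (perm_big _ pu) big_filter big_mkcond; apply: eq_bigr => z _.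
  case: ifP => // /negbT; rewrite mem_dom negbK => /eqP e.
  by rewrite /phi e K0 D0 !scale0r addr0.
by rewrite big_map; apply: eq_big_seq => s sr; rewrite /phi cu.
Qed.

Lemma generic_gen up r z : (1 <= r)%N ->
  generic_act v (gen up r) z = \sum_(1 <= s < r.+1) << actK up r s z *g mv up r s z >>.
Proof.
case: up => /= r1.
  rewrite -sumrN; apply: eq_bigr => s _.
  by rewrite freegUN /actK /adj /= mulN1r.
apply: eq_bigr => s _; rewrite /actK /adj prednK // expr0 mul1r //.
Qed.

Lemma valid_gen_gen up r : (1 <= r < n)%N -> valid_gen n (gen up r).
Proof. by case: up. Qed.

Lemma mv_inj_in up r z : (r < n)%N -> {in index_iota 1 r.+1 &, injective (fun s => mv up r s z)}.
Proof.
move=> rn s s'; by rewrite !mem_index_iota => sr sr'; apply: mv_inj.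
Qed.

Lemma actT_gen up r z : (1 <= r < n)%N -> act (gen up r) (T z) =
  \sum_(1 <= s < r.+1) (Dv m (qnum_xy R m * actK up r s z) *: T (mv up r s z) +
                        Kval m (qnum_xy R m * actK up r s z) *: DT (mv up r s z)).
Proof.
move=> /andP[r1 rn].
have [-> _] := act_GT (@valid_gen_gen up r (introT andP (conj r1 rn))).
rewrite (generic_gen up z r1) scaler_sumr.
have <- := @DvT_sum _ (fun s => qnum_xy R m * actK up r s z) _ (iota_uniq _ _) (@mv_inj_in up r z rn).
by congr DvT; apply: eq_bigr => s _; rewrite freegZ.
Qed.

Lemma actDT_gen up r z : (1 <= r < n)%N -> z.2.1 != z.2.2 -> act (gen up r) (DT z) =
  \sum_(1 <= s < r.+1) (Dv m (actK up r s z) *: T (mv up r s z) +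
                        Kval m (actK up r s z) *: DT (mv up r s z)).
Proof.
move=> /andP[r1 rn] zz.
have [_ ->] := act_GT (@valid_gen_gen up r (introT andP (conj r1 rn))).
  rewrite (generic_gen up z r1).
  exact: (@DvT_sum _ (fun s => actK up r s z) _ (iota_uniq _ _) (@mv_inj_in up r z rn)).
by move=> e; move: zz; rewrite {1}e eqxx.
Qed.

Lemma actDT up r z : (1 <= r < n)%N -> z.2.1 != z.2.2 ->
  act (gen up r) (DT z) =
  \sum_(1 <= s < r.+1) (actc up r s z *: DT (mv up r s z) + actd up r s z *: T (mv up r s z)).
Proof.
move=> r1n zz; rewrite actDT_gen //; have /andP[r1 rn] := r1n.
apply: eq_big_nat => s sr.
have reg : regular_at r z by rewrite /regular_at zz orbT.
have [b jf] := jet_actK up (actden_neq0 sr rn reg).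
by have [-> _] := jetP jf; rewrite addrC.
Qed.

Lemma VT_linear_ext (W : lmodType C) (f g : V -> W) : linear f -> linear g ->
  (forall z, f (T z) = g (T z)) -> (forall z, f (DT z) = g (DT z)) -> f =1 g.
Proof.
move=> lf lg.
pose F : {linear V -> W} := HB.pack f (GRing.isLinear.Build C V W _ f lf).
pose G : {linear V -> W} := HB.pack g (GRing.isLinear.Build C V W _ g lg).
exact: (@VT_ext _ F G).
Qed.

Lemma act0 g : valid_gen n g -> act g 0 = 0.
Proof.
by move=> vg; have := act_linear vg (-1) 0 0; rewrite scaler0 addr0 scaleN1r addNr.
Qed.

Lemma tau_fixP z : z.2.1 = z.2.2 <-> tau z = z.
Proof.
by case: z => z1 [a b]; split=> /= [->//|[]].
Qed.

Lemma tabDT_diag z : z.2.1 = z.2.2 -> DT z = 0.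
Proof. by move/tau_fixP/tabDT_fix. Qed.

Lemma tshift_act_gen up r f x : (1 <= r < n)%N ->
  act (gen up r) (tshift f x) = tshift f (act (gen up r) x).
Proof.
move=> rn; have vg : valid_gen n (gen up r) by case: up.
have lg := act_linear vg; have /andP[r1 rn'] := rn.
have eK s z : (1 <= s <= r)%N -> actK up r s (z + lat f) = actK up r s z.
  by move=> sr; apply: eq_actK => // a b _ _ _; apply: entry_lat.
move: x; apply: VT_linear_ext => [c x y|c x y|z|z].
- by rewrite tshift_linear lg.
- by rewrite lg tshift_linear.
- rewrite tshiftT (actT_gen up _ rn) (actT_gen up z rn) (linear_fun_sum (@tshift_linear f)).
  apply: eq_big_nat => s sr; rewrite (linear_fun_comb (@tshift_linear f)) mv_lat (eK _ _ sr).
  by rewrite -tshiftT -tshiftDT.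
- rewrite tshiftDT; have [zz|zz] := eqVneq z.2.1 z.2.2.
    have zz' : (z + lat f).2.1 = (z + lat f).2.2 by rewrite /= zz.
    by rewrite (tabDT_diag zz) (tabDT_diag zz') (act0 vg) (linear_fun0 (@tshift_linear f)).
  have zz' : (z + lat f).2.1 != (z + lat f).2.2 by rewrite /= !addr0.
  rewrite (actDT_gen up rn zz') (actDT_gen up rn zz) (linear_fun_sum (@tshift_linear f)).
  apply: eq_big_nat => s sr; rewrite (linear_fun_comb (@tshift_linear f)) mv_lat (eK _ _ sr).
  by rewrite -tshiftT -tshiftDT.
Qed.

(** The variables enter the weight through x + y only, which D^v annihilates. Hence the K_r act on
    DT without a T-term. *)
Lemma weight_var z r : (generic_weight v z r).2.1 = (generic_weight v z r).2.2.
Proof.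
rewrite /generic_weight /=.
rewrite !(big_morph (fun w : affine R => w.2) (id1 := 0) (op1 := +%R)) //=.
rewrite !(big_morph (fun w : int * int => w.1) (id1 := 0) (op1 := +%R)) //=.
rewrite !(big_morph (fun w : int * int => w.2) (id1 := 0) (op1 := +%R)) //=.
have h (a l : nat) : (1 <= l <= k)%N -> \sum_(1 <= s < a.+1) (((a, s) == (k, l))%:R : int) = (a == k)%:R.
  move=> /andP[l1 lk]; case: eqP => [->|/eqP ak].
    rewrite (bigD1_seq l) ?iota_uniq ?mem_index_iota ?l1 //= eqxx big1 ?addr0 //.
    by move=> s sl; rewrite xpair_eqE eqxx (negPf sl).
  by rewrite big1 // => s _; rewrite xpair_eqE (negPf ak).
case: r => [|r]; first by rewrite !big_geq.
by rewrite /= !h.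
Qed.

Definition genK (inv : bool) r := if inv then UKi r else UK r.

Definition wtK (inv : bool) z r := let w := generic_weight v z r in if inv then - w else w.

Lemma jet_wtK inv z r : jet m (qpowK m (wtK inv z r)) (qpow m (wtK inv z r).1) 0.
Proof.
have := jet_qpowK m (wtK inv z r).
have -> : (wtK inv z r).2.1 - (wtK inv z r).2.2 = 0.
  have e := weight_var z r; apply/eqP; rewrite subr_eq0 /wtK; apply/eqP.
  by case: inv; [exact: (congr1 -%R e) | exact: e].
by rewrite mulr0z mulr0.
Qed.

Lemma DvT1 (f : ratK R) z : DvT << f *g z >> = Dv m f *: T z + Kval m f *: DT z.
Proof.
have inj1 : {in [:: 0%N] &, injective (fun=> z)} by move=> x y; rewrite !inE => /eqP -> /eqP ->.
by have := @DvT_sum [:: 0%N] (fun=> f) (fun=> z) isT inj1; rewrite !big_seq1.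
Qed.

Lemma act_genK inv r z : (1 <= r <= n)%N ->
  act (genK inv r) (T z) = qpow m (wtK inv z r).1 *: T z /\
  act (genK inv r) (DT z) = qpow m (wtK inv z r).1 *: DT z.
Proof.
move=> rn; have vg : valid_gen n (genK inv r) by case: inv.
have e : generic_act v (genK inv r) z = << qpowK m (wtK inv z r) *g z >> by case: (inv).
have jw := jet_wtK inv z r.
have [hT hD] := act_GT vg; split.
  by rewrite hT e freegZ DvT1; have [-> ->] := jetP (jet_xyM jw); rewrite scale0r addr0.
have [zz|zz] := eqVneq z.2.1 z.2.2; first by rewrite tabDT_diag // act0 // scaler0.
rewrite hD; last by move=> e'; move: zz; rewrite {1}e' eqxx.
by rewrite e DvT1; have [-> ->] := jetP jw; rewrite scale0r add0r.
Qed.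

Lemma tshift_act g f x : valid_gen n g -> act g (tshift f x) = tshift f (act g x).
Proof.
have hK inv r : (1 <= r <= n)%N -> act (genK inv r) (tshift f x) = tshift f (act (genK inv r) x).
  move=> rn; have vg : valid_gen n (genK inv r) by case: inv.
  have lg := act_linear vg.
  have ew z : qpow m (wtK inv (z + lat f) r).1 = qpow m (wtK inv z r).1.
    have dent (a b : nat) : exists2 d : int, ent (z + lat f) a b - ent z a b = d%:~R & (m%:Z %| d)%Z.
      exists (E (z + lat f) a b - E z a b); last exact: entry_lat.
      by rewrite /ent intrB; ring.
    have dsum (a : nat) (s : seq nat) : exists2 d : int,
        \sum_(b <- s) ent (z + lat f) a b - \sum_(b <- s) ent z a b = d%:~R & (m%:Z %| d)%Z.
      elim: s => [|b s [d IH dm]]; first by exists 0; rewrite ?big_nil ?subrr.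
      have [d' h' dm'] := dent a b; exists (d' + d); last exact: rpredD.
      by rewrite !big_cons intrD -h' -IH; ring.
    have dw : exists2 d : int, wt (z + lat f) r - wt z r = d%:~R & (m%:Z %| d)%Z.
      have [d1 e1 h1] := dsum r (index_iota 1 r.+1).
      have [d2 e2 h2] := dsum r.-1 (index_iota 1 r).
      exists (d1 - d2); last exact: rpredB.
      by rewrite !wtE intrB -e1 -e2; ring.
    have [d ed hd] := dw; have := qpow_dvd ed hd.
    by rewrite /wtK; case: inv {vg lg} => // ed'; rewrite !qpowN -/(wt _ _) ed'.
  move: x; apply: VT_linear_ext => [c x y|c x y|z|z].
  - by rewrite tshift_linear lg.
  - by rewrite lg tshift_linear.
  - by rewrite tshiftT !(act_genK _ _ rn).1 (linear_funZ (@tshift_linear f)) tshiftT ew.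
  - by rewrite tshiftDT !(act_genK _ _ rn).2 (linear_funZ (@tshift_linear f)) tshiftDT ew.
case: g => r /= rn.
- exact: (tshift_act_gen true).
- exact: (tshift_act_gen false).
- exact: (hK false).
- exact: (hK true).
Qed.

Lemma all_of_tabT N z : is_subspace N ->
  (forall g x, valid_gen n g -> N x -> N (act g x)) ->
  (forall f x, N x -> N (tshift f x)) -> N (T z) -> forall x, N x.
Proof.
move=> Ns Na Nf; exact: (all_of_tableau tabT_tau tabDT_tau tabT_span proj_oriented
  proj_linear projT projDT tshift_linear tshiftT tshiftDT act_linear actT_gen actDT
  (act_genK false) Ns Na Nf).
Qed.

Lemma all_of_nontrivial N K x : is_subspace N ->
  (forall g x, valid_gen n g -> N x -> N (act g x)) ->
  (forall f x, N x -> N (tshift f x)) -> is_subspace K -> (forall x, K x -> N x) ->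
  (forall f x, K (tshift f x - x)) -> N x -> ~ K x -> forall y, N y.
Proof.
move=> Ns Na Nf Ks KN Kf Nx nKx; apply: (all_of_outside tabT_tau tabDT_tau tabT_span proj_oriented
  proj_linear projT projDT tshift_linear tshiftT tshiftDT act_linear actT_gen actDT
  (act_genK false) Ns Na Nf Ks KN Kf Nx nKx).
Qed.

End TableauSpace.

(* It vanishes at (k, i) and (k, j), where shifts by m are trivial. *)
Definition unit_shift (a s : nat) : lattice :=
  [ffun p => ((pos_row p, pos_col p) == (a, s))%:R].

Definition chain_shift (p : rpos n k i j) : lattice :=
  - \sum_(chain_start v (pos_row p) (pos_col p) <= a < (pos_row p).+1) unit_shift a (pos_col p).

Lemma lat_unit_shift a s : lat (unit_shift a s) = delta n m k i j a s *+ m.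
Proof.
have e (z : GTindex n m k i j) (l : nat) : z *+ l = (z.1 *+ l, z.2 *+ l).
  by elim: l => [|l IH]; rewrite ?mulr0n // !mulrS IH.
have mZ (x : 'Z_m) : x *+ m = 0 by rewrite -mulr_natr pchar_Zp ?mulr0 // ltnW.
have e2 (x : 'Z_m * 'Z_m) (l : nat) : x *+ l = (x.1 *+ l, x.2 *+ l).
  by elim: l => [|l IH]; rewrite ?mulr0n // !mulrS IH.
rewrite e e2 !mZ; congr pair; apply/ffunP => p.
have h (x : int) : x * m%:Z = x *+ m by rewrite -mulr_natr natz.
by rewrite ffunMnE !ffunE h.
Qed.

Lemma chain_start_le r s : (chain_start v r s <= r)%N.
Proof. by elim: r => //= r IH; case: ifP => // _; apply: leqW. Qed.

Lemma tab_chainE p : tab_chain m v p = tabT R (lat (chain_shift p)).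
Proof.
have latN f : lat (- f) = - lat f :> GTindex n m k i j.
  by apply/eqP; rewrite -subr_eq0 opprK -latD addNr lat0.
rewrite /tab_chain /chain_shift latN; congr (tabT R (- _)).
rewrite (big_morph (lat) (latD) (lat0)).
by apply: eq_bigr => a _; rewrite lat_unit_shift.
Qed.

(** Triangularity: up to sign, the chain at p is the unit shift at p plus unit shifts in lower rows
    of the same column. Induction on the row recovers the unit shifts. *)
Lemma chain_shift_gen (D : lattice -> Prop) : D 0 ->
  (forall f f', D f -> D f' -> D (f - f')) -> (forall p, D (chain_shift p)) -> forall f, D f.
Proof.
move=> D0 DB Dc.
have DN f : D f -> D (- f) by move=> Df; rewrite -sub0r; apply: DB.
have DD f f' : D f -> D f' -> D (f + f') by move=> Df Df'; rewrite -[f']opprK; apply/DB/DN.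
have Dsum (J : eqType) (s : seq J) (F : J -> lattice) : (forall x, x \in s -> D (F x)) -> D (\sum_(x <- s) F x).
  by move=> h; rewrite big_seq; elim/big_rec: _ => // x f xs; apply/DD/h.
have Du a : forall s, D (unit_shift a s).
  have [l] := ubnP a; elim: l a => // l IH a al s.
  case: (pickP (fun p : rpos n k i j => (pos_row p, pos_col p) == (a, s))) => [p /eqP[ea es]|np]; last first.
    have -> // : unit_shift a s = 0 by apply/ffunP => p; rewrite !ffunE np.
  subst a s; have := Dc p; rewrite /chain_shift big_nat_recr ?chain_start_le //= => /DN; rewrite opprK => h.
  rewrite -[unit_shift _ _](addKr (\sum_(chain_start v (pos_row p) (pos_col p) <= a0 < pos_row p)
    unit_shift a0 (pos_col p))) addrC; apply: DB => //.
  apply: Dsum => a'; rewrite mem_index_iota => /andP[_ a'p]; apply: IH.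
  exact: leq_trans a'p al.
move=> f; have -> : f = \sum_(p : rpos n k i j) unit_shift (pos_row p) (pos_col p) *~ f p.
  apply/ffunP => p; rewrite sum_ffunE (bigD1 p) //= big1 ?addr0 => [|p' pp'].
    by rewrite ffunMzE ffunE eqxx -[RHS]/((f p)%:~R) intz.
  rewrite ffunMzE ffunE; case: eqP => [[e1 e2]|_]; last by rewrite mul0rz.
  by case/eqP: pp'; apply: pos_inj; rewrite (e1, e2).
apply: Dsum => p _.
have DM (g : lattice) (l : nat) : D g -> D (g *+ l).
  by move=> Dg; elim: l => [|l IH]; rewrite ?mulr0n // mulrS; apply: DD.
by case: (f p) => l; [rewrite -pmulrn | rewrite NegzE mulrNz -pmulrn; apply: DN]; apply/DM/Du.
Qed.

End Tableaux.

Theorem theorem3p14 (R : realType) (n m k i j : nat) (v : nat -> nat -> R[i])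
  (hn : (3 <= n)%N) (hm : (3 <= m)%N) (hodd : odd m)
  (hsing : one_singular n k i j v) (hconv : GT_convention n v)
  (hnorm : v k i = v k j)
  (act : Ugen -> VT R n m k i j -> VT R n m k i j)
  (hact : is_GT_action v act) (actP : is_Uq_action n (qroot R m) act)
  (hchains : chains_in_UqT v actP)
  (W : rpos n k i j -> Uq_submodule (UqT actP))
  (hchoice : W_choice v W)
  (hW : forall p : rpos n k i j, W p = W1 v actP p) :
  Uq_simple (Vbar W).
Proof.
have [i_gt0 ij jk kn [_ v_reg]] := hsing.
have act_lin g (vg : valid_gen n g) : linear (act g) := Uq_linear actP vg.
have -> : W = W1 v actP by apply/funext.
pose phi : VT R n m k i j -> R[i] := @VTlift R n m k i j (R[i])^o (fun=> 1) (fun=> 0).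
have ft (z : GTindex n m k i j) : 1 = 1 :> (R[i])^o by [].
have gt (z : GTindex n m k i j) : 0 = - 0 :> (R[i])^o by rewrite oppr0.
have phi_lin : scalar phi := VTlift_linear ft gt.
have phi_T z : phi (tabT R z) = 1 := VTliftT ft gt z.
have phi_DT z : phi (tabDT R z) = 0 := VTliftDT ft gt z.
have phi_S f x : phi (tshift f x) = phi x.
  apply: (@VT_linear_ext R n m k i j (R[i])^o (fun x => phi (tshift f x)) phi).
  - exact: linear_comp phi_lin (tshift_linear f).
  - exact: phi_lin.
  - by move=> z; rewrite tshiftT !phi_T.
  - by move=> z; rewrite tshiftDT !phi_DT.
apply: (@simple_quotient _ n (qroot R m) (VT_module actP) {ffun rpos n k i j -> int}
  (@tshift R n m k i j) (tabT R 0) (rpos n k i j) (@chain_shift R n k i j v)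
  (fun p => tab_chain m v p - tabT R 0) phi).
- exact: tshift_linear.
- exact: tshift0.
- exact: tshiftD.
- by move=> g f x vg; apply: (tshift_act hm i_gt0 ij jk kn hact act_lin).
- by move=> p; rewrite tshiftT add0r tab_chainE.
- exact: chain_shift_gen.
- exact: phi_lin.
- exact: phi_S.
- by rewrite phi_T oner_neq0.
- move=> N [Nsub Na Ns].
  exact: (all_of_tabT hm hodd i_gt0 ij jk kn hnorm v_reg hact act_lin Nsub Na Ns).
- move=> N K [Nsub Na Ns] Ksub KN Ks [x [Nx nKx]].
  exact: (all_of_nontrivial hm hodd i_gt0 ij jk kn hnorm v_reg hact act_lin Nsub Na Ns
    Ksub KN Ks Nx nKx).
exact: hchains.
Qed.
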